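(* Let arbitrary constants $\omega,k,q,\delta>0$ be given and let $R>0$ be the constant defined in the context. Let arbitrary $r\in[0,R)$ be given and assume that $k<q\,\theta(r)$, where $$\theta(r):=\frac{\omega g\mu\delta\pi^2Q_1(r)}{g\mu\delta\pi^2Q_1(r)+2\omega L\left(mgLH_{\max}(\delta+1)^2+2\mu^2\delta\pi^2Q_1(r)\right)}.$$ Then there exist constants $M,\lambda>0$ with the following property: every classical solution (in the sense of the context) of the tank-liquid system $$\dot\xi=w,\qquad \dot w=-f,\qquad t\ge 0,$$ $$h_t+(hv)_x=0,\qquad t>0,\ x\in[0,L],$$ $$(hv)_t+\left(hv^2+\tfrac12 gh^2\right)_x-\sigma h\left(\frac{h_{xx}}{(1+h_x^2)^{3/2}}\right)_x=\mu(hv_x)_x+hf,\qquad t>0,\ x\in(0,L),$$ $$v(t,0)=v(t,L)=0,\qquad h_x(t,0)=h_x(t,L)=0,\qquad \int_0^Lh(t,x)\,dx=m,\qquad t\ge0,$$ in closed loop with the feedback law $$f(t)=-\omega\left((\delta+1)\int_0^Lh(t,x)v(t,x)\,dx+\mu\big(h(t,L)-h(t,0)\big)-q\big(w(t)+k\xi(t)\big)\right),\qquad t>0,$$ and with $(\xi(0),w(0),h[0],v[0])\in X_V(r)$, satisfies $(\xi(t),w(t),h[t],v[t])\in X_V(r)$ and $$\left\|\left(\xi(t),w(t),h[t]-h^*\chi_{[0,L]},v[t]\right)\right\|_X\le M\exp(-\lambda t)\left\|\left(\xi(0),w(0),h[0]-h^*\chi_{[0,L]},v[0]\right)\right\|_X$$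 for all $t\ge0$.
   Context: Constants: $g,\mu,\sigma,L,m,H_{\max}>0$ are given, $h^*:=m/L$, and it is assumed that $h^*<H_{\max}$. $\chi_{[0,L]}$ is the characteristic function of $[0,L]$, $\|\cdot\|_2$ is the norm of $L^2(0,L)$, $u[t]$ denotes the profile $x\mapsto u(t,x)$, and for a function of one variable $'$ denotes the derivative. Classical solution: functions $\xi\in C^2(\mathbb R_+)$, $w\in C^1(\mathbb R_+)$, $h\in C^1([0,\infty)\times[0,L];(0,\infty))\cap C^3((0,\infty)\times(0,L))$, $v\in C^0([0,\infty)\times[0,L])\cap C^1((0,\infty)\times[0,L])$ with $v[t]\in C^2((0,L))$ for each $t>0$, which satisfy all the equations of the system with an input $f\in C^0(\mathbb R_+)$; here $\mathbb R_+=[0,\infty)$. (For $A$ with $S\subseteq A\subseteq cl(S)$, $S$ open, $C^k(A)$ is the class of functions having continuous derivatives of order $k$ in the interior $S$ that can be continued continuously to all points of $\partial S\cap A$.) The set $S$: $(\xi,w,h,v)\in S$ iff $(\xi,w)\in\mathbb R^2$, $h\in C^0([0,L];(0,\infty))\cap H^1(0,L)$, $v\in C^0([0,L])$, $\int_0^Lh(x)\,dx=m$, $v(0)=v(L)=0$. Norm: $\|(\xi,w,h,v)\|_X=\left(\xi^2+w^2+\|h\|_2^2+\|h'\|_2^2+\|v\|_2^2\right)^{1/2}$. Functionals on $S$: $$E(h,v):=\tfrac12\int_0^Lhv^2dx+\tfrac g2\|h-h^*\chi_{[0,L]}\|_2^2+\sigma\int_0^L\left(\sqrt{1+(h')^2}-1\right)dx,$$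 $$W(h,v):=\tfrac12\int_0^Lh^{-1}(hv+\mu h')^2dx+\tfrac g2\|h-h^*\chi_{[0,L]}\|_2^2+\sigma\int_0^L\left(\sqrt{1+(h')^2}-1\right)dx,$$ $$V(\xi,w,h,v):=\delta E(h,v)+W(h,v)+\tfrac{qk^2}{2}\xi^2+\tfrac q2(w+k\xi)^2.$$ For $r\ge0$: $X_V(r):=\{(\xi,w,h,v)\in S: V(\xi,w,h,v)\le r\}$. The function $Q_1$: let $G:\mathbb R\to\mathbb R$ be the increasing function $G(h):=\mathrm{sgn}(h-h^* )\left(\frac23h\sqrt h-2h^*\sqrt h+\frac43h^*\sqrt{h^*}\right)$ for $h>0$ and $G(h):=-\frac43h^*\sqrt{h^*}+h$ for $h\le0$, with inverse $G^{-1}:\mathbb R\to\mathbb R$ and let $c:=\frac1{\mu\sqrt{\delta g}}$. For $s\ge0$, $$Q_1(s):=\max\left(G^{-1}(-cs),\ h^*-\sqrt{\tfrac{2m(1+\delta)s}{\delta\mu^2}},\ h^*-\sqrt{\left(\tfrac{s}{\sigma(\delta+1)}+L\right)^2-L^2}\right).$$ The constant $R$: $$R:=\frac{2\mu\sqrt{\delta gh^*}}{3}(H_{\max}-h^* )\min(\zeta_1,\zeta_2),\quad \zeta_1:=\max(\Gamma_1,\Gamma_2,\Gamma_3),\quad \zeta_2:=\frac{h^*}{H_{\max}-h^*}\max(2,\Delta_1,\Delta_2),$$ $$\Gamma_1:=\sqrt{\frac{H_{\max}}{h^*}}-\frac{2\sqrt{h^*}}{\sqrt{H_{\max}}+\sqrt{h^*}},\quad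 \Gamma_2:=\frac{3\mu\sqrt\delta(H_{\max}-h^* )}{4m(1+\delta)\sqrt{gh^*}},\quad \Gamma_3:=\frac{3\sigma(\delta+1)\left(\sqrt{L^2+(H_{\max}-h^* )^2}-L\right)}{2\mu\sqrt{\delta gh^*}(H_{\max}-h^* )},$$ $$\Delta_1:=\frac{3\mu\sqrt\delta}{4L\sqrt{gh^*}(1+\delta)},\quad \Delta_2:=\frac{3\sigma(\delta+1)\sqrt{h^*}}{2\mu\sqrt{\delta g}\left(\sqrt{(h^* )^2+L^2}+L\right)}.$$ *)

(* Defs.v *)
From HB Require Import structures.
From mathcomp Require Import all_boot all_order all_algebra.
From mathcomp Require Import all_classical all_reals all_analysis.
Set Implicit Arguments.
Unset Strict Implicit.
Unset Printing Implicit Defensive.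
Import Order.TTheory GRing.Theory Num.Theory.
Import numFieldNormedType.Exports.
Local Open Scope classical_set_scope.
Local Open Scope ring_scope.

Definition integral_0L (R : realType) (L : R) (f : R -> R) : R :=
  \int[lebesgue_measure]_(x in `[0, L]) f x.

(* For S open and S `<=` A `<=` closure S, a function of class C^k on A is
   continuous on A and has derivatives of order <= k in the interior that are
   continuous there and continue continuously to A. The values of [f] outside
   the interior of [A] are irrelevant here: [derive1] is junk at boundary
   points. *)
Definition extends_to (R : realType) (T : topologicalType) (A : set T)
    (f : T -> R) : Prop :=
  exists2 g : T -> R, {within A, continuous g} & forall p, A° p -> g p = f p.

(* The continuous continuation to A of a function given on the interior of A;
   derivatives at boundary points are read this way. *)
Definition extension (R : realType) (T : topologicalType) (A : set T)
    (f : T -> R) (p : T) : R :=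
  lim (f y @[y --> within A° (nbhs p)]).

Fixpoint derivatives_extend1 (R : realType) (k : nat) (A : set R)
    (f : R -> R) : Prop :=
  extends_to A f /\
  if k is k'.+1 then
    (forall x : R, A° x -> derivable f x 1) /\
    derivatives_extend1 k' A (derive1 f)
  else True.

Definition C1d (R : realType) (k : nat) (A : set R) (f : R -> R) : Prop :=
  {within A, continuous f} /\ derivatives_extend1 k A f.

Definition uncurry2 (R : realType) (u : R -> R -> R) (p : R * R) : R :=
  u p.1 p.2.

Definition extension2 (R : realType) (A : set (R * R)) (u : R -> R -> R)
    (t x : R) : R :=
  extension A (uncurry2 u) (t, x).

Definition dt (R : realType) (u : R -> R -> R) (t x : R) : R :=
  derive1 (fun s => u s x) t.

Definition dx (R : realType) (u : R -> R -> R) (t x : R) : R :=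
  derive1 (u t) x.

Fixpoint derivatives_extend2 (R : realType) (k : nat) (A : set (R * R))
    (u : R -> R -> R) : Prop :=
  extends_to A (uncurry2 u) /\
  if k is k'.+1 then
    [/\ forall t x : R, A° (t, x) ->
          derivable (fun s => u s x) t 1 /\ derivable (u t) x 1,
        derivatives_extend2 k' A (dt u) &
        derivatives_extend2 k' A (dx u)]
  else True.

Definition C2d (R : realType) (k : nat) (A : set (R * R))
    (u : R -> R -> R) : Prop :=
  {within A, continuous (uncurry2 u)} /\ derivatives_extend2 k A u.

Definition L2 (R : realType) (L : R) (f : R -> R) : Prop :=
  f \_ `]0, L[ \in Lfun (@lebesgue_measure R) 2%:E.

Definition L2norm (R : realType) (L : R) (f : R -> R) : R :=
  fine (Lnorm (@lebesgue_measure R) 2%:E (EFin \o f \_ `]0, L[)).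

(* C^1_c(0,L); by mollification it yields the same weak derivatives as
   C^oo_c(0,L). *)
Definition test_function (R : realType) (L : R) (phi : R -> R) : Prop :=
  [/\ forall x : R, derivable phi x 1, continuous (derive1 phi) &
      exists a b : R, [/\ 0 < a, b < L &
        forall x : R, x \notin `[a, b] -> phi x = 0]].

Definition is_weak_derivative (R : realType) (L : R) (f p : R -> R) : Prop :=
  forall phi : R -> R, test_function L phi ->
    integral_0L L (fun x => f x * derive1 phi x) =
    - integral_0L L (fun x => p x * phi x).

Definition H1 (R : realType) (L : R) (f : R -> R) : Prop :=
  L2 L f /\ exists p, L2 L p /\ is_weak_derivative L f p.

(* A representative; it is unique up to equality almost everywhere on (0,L). *)
Definition weak_derivative (R : realType) (L : R) (f : R -> R) : R -> R :=
  xget (fun=> 0) [set p | L2 L p /\ is_weak_derivative L f p].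

Definition in_S (R : realType) (L m : R) (xi w : R) (h v : R -> R) : Prop :=
  [/\ {within `[0, L], continuous h} /\ (forall x : R, x \in `[0, L] -> 0 < h x),
      H1 L h,
      {within `[0, L], continuous v},
      integral_0L L h = m &
      v 0 = 0 /\ v L = 0].

Definition Xnorm (R : realType) (L : R) (xi w : R) (h v : R -> R) : R :=
  Num.sqrt (xi ^+ 2 + w ^+ 2 + L2norm L h ^+ 2 +
            L2norm L (weak_derivative L h) ^+ 2 + L2norm L v ^+ 2).

(* m / L is the equilibrium level h^*. *)
Definition potential (R : realType) (g sigma L m : R) (h : R -> R) : R :=
  g / 2 * L2norm L (fun x => h x - m / L) ^+ 2 +
  sigma * integral_0L L
    (fun x => Num.sqrt (1 + weak_derivative L h x ^+ 2) - 1).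

Definition E_fun (R : realType) (g sigma L m : R) (h v : R -> R) : R :=
  1 / 2 * integral_0L L (fun x => h x * v x ^+ 2) + potential g sigma L m h.

Definition W_fun (R : realType) (g mu sigma L m : R) (h v : R -> R) : R :=
  1 / 2 * integral_0L L
    (fun x => (h x)^-1 * (h x * v x + mu * weak_derivative L h x) ^+ 2) +
  potential g sigma L m h.

Definition V_fun (R : realType) (g mu sigma L m k q delta : R)
    (xi w : R) (h v : R -> R) : R :=
  delta * E_fun g sigma L m h v + W_fun g mu sigma L m h v +
  q * k ^+ 2 / 2 * xi ^+ 2 + q / 2 * (w + k * xi) ^+ 2.

Definition in_X_V (R : realType) (g mu sigma L m k q delta r : R)
    (xi w : R) (h v : R -> R) : Prop :=
  in_S L m xi w h v /\ V_fun g mu sigma L m k q delta xi w h v <= r.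

Definition G_fun (R : realType) (hs h : R) : R :=
  if 0 < h then
    Num.sg (h - hs) * (2 / 3 * h * Num.sqrt h - 2 * hs * Num.sqrt h
                       + 4 / 3 * hs * Num.sqrt hs)
  else - (4 / 3 * hs * Num.sqrt hs) + h.

Definition G_inv (R : realType) (hs : R) : R -> R :=
  'pinv_(fun=> 0) [set: R] (G_fun hs).

Definition Q1 (R : realType) (g mu sigma L m delta s : R) : R :=
  let hs := m / L in
  let c := 1 / (mu * Num.sqrt (delta * g)) in
  Num.max (G_inv hs (- (c * s)))
    (Num.max (hs - Num.sqrt (2 * m * (1 + delta) * s / (delta * mu ^+ 2)))
             (hs - Num.sqrt ((s / (sigma * (delta + 1)) + L) ^+ 2 - L ^+ 2))).

Definition theta (R : realType) (g mu sigma L m Hmax omega delta r : R) : R :=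
  let Q := Q1 g mu sigma L m delta r in
  omega * g * mu * delta * pi ^+ 2 * Q /
  (g * mu * delta * pi ^+ 2 * Q +
   2 * omega * L * (m * g * L * Hmax * (delta + 1) ^+ 2 +
                    2 * mu ^+ 2 * delta * pi ^+ 2 * Q)).

Definition R_const (R : realType) (g mu sigma L m Hmax delta : R) : R :=
  let hs := m / L in
  let Gamma1 := Num.sqrt (Hmax / hs) -
    2 * Num.sqrt hs / (Num.sqrt Hmax + Num.sqrt hs) in
  let Gamma2 := 3 * mu * Num.sqrt delta * (Hmax - hs) /
    (4 * m * (1 + delta) * Num.sqrt (g * hs)) in
  let Gamma3 :=
    3 * sigma * (delta + 1) * (Num.sqrt (L ^+ 2 + (Hmax - hs) ^+ 2) - L) /
    (2 * mu * Num.sqrt (delta * g * hs) * (Hmax - hs)) in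
  let Delta1 := 3 * mu * Num.sqrt delta /
    (4 * L * Num.sqrt (g * hs) * (1 + delta)) in
  let Delta2 := 3 * sigma * (delta + 1) * Num.sqrt hs /
    (2 * mu * Num.sqrt (delta * g) * (Num.sqrt (hs ^+ 2 + L ^+ 2) + L)) in
  let zeta1 := Num.max Gamma1 (Num.max Gamma2 Gamma3) in
  let zeta2 := hs / (Hmax - hs) * Num.max 2 (Num.max Delta1 Delta2) in
  2 * mu * Num.sqrt (delta * g * hs) / 3 * (Hmax - hs) * Num.min zeta1 zeta2.

Record classical_solution (R : realType) (g mu sigma L m : R)
    (xi w : R -> R) (h v : R -> R -> R) (f : R -> R) : Prop :=
  ClassicalSolution {
  input_C0 : C1d 0 `[0, +oo[ f;
  xi_C2 : C1d 2 `[0, +oo[ xi;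
  w_C1 : C1d 1 `[0, +oo[ w;
  h_C1 : C2d 1 (`[0, +oo[ `*` `[0, L]) h;
  h_C3 : C2d 3 (`]0, +oo[ `*` `]0, L[) h;
  h_gt0 : forall t x : R, 0 <= t -> 0 <= x <= L -> 0 < h t x;
  v_C0 : C2d 0 (`[0, +oo[ `*` `[0, L]) v;
  v_C1 : C2d 1 (`]0, +oo[ `*` `[0, L]) v;
  v_C2 : forall t : R, 0 < t -> C1d 2 `]0, L[ (v t);
  tank_position : forall t : R, 0 <= t -> extension (`[0, +oo[ : set R) (derive1 xi) t =
    w t;
  tank_velocity : forall t : R, 0 <= t -> extension (`[0, +oo[ : set R) (derive1 w) t =
    - f t;
  continuity_equation : forall t x : R, 0 < t -> 0 <= x <= L ->
    extension2 (`]0, +oo[ `*` `[0, L]) (dt h) t x +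
    extension2 (`]0, +oo[ `*` `[0, L])
      (dx (fun t x : R => h t x * v t x)) t x = 0;
  momentum_equation : forall t x : R, 0 < t -> 0 < x < L ->
    dt (fun t x : R => h t x * v t x) t x +
    dx (fun t x : R => h t x * v t x ^+ 2 + 1 / 2 * g * h t x ^+ 2) t x -
    sigma * h t x *
      dx (fun t x : R => dx (dx h) t x / (1 + dx h t x ^+ 2) `^ (3 / 2)) t x =
    mu * dx (fun t x : R => h t x * dx v t x) t x + h t x * f t;
  no_flux : forall t : R, 0 <= t -> v t 0 = 0 /\ v t L = 0;
  right_contact_angle : forall t : R, 0 <= t ->
    extension2 (`[0, +oo[ `*` `[0, L]) (dx h) t 0 = 0 /\
    extension2 (`[0, +oo[ `*` `[0, L]) (dx h) t L = 0;
  total_mass : forall t : R, 0 <= t -> integral_0L L (h t) = m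
}.

Definition feedback_law (R : realType) (mu L omega k q delta : R)
    (xi w : R -> R) (h v : R -> R -> R) (f : R -> R) : Prop :=
  forall t : R, 0 < t ->
    f t = - (omega * ((delta + 1) * integral_0L L (fun x => h t x * v t x) +
                      mu * (h t L - h t 0) - q * (w t + k * xi t))).

(* Main.v *)
Require Import Defs.
From HB Require Import structures.
From mathcomp Require Import all_boot all_order all_algebra.
From mathcomp Require Import all_classical all_reals all_analysis.
From mathcomp Require Import measurable_realfun ring lra.
Set Implicit Arguments.
Unset Strict Implicit.
Unset Printing Implicit Defensive.
Import Order.TTheory GRing.Theory Num.Theory.
Import numFieldNormedType.Exports.
Local Open Scope classical_set_scope.
Local Open Scope ring_scope.

(** The functional V is a Lyapunov function. Along a solution the energy E
    loses the viscous dissipation, the integral of mu h v_x^2. The functional W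
    is the energy of the flow with the velocity u = v + mu h_x / h; by the mass
    equation, N = h u obeys a momentum equation without viscosity, and W loses
    mu g times the integral of h_x^2 together with a nonnegative capillary
    term. So delta E + W has the dissipation rate
    D = delta mu int h v_x^2 + mu g int h_x^2 ([E_balance], [W_balance]), and it
    is fed with power f Phi by the tank, where
    Phi = (delta + 1) int h v + mu (h(L) - h(0)). As long as the height stays
    between two positive bounds, the Wirtinger inequality ([poincare]) and the
    Cauchy-Schwarz inequality give Phi^2 <= C D and delta E + W <= C' D
    ([input_sqr_le], [energy_le]). The feedback law contains Phi with the right
    sign; by the condition k < q theta(r) the remaining power
    k q (w + k xi)^2 is absorbed ([feedback_power], [theta_inv]). Hence
    V' <= - 2 lambda V.

    The height is controlled by V itself. Three lower bounds for the energy
    density in terms of h and h_x show that V <= s confines the height to an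
    interval ([height_bound_G], [height_bound_viscous],
    [height_bound_surface]); Q_1(s) is its lower end, and s < R means that
    Q_1(s) > 0 and that the upper end lies below Hmax ([Q1_gt0], [lt_Hmax]). The
    estimate V' <= - 2 lambda V needs the bounds on the height, and these need
    V <= r; a continuation argument in time closes the circle
    ([continuous_induction]). It needs some room below Q_1(r), which the
    definition of theta provides ([floor_height]).

    The regularity of a classical solution does not justify integrating the
    balance laws by parts: h_xx, h_xt and v_xx need not extend to the walls.
    Instead the local laws are integrated over slightly shorter segments
    ([dissipation]). The fluxes have v or h_x as a factor in each term, and
    both vanish at the walls; the other factors are bounded, the only delicate
    one being the curvature, which the momentum equation controls together
    with v_x ([curv_bounded]).

    Finally V is compared with the square of the norm ([total_ge], [total_le]).
    The weak derivative in the norm and in V agrees almost everywhere with the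
    classical one ([weak_derivativeE]). *)

(** * Continuity on a set *)

Section within_algebra.
Context {R : realType} {T : topologicalType}.
Implicit Types (A : set T) (f g : T -> R).

Lemma within_cst A (c : R) : {within A, continuous (fun _ : T => c)}.
Proof. by move=> x; exact: cvg_cst. Qed.

Lemma withinD A f g : {within A, continuous f} -> {within A, continuous g} ->
  {within A, continuous (fun x => f x + g x)}.
Proof. by move=> cf cg x; apply: (@cvgD _ _ _ _ _ f g); [exact: cf|exact: cg]. Qed.

Lemma withinN A f : {within A, continuous f} ->
  {within A, continuous (fun x => - f x)}.
Proof. by move=> cf x; apply: (@cvgN _ _ _ _ _ f); exact: cf. Qed.

Lemma withinB A f g : {within A, continuous f} -> {within A, continuous g} ->
  {within A, continuous (fun x => f x - g x)}.
Proof. by move=> cf cg; apply: withinD => //; exact: withinN. Qed.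

Lemma withinM A f g : {within A, continuous f} -> {within A, continuous g} ->
  {within A, continuous (fun x => f x * g x)}.
Proof. by move=> cf cg x; apply: (@cvgM _ _ _ _ f g); [exact: cf|exact: cg]. Qed.

Lemma withinX A f n : {within A, continuous f} ->
  {within A, continuous (fun x => f x ^+ n)}.
Proof.
move=> cf; elim: n => [|n IH].
  by under eq_fun do rewrite expr0; exact: within_cst.
by under eq_fun do rewrite exprS; exact: withinM.
Qed.

Lemma within_comp A f (h : R -> R) : {within A, continuous f} ->
  (forall x, A x -> {for f x, continuous h}) ->
  {within A, continuous (fun x => h (f x))}.
Proof.
move=> /subspace_continuousP cf ch; apply/subspace_continuousP => x Ax.
exact: cvg_comp (cf x Ax) (ch x Ax).
Qed.

Lemma withinV A f : (forall x, A x -> f x != 0) -> {within A, continuous f} ->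
  {within A, continuous (fun x => (f x)^-1)}.
Proof. by move=> f0 cf; apply: within_comp => // x Ax; exact/inv_continuous/f0. Qed.

Lemma within_sqrt A f : {within A, continuous f} ->
  {within A, continuous (fun x => Num.sqrt (f x))}.
Proof. by move=> cf; apply: within_comp => // x _; exact: sqrt_continuous. Qed.

Lemma within_norm A f : {within A, continuous f} ->
  {within A, continuous (fun x => `|f x|)}.
Proof. by move=> cf; apply: within_comp => // x _; exact: norm_continuous. Qed.

Lemma within_ext A f g : (forall x, A x -> f x = g x) ->
  {within A, continuous f} -> {within A, continuous g}.
Proof. by move=> fg; apply: subspace_eq_continuous => x /set_mem; exact: fg. Qed.
End within_algebra.

Lemma within_id {R : realType} (A : set R) : {within A, continuous (fun x : R => x)}.
Proof. by apply: continuous_subspaceT => x; exact: cvg_id. Qed.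

(** Hypotheses are first compared syntactically: conversion would unfold
    every compound function on the way. *)
Ltac within_tac := repeat first
  [ match goal with
    | H : {within ?A, continuous ?f} |- {within ?A, continuous ?f} => exact H
    | |- {within _, continuous (fun y => _ + _)} => apply: withinD
    | |- {within _, continuous (fun y => - _)} => apply: withinN
    | |- {within _, continuous (fun y => _ * _)} => apply: withinM
    | |- {within _, continuous (fun y => _ ^+ _)} => apply: withinX
    | |- {within _, continuous (fun y => Num.sqrt _)} => apply: within_sqrt
    | |- {within _, continuous (fun y => `|_|)} => apply: within_norm
    | |- {within _, continuous (fun y => ?c)} => exact: within_cst
    | |- {within _, continuous (fun y => y)} => exact: within_id
    | |- {within _, continuous -%R} => exact: (withinN (@within_id _ _))
    | |- {within _, continuous ( +%R ?a)} =>
        exact: (withinD (@within_cst _ _ _ a) (@within_id _ _))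
    | |- {within _, continuous ( *%R ?a)} =>
        exact: (withinM (@within_cst _ _ _ a) (@within_id _ _))
    | |- {within _, continuous Num.sqrt} => exact: (within_sqrt (@within_id _ _))
    | |- {within _, continuous _} => exact: within_id
    end
  | eassumption ].

(** * Integrals of continuous functions on a segment *)

Section integral_1d.
Context {R : realType}.
Implicit Types (a b c x : R) (f g F w : R -> R).
Local Notation mu := (@lebesgue_measure R).
Local Notation itg a b f := (\int[lebesgue_measure]_(x in `[a, b]) f x).
Local Notation cont a b f := {within `[a, b], continuous f}.

Lemma cont_integrable a b f : cont a b f -> mu.-integrable `[a, b] (EFin \o f).
Proof. by move=> cf; apply: continuous_compact_integrable => //; exact: segment_compact. Qed.

Lemma itg_le a b f g : cont a b f -> cont a b g ->
  (forall x, a <= x <= b -> f x <= g x) -> itg a b f <= itg a b g.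
Proof.
move=> cf cg fg; apply: le_Rintegral => //; exact: cont_integrable.
Qed.

Lemma itgD a b f g : cont a b f -> cont a b g ->
  itg a b (fun x => f x + g x) = itg a b f + itg a b g.
Proof. by move=> cf cg; apply: RintegralD => //; exact: cont_integrable. Qed.

Lemma itgB a b f g : cont a b f -> cont a b g ->
  itg a b (fun x => f x - g x) = itg a b f - itg a b g.
Proof. by move=> cf cg; apply: RintegralB => //; exact: cont_integrable. Qed.

Lemma itgZ a b (k : R) f : cont a b f -> itg a b (fun x => k * f x) = k * itg a b f.
Proof. by move=> cf; apply: RintegralZl => //; exact: cont_integrable. Qed.

Lemma itgN a b f : cont a b f -> itg a b (fun x => - f x) = - itg a b f.
Proof.
move=> cf; rewrite -[RHS]mulN1r -itgZ//.
by congr Rintegral; apply/funext => x; rewrite mulN1r.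
Qed.

Lemma itg_cst a b (k : R) : a <= b -> itg a b (fun=> k) = k * (b - a).
Proof.
move=> ab; rewrite Rintegral_cst//= lebesgue_measure_itv /= lte_fin.
have [ab'|ba] := ltP a b; first by rewrite -EFinD.
have -> : a = b by apply/le_anti; rewrite ab ba.
by rewrite subrr.
Qed.

Lemma itg_ge0 a b f : (forall x, a <= x <= b -> 0 <= f x) -> 0 <= itg a b f.
Proof. by move=> f0; apply: Rintegral_ge0 => x /=; rewrite in_itv /=; exact: f0. Qed.

Lemma eq_itg a b f g : (forall x, a <= x <= b -> f x = g x) -> itg a b f = itg a b g.
Proof. by move=> fg; apply: eq_Rintegral => x /set_mem /=; rewrite in_itv /=; exact: fg. Qed.

Lemma contW a b c d f : a <= c -> d <= b -> cont a b f -> cont c d f.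
Proof.
move=> ac db; apply: continuous_subspaceW => x /=; rewrite !in_itv /=.
by move=> /andP[cx xd]; rewrite (le_trans ac cx) (le_trans xd db).
Qed.

Lemma itg_split a b c f : a <= c -> c <= b -> cont a b f ->
  itg a b f = itg a c f + itg c b f.
Proof.
move=> ac cb cf; apply/eqP; rewrite addrC -subr_eq; apply/eqP.
rewrite Rintegral_itvB; [|exact: cont_integrable|by rewrite bnd_simp..].
rewrite Rintegral_itv_obnd_cbnd//.
apply: (@integrableS _ _ _ mu `[a, b]) => //; last exact: cont_integrable.
by apply: subset_itv; rewrite bnd_simp.
Qed.

Lemma itg_norm_le a b f (M : R) : a <= b -> cont a b f ->
  (forall x, a <= x <= b -> `|f x| <= M) -> `|itg a b f| <= M * (b - a).
Proof.
move=> ab cf fM; apply: le_trans (le_normr_Rintegral _ _) _ => //.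
  exact: cont_integrable.
by rewrite -itg_cst//; apply: itg_le => //; within_tac.
Qed.

Lemma cont_for a b f x : cont a b f -> a < x < b -> {for x, continuous f}.
Proof.
move=> cf /andP[ax xb]; apply: (@within_continuous_continuous _ _ _ a b) => //.
  exact: lt_trans xb.
by rewrite in_itv /= ax xb.
Qed.

Lemma itg_continuous a b f : a <= b -> cont a b f -> cont a b (fun x => itg a x f).
Proof. by move=> ab cf; apply: parameterized_integral_continuous => //; exact: cont_integrable. Qed.

Lemma itg_derive a b f x : cont a b f -> a < x < b ->
  is_derive x 1 (fun y => itg a y f) (f x).
Proof.
move=> cf /[dup] axb /andP[ax xb].
have [dF Ff] := @continuous_FTC1_closed R f a x b xb (cont_integrable cf) ax (cont_for cf axb).
by rewrite -Ff derive1E; exact: derivableP.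
Qed.

Lemma derive_ge0_le a b F F' : a <= b -> cont a b F ->
  (forall x, a < x < b -> is_derive x 1 F (F' x)) ->
  (forall x, a < x < b -> 0 <= F' x) -> F a <= F b.
Proof.
rewrite le_eqVlt => /predU1P[->//|ab] cF dF F0.
have dF' x : x \in `]a, b[ -> is_derive x 1 F (F' x).
  by rewrite in_itv /=; exact: dF.
have [c cab E] := MVT ab dF' cF.
rewrite -subr_ge0 E mulr_ge0 ?subr_ge0 ?(ltW ab)//.
by apply: F0; move: cab; rewrite in_itv.
Qed.

(** The fundamental theorem of calculus with an inequality, which is what a
    local balance law provides. *)
Lemma itg_ge_diff a b f F F' : a <= b -> cont a b f -> cont a b F ->
  (forall x, a < x < b -> is_derive x 1 F (F' x)) ->
  (forall x, a < x < b -> F' x <= f x) -> F b - F a <= itg a b f.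
Proof.
move=> ab cf cF dF Ff; pose H x := itg a x f - F x.
have : H a <= H b.
  apply: (@derive_ge0_le a b H (fun x => f x - F' x)) => //.
  - apply: withinB => //; exact: itg_continuous.
  - move=> x xab; apply: is_deriveB; [exact: (itg_derive cf)|exact: dF].
  - by move=> x xab; rewrite subr_ge0 Ff.
by rewrite /H set_itv1 Rintegral_set1; lra.
Qed.

Lemma itg_le_diff a b f F F' : a <= b -> cont a b f -> cont a b F ->
  (forall x, a < x < b -> is_derive x 1 F (F' x)) ->
  (forall x, a < x < b -> f x <= F' x) -> itg a b f <= F b - F a.
Proof.
move=> ab cf cF dF Ff.
have := @itg_ge_diff a b (fun x => - f x) (fun x => - F x) (fun x => - F' x) ab.
rewrite itgN// => /(_ (withinN cf) (withinN cF)) h.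
suff : - F b - - F a <= - itg a b f by lra.
apply: h => x xab; first by apply: is_deriveN; exact: dF.
by rewrite lerN2 Ff.
Qed.

Lemma itg_ftc a b f F : a <= b -> cont a b f -> cont a b F ->
  (forall x, a < x < b -> is_derive x 1 F (f x)) -> itg a b f = F b - F a.
Proof.
move=> ab cf cF dF; apply/eqP; rewrite eq_le.
by rewrite (itg_le_diff ab cf cF dF)// (itg_ge_diff ab cf cF dF).
Qed.

(** The mean value theorem for the primitive of f. *)
Lemma itg0_root a b f : a < b -> cont a b f -> itg a b f = 0 ->
  exists2 c, a < c < b & f c = 0.
Proof.
move=> ab cf f0; have dI x : x \in `]a, b[ -> is_derive x 1 (fun y => itg a y f) (f x).
  by rewrite in_itv /=; exact: itg_derive.
have [c cab E] := MVT ab dI (itg_continuous (ltW ab) cf).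
exists c; first by move: cab; rewrite in_itv.
move/eqP: E; rewrite f0 set_itv1 Rintegral_set1 subrr eq_sym mulf_eq0 subr_eq0.
by rewrite (gt_eqF ab) orbF => /eqP.
Qed.

(** The total variation of F between x and y is at most the integral of w
    over the whole segment. *)
Lemma osc_le a b F F' w x y : a <= b -> cont a b F -> cont a b w ->
  (forall x, a < x < b -> is_derive x 1 F (F' x)) ->
  (forall x, a <= x <= b -> 0 <= w x) ->
  (forall x, a < x < b -> `|F' x| <= w x) ->
  a <= x <= b -> a <= y <= b -> `|F x - F y| <= itg a b w.
Proof.
move=> ab cF cw dF w0 Fw; wlog yx : x y / y <= x.
  move=> W xab yab; have [/W|/ltW /W] := leP y x; first exact.
  by rewrite distrC; exact.
move=> /andP[ax xb] /andP[ay yb].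
have sub z : y < z < x -> a < z < b.
  by move=> /andP[yz zx]; rewrite (le_lt_trans ay yz) (lt_le_trans zx xb).
have cF' : cont y x F by exact: contW cF.
have cw' : cont y x w by exact: contW cw.
have h1 : F x - F y <= itg y x w.
  apply: (itg_ge_diff (F' := F')) => // z /sub zab; first exact: dF.
  by rewrite (le_trans (ler_norm _))// Fw.
have h2 : - itg y x w <= F x - F y.
  rewrite -itgN//; apply: (itg_le_diff (F' := F')) => //; first exact: withinN.
    by move=> z /sub zab; exact: dF.
  by move=> z /sub zab; rewrite lerNl (le_trans (ler_norm _))// normrN Fw.
have := itg_split ay yb cw.
have := itg_split yx xb (contW ay (lexx b) cw).
have p1 : 0 <= itg a y w.
  by apply: itg_ge0 => z /andP[? zy]; apply: w0; lra.
have p2 : 0 <= itg x b w.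
  by apply: itg_ge0 => z /andP[? zy]; apply: w0; lra.
by rewrite ler_norml => -> ->; lra.
Qed.
End integral_1d.

(** * Joint continuity in two variables *)

Section joint_continuity.
Context {R : realType}.
Implicit Types (a b t x e d : R) (A B : set R) (u : R -> R -> R).
Local Notation mu := (@lebesgue_measure R).
Local Notation itg a b f := (\int[lebesgue_measure]_(x in `[a, b]) f x).
Local Notation cont a b f := {within `[a, b], continuous f}.
Local Notation joint A B u := {within A `*` B, continuous (uncurry2 u)}.

Lemma joint_eps A B u : joint A B u <-> forall t x e : R, A t -> B x -> 0 < e ->
  exists2 d : R, 0 < d & forall s y, A s -> B y -> `|s - t| < d -> `|y - x| < d ->
    `|u s y - u t x| < e.
Proof.
split=> [/subspace_continuousP cu t x e At Bx e0|h].
  have /cvgrPdist_lt /(_ e e0) := cu (t, x) (conj At Bx).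
  rewrite near_withinE => -[[P Q] /= [[d1 d10 h1] [d2 d20 h2]] h].
  exists (Num.min d1 d2); first by rewrite lt_min d10.
  move=> s y As By; rewrite !lt_min => /andP[s1 _] /andP[_ y2].
  rewrite distrC; apply: (h (s, y)) => //; split => /=.
    by apply: h1; rewrite /ball /= distrC.
  by apply: h2; rewrite /ball /= distrC.
apply/subspace_continuousP => -[t x] [/= At Bx]; apply/cvgrPdist_lt => e e0.
have [d d0 hd] := h t x e At Bx e0.
rewrite near_withinE; exists (ball t d, ball x d) => /=.
  by split; apply/nbhs_ballP; exists d.
move=> [s y] [/= bs By] [As Bs]; rewrite distrC; apply: hd => //; rewrite distrC; [exact: bs|exact: By].
Qed.

Lemma joint_slice A B u t : A t -> joint A B u -> {within B, continuous (u t)}.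
Proof.
move=> At /joint_eps cu; apply/subspace_continuousP => x Bx.
apply/cvgrPdist_lt => e e0; have [d d0 hd] := cu t x e At Bx e0.
rewrite near_withinE; exists d => // y; rewrite /ball /= => xy By.
by rewrite distrC hd// ?subrr ?normr0// distrC.
Qed.

Lemma joint_slice2 A B u x : B x -> joint A B u ->
  {within A, continuous (u^~ x)}.
Proof.
move=> Bx /joint_eps cu; apply/subspace_continuousP => t At.
apply/cvgrPdist_lt => e e0; have [d d0 hd] := cu t x e At Bx e0.
rewrite near_withinE; exists d => // s; rewrite /ball /= => ts As.
by rewrite distrC hd// ?subrr ?normr0// distrC.
Qed.

(** A consequence of the compactness of [a, b]. It makes integrals over [a,
    b] continuous in t, and it lets a strict bound on a whole profile persist
    for a short time. *)
Lemma joint_unif A a b u t e : joint A `[a, b] u -> A t -> 0 < e ->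
  exists2 d : R, 0 < d & forall s x, A s -> `|s - t| < d -> a <= x <= b ->
    `|u s x - u t x| < e.
Proof.
move=> /joint_eps cu At e0.
have /compact_near_coveringP /(_ R (within A (nbhs t))
  (fun s x => a <= x <= b -> `|u s x - u t x| < e)) := @segment_compact R a b.
case.
  move=> x xab; have e20 : 0 < e / 2 by rewrite divr_gt0.
  have [d d0 hd] := cu t x _ At xab e20.
  exists (ball x d, [set s | A s /\ ball t d s]) => /=.
    split; first exact: nbhsx_ballx.
    rewrite nbhs_simpl /within /=.
    by apply: filterS (nbhsx_ballx t _ d0) => s ts As.
  move=> [y s] /= [xy [As ts]] yab.
  have -> : u s y - u t y = (u s y - u t x) - (u t y - u t x) by ring.
  apply: le_lt_trans (ler_normB _ _) _.
  have yx : `|y - x| < d by rewrite distrC.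
  have st : `|s - t| < d by rewrite distrC.
  have h1 := hd s y As yab st yx.
  have := hd t y At yab _ yx; rewrite subrr normr0 => /(_ d0) h2.
  by rewrite (splitr e) ltrD.
move=> d /= d0 hd; exists d => // s x As st xab; apply: hd => //.
by rewrite /= distrC.
Qed.

Lemma joint_bounded a b c d u : joint `[a, b] `[c, d] u ->
  exists2 C : R, 0 < C & forall t x, a <= t <= b -> c <= x <= d -> `|u t x| <= C.
Proof.
move=> cu; have K : compact (`[a, b] `*` `[c, d] : set (R * R)).
  by apply: compact_setX; exact: segment_compact.
have [M [_ hM]] := compact_bounded (continuous_compact cu K).
exists (Num.max 1 (M + 1)); first by rewrite lt_max ltr01.
move=> t x tab xcd; apply: (hM (Num.max 1 (M + 1))).
  by rewrite lt_max ltrDl ltr01 orbT.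
by exists (t, x) => //=; rewrite !in_itv.
Qed.

Lemma joint_itg A a b u : a < b -> joint A `[a, b] u ->
  {within A, continuous (fun t => itg a b (u t))}.
Proof.
move=> ab cu; apply/subspace_continuousP => t At.
apply/cvgrPdist_lt => e e0.
have e1 : 0 < e / (2 * (b - a)) by rewrite divr_gt0 ?mulr_gt0// subr_gt0.
have [d d0 hd] := joint_unif cu At e1.
rewrite near_withinE; exists d => // s; rewrite /ball /= => ts As.
have ct r : A r -> cont a b (u r) by move=> Ar; exact: joint_slice cu.
rewrite -itgB//; [|exact: ct..].
apply: (@le_lt_trans _ _ (e / (2 * (b - a)) * (b - a))).
  apply: itg_norm_le; first exact: ltW.
    by apply: withinB; exact: ct.
  by move=> x xab; rewrite distrC ltW// hd// distrC.
have ba : b - a != 0 by rewrite subr_eq0 gt_eqF.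
by rewrite (_ : _ * _ = e / 2); [lra|field].
Qed.

Lemma jointW A B A' B' u : A' `<=` A -> B' `<=` B -> joint A B u -> joint A' B' u.
Proof.
move=> AA BB; apply: continuous_subspaceW => -[t x] [/= At Bx].
by split; [exact: AA|exact: BB].
Qed.

(** Near t the derivative is bounded, by compactness, and a constant serves
    as the dominating function. *)
Lemma itg_param_derive t0 t1 a b u ut t :
  joint `]t0, t1[ `[a, b] u -> joint `]t0, t1[ `[a, b] ut ->
  (forall s x, t0 < s < t1 -> a <= x <= b -> is_derive s 1 (u^~ x) (ut s x)) ->
  t0 < t < t1 ->
  is_derive t 1 (fun s => itg a b (u s)) (itg a b (ut t)).
Proof.
move=> cu cut du /andP[t0t tt1].
pose s0 := (t0 + t) / 2; pose s1 := (t + t1) / 2.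
have cK : joint `[s0, s1] `[a, b] ut.
  apply: jointW cut => // s /=; rewrite !in_itv /=.
  by rewrite /s0 /s1; lra.
have [C C0 hC] := joint_bounded cK.
have sub s : s0 < s < s1 -> t0 < s < t1 by rewrite /s0 /s1; lra.
have It : `]s0, s1[%classic t by rewrite /= in_itv /= /s0 /s1; lra.
have mB : measurable (`[a, b]%classic : set (measurableTypeR R)) by [].
have I1 s : `]s0, s1[%classic s -> mu.-integrable `[a, b] (EFin \o u s).
  rewrite /= in_itv /= => /sub ts; apply: cont_integrable.
  by apply: (joint_slice (A := `]t0, t1[)) => //=; rewrite in_itv.
have I2 s x : `]s0, s1[%classic s -> `[a, b]%classic x -> derivable (u^~ x) s 1.
  by rewrite /= !in_itv /= => /sub ts xab; have [] := du s x ts xab.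
have I3 : mu.-integrable `[a, b] (EFin \o (fun=> C)).
  exact/cont_integrable/within_cst.
have dE s x : t0 < s < t1 -> a <= x <= b -> partial1of2 u s x = ut s x.
  by move=> ts xab; rewrite partial1of2E; have [] := du s x ts xab.
have I4 s x : `]s0, s1[%classic s -> `[a, b]%classic x -> `|partial1of2 u s x| <= C.
  rewrite /= !in_itv /= => s01 xab; rewrite dE//; last exact: sub.
  by apply: hC => //; lra.
have dI := derivable_under_integral mB It I1 I2 (fun=> ltW C0) I3 I4.
have vI := differentiation_under_integral mB It I1 I2 (fun=> ltW C0) I3 I4.
apply: DeriveDef => //; rewrite -derive1E vI.
by apply: eq_itg => x xab; rewrite dE// t0t.
Qed.
End joint_continuity.

(** * From local balance laws to decreasing integrals *)

Section dissipation.
Context {R : realType}.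
Implicit Types (a b c t x : R) (A B : set R).
Local Notation itg a b f := (\int[lebesgue_measure]_(x in `[a, b]) f x).
Local Notation cont a b f := {within `[a, b], continuous f}.
Local Notation joint A B u := {within A `*` B, continuous (uncurry2 u)}.

Lemma joint_swap A B (u : R -> R -> R) : joint A B u -> joint B A (fun x t => u t x).
Proof.
move=> /joint_eps cu; apply/joint_eps => x t e Bx At e0.
by have [d d0 hd] := cu t x e At Bx e0; exists d => // *; exact: hd.
Qed.

Lemma joint_vanish t1 t2 a b x0 (u : R -> R -> R) e : joint `[t1, t2] `[a, b] u ->
  a <= x0 <= b -> (forall t, t1 <= t <= t2 -> u t x0 = 0) -> 0 < e ->
  exists2 d : R, 0 < d & forall t x, t1 <= t <= t2 -> a <= x <= b ->
    `|x - x0| < d -> `|u t x| < e.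
Proof.
move=> cu x0ab u0 e0.
have Ax0 : `[a, b]%classic x0 by rewrite /= in_itv.
have [d d0 hd] := joint_unif (joint_swap cu) Ax0 e0.
exists d => // t x tt xab xx0; have := hd x t _ xx0 tt.
by rewrite u0// subr0; apply; rewrite /= in_itv.
Qed.

Lemma itg_trim a b c c' f (C : R) : a <= c -> c <= c' -> c' <= b -> cont a b f ->
  (forall x, a <= x <= b -> `|f x| <= C) ->
  `|itg a b f - itg c c' f| <= C * ((c - a) + (b - c')).
Proof.
move=> ac cc' c'b cf fC.
rewrite (itg_split ac (le_trans cc' c'b) cf).
rewrite (itg_split cc' c'b (contW ac (lexx b) cf)).
rewrite (_ : _ - _ = itg a c f + itg c' b f); last by ring.
apply: le_trans (ler_normD _ _) _; rewrite mulrDr lerD//.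
  apply: itg_norm_le => //; first by apply: contW cf => //; lra.
  by move=> x xac; apply: fC; lra.
apply: itg_norm_le => //; first by apply: contW cf => //; lra.
by move=> x xac; apply: fC; lra.
Qed.

Lemma small_pos4 (x y z w : R) : 0 < x -> 0 < y -> 0 < z -> 0 < w ->
  exists q : R, [/\ 0 < q, q < x, q < y, q < z & q < w].
Proof.
move=> x0 y0 z0 w0; exists (Num.min (Num.min x y) (Num.min z w) / 2).
have m0 : 0 < Num.min (Num.min x y) (Num.min z w) by rewrite !lt_min x0 y0 z0.
have : Num.min (Num.min x y) (Num.min z w) / 2 < Num.min (Num.min x y) (Num.min z w).
  by rewrite ltr_pdivrMr// ltr_pMr// ltr1n.
by rewrite !lt_min divr_gt0// => /andP[/andP[-> ->] /andP[-> ->]].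
Qed.

(** The balance law e_t + j_x + d <= 0 is available in the open rectangle
    only, where e_t and j_x may be unbounded. Over a trimmed segment [a + q,
    b - q] it may be integrated; the fluxes through the ends of that segment
    are small, because |j| <= bd and bd tends to 0 at the walls uniformly in
    time. Then q tends to 0. *)
Lemma dissipation t1 t2 a b (e et j jx d bd : R -> R -> R) :
  t1 < t2 -> a < b ->
  joint `[t1, t2] `[a, b] e -> joint `[t1, t2] `[a, b] d ->
  joint `[t1, t2] `[a, b] bd -> joint `]t1, t2[ `]a, b[ et ->
  (forall t, t1 <= t <= t2 -> bd t a = 0 /\ bd t b = 0) ->
  (forall t x, t1 < t < t2 -> a < x < b ->
    [/\ is_derive t 1 (e^~ x) (et t x), is_derive x 1 (j t) (jx t x),
        `|j t x| <= bd t x & et t x + jx t x + d t x <= 0]) ->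
  (forall t, t1 < t < t2 -> 0 <= itg a b (d t)) ->
  itg a b (e t2) <= itg a b (e t1).
Proof.
move=> t12 ab ce cd cbd cet bd0 H d_ge0.
have [Ce Ce0 hCe] := joint_bounded ce.
have [Cd Cd0 hCd] := joint_bounded cd.
(* For q < eta and end fluxes at most eta, the trimming of e at both times and
   of d in between costs at most K eta. *)
have [K KE] : exists K : R, K = 4 * Ce + (t2 - t1) * (2 * Cd + 2) by eexists.
have K0 : 0 < K by rewrite KE addr_gt0 ?mulr_gt0 ?subr_gt0 ?addr_gt0// mulr_gt0.
apply/ler_addgt0Pr => z z0.
have [eta etaE] : exists eta : R, eta = z / K by eexists.
have eta0 : 0 < eta by rewrite etaE divr_gt0.
have [da da0 hda] : exists2 d : R, 0 < d & forall t x, t1 <= t <= t2 ->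
    a <= x <= b -> `|x - a| < d -> `|bd t x| < eta.
  by apply: joint_vanish => //; [lra|move=> t /bd0[]].
have [db db0 hdb] : exists2 d : R, 0 < d & forall t x, t1 <= t <= t2 ->
    a <= x <= b -> `|x - b| < d -> `|bd t x| < eta.
  by apply: joint_vanish => //; [lra|move=> t /bd0[]].
have [q [q0 qda qdb qeta qab]] : exists q : R,
    [/\ 0 < q, q < da, q < db, q < eta & q < (b - a) / 2].
  apply: small_pos4 => //; by rewrite divr_gt0 ?subr_gt0.
have [c cE] : exists c : R, c = a + q by exists (a + q).
have [c' c'E] : exists c' : R, c' = b - q by exists (b - q).
have cc' : c < c' by clear - cE c'E qab; lra.
have ac : a < c by rewrite cE ltrDl.
have c'b : c' < b by rewrite c'E ltrBlDr ltrDl.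
have sub x : c <= x <= c' -> a < x < b.
  by move=> xx; clear - ac c'b xx; lra.
have subo x : c < x < c' -> a < x < b.
  by move=> xx; clear - ac c'b xx; lra.
have cab : a < c < b by clear - ac cc' c'b; lra.
have c'ab : a < c' < b by clear - ac cc' c'b; lra.
have cab' : a <= c <= b by clear - ac cc' c'b; lra.
have c'ab' : a <= c' <= b by clear - ac cc' c'b; lra.
have dca : `|c - a| = q by rewrite cE addrAC subrr add0r gtr0_norm.
have dcb : `|c' - b| = q by rewrite c'E addrAC subrr add0r normrN gtr0_norm.
have cet' : joint `]t1, t2[ `[c, c'] et.
  by apply: jointW cet => // x /=; rewrite !in_itv /=; clear - ac c'b; lra.
have ce' : joint `[t1, t2] `[c, c'] e.
  by apply: jointW ce => // x /=; rewrite !in_itv /=; clear - ac c'b; lra.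
have ce2 : joint `]t1, t2[ `[c, c'] e.
  by apply: jointW ce' => // x /=; rewrite !in_itv /=; clear; lra.
have dF t : t1 < t < t2 ->
    is_derive t 1 (fun s => itg c c' (e s)) (itg c c' (et t)).
  move=> tt; apply: (itg_param_derive ce2 cet') => // s x ss xx.
  by have [] := H s x ss; first by clear - ac c'b xx; lra.
have Fle t : t1 < t < t2 -> itg c c' (et t) <= 2 * q * Cd + 2 * eta.
  move=> tt; have tt' : t1 <= t <= t2 by clear - tt; lra.
  have ot : `]t1, t2[%classic t by rewrite /= in_itv.
  have ct : `[t1, t2]%classic t by rewrite /= in_itv.
  have cdt : cont a b (d t) by exact: joint_slice cd.
  have cdt' : cont c c' (d t) by apply: contW cdt; exact: ltW.
  have cett : cont c c' (et t) by apply: joint_slice cet'.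
  have h1 : itg c c' (fun x => et t x + d t x) <= - j t c' - - j t c.
    apply: (@itg_le_diff _ c c' _ (fun x => - j t x) (fun x => - jx t x)) => //.
    - exact: ltW.
    - exact: withinD.
    - apply: derivable_within_continuous => x; rewrite in_itv /= => xx.
      have [_ jd _ _] := H t x tt (sub x xx).
      by apply: derivableN.
    - move=> x xx; have [_ jd _ _] := H t x tt (subo x xx).
      by apply: is_deriveN.
    - by move=> x xx; have [_ _ _] := H t x tt (subo x xx); clear; lra.
  have h2 : `|j t c| <= eta.
    have [_ _ + _] := H t c tt cab; move/le_trans; apply.
    apply: le_trans (ler_norm _) _; apply/ltW/hda => //.
    by rewrite dca.
  have h3 : `|j t c'| <= eta.
    have [_ _ + _] := H t c' tt c'ab; move/le_trans; apply.
    apply: le_trans (ler_norm _) _; apply/ltW/hdb => //.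
    by rewrite dcb.
  have h4 := itg_trim (ltW ac) (ltW cc') (ltW c'b) cdt (fun x => hCd t x tt').
  move: h1; rewrite itgD// => h1.
  have := d_ge0 t tt; move: h2 h3 h4; rewrite !ler_norml.
  by move: h1; clear - cE c'E; rewrite cE c'E; lra.
have hF : itg c c' (e t2) - itg c c' (e t1) <= (t2 - t1) * (2 * q * Cd + 2 * eta).
  have dF' t : t \in `]t1, t2[ -> is_derive t 1 (fun s => itg c c' (e s)) (itg c c' (et t)).
    by rewrite in_itv; exact: dF.
  have [s ss ->] := MVT t12 dF' (joint_itg cc' ce').
  rewrite mulrC ler_wpM2l ?subr_ge0 ?(ltW t12)//; apply: Fle.
  by move: ss; rewrite in_itv.
have tr t : t1 <= t <= t2 -> `|itg a b (e t) - itg c c' (e t)| <= Ce * (2 * q).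
  move=> tt; have := @itg_trim a b c c' (e t) Ce (ltW ac) (ltW cc') (ltW c'b).
  rewrite (_ : c - a + (b - c') = 2 * q); last by rewrite cE c'E; ring.
  apply; last by move=> x; exact: hCe.
  by apply: joint_slice ce; rewrite /= in_itv.
have := tr t1; have := tr t2; rewrite !lexx !(ltW t12) !ler_norml => /(_ isT) k2 /(_ isT) k1.
have zE : z = eta * K by rewrite etaE divfK// gt_eqF.
have h5 : Ce * q <= Ce * eta by rewrite ler_pM2l// ltW.
have h6 : (t2 - t1) * (2 * q * Cd + 2 * eta) <= (t2 - t1) * (2 * eta * Cd + 2 * eta).
  by rewrite ler_pM2l ?subr_gt0// lerD2r ler_pM2r// ler_pM2l// ltW.
by rewrite zE KE; clear - hF h5 h6 k1 k2; lra.
Qed.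
End dissipation.

(** * Pointwise derivatives *)

Section pointwise_derivatives.
Context {R : realType}.
Implicit Types (f g : R -> R) (x a b c : R).

Lemma der_eq f x a b : is_derive x 1 f a -> a = b -> is_derive x 1 f b.
Proof. by move=> h <-. Qed.

Lemma der_cst c x : is_derive x 1 (fun _ : R => c) 0.
Proof. exact: is_derive_cst. Qed.

Lemma der_id x : is_derive x 1 (fun y : R => y) 1.
Proof. exact: is_derive_id. Qed.

Lemma derD f g x a b : is_derive x 1 f a -> is_derive x 1 g b ->
  is_derive x 1 (fun y => f y + g y) (a + b).
Proof. by move=> df dg; apply: (@is_deriveD _ _ _ f g). Qed.

Lemma derN f x a : is_derive x 1 f a -> is_derive x 1 (fun y => - f y) (- a).
Proof. by move=> df; apply: (@is_deriveN _ _ _ f). Qed.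

Lemma derM f g x a b : is_derive x 1 f a -> is_derive x 1 g b ->
  is_derive x 1 (fun y => f y * g y) (a * g x + f x * b).
Proof.
move=> df dg; apply: der_eq (@is_deriveM _ _ f g x 1 a b df dg) _.
by rewrite /GRing.scale /= addrC; congr (_ + _); rewrite mulrC.
Qed.

Lemma derX f x a n : is_derive x 1 f a ->
  is_derive x 1 (fun y => f y ^+ n) (n%:R * f x ^+ n.-1 * a).
Proof.
move=> df; elim: n => [|n IH].
  rewrite !mul0r (_ : (fun _ => _) = fun _ => 1); first exact: der_cst.
  by apply/funext => y; rewrite expr0.
rewrite (_ : (fun _ => _) = fun y => f y * f y ^+ n); last first.
  by apply/funext => y; rewrite exprS.
apply: der_eq (derM df IH) _.
case: n {IH} => [|n] /=; first by rewrite !expr0; ring.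
by rewrite -[in RHS]natr1 exprS; ring.
Qed.

Lemma der_comp f g x a b : is_derive x 1 f a -> is_derive (f x) 1 g b ->
  is_derive x 1 (fun y => g (f y)) (b * a).
Proof. by move=> df dg; apply: (@is_derive1_comp _ g f x b a). Qed.

Lemma derV f x a : is_derive x 1 f a -> f x != 0 ->
  is_derive x 1 (fun y => (f y)^-1) (- (a / f x ^+ 2)).
Proof.
move=> df f0; have dV : is_derive (f x) 1 (GRing.inv : R -> R) (- (f x) ^- 2).
  have := @is_deriveV R id (f x) 1 1 f0 (is_derive_id _ _).
  by rewrite scaler1.
by apply: der_eq (der_comp df dV) _; rewrite mulNr mulrC.
Qed.

Lemma der_sqrt f x a : is_derive x 1 f a -> 0 < f x ->
  is_derive x 1 (fun y => Num.sqrt (f y)) (a / (2 * Num.sqrt (f x))).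
Proof.
move=> df f0; apply: der_eq (der_comp df (is_derive1_sqrt f0)) _.
by rewrite mulrC.
Qed.

Lemma der_expR f x a : is_derive x 1 f a ->
  is_derive x 1 (fun y => expR (f y)) (expR (f x) * a).
Proof. by move=> df; apply: (der_comp df); exact: is_derive_expR. Qed.

Lemma der_near f g x d a b : a < x < b -> (forall y, a < y < b -> f y = g y) ->
  is_derive x 1 f d -> is_derive x 1 g d.
Proof.
move=> /andP[ax xb] fg; apply: near_eq_is_derive.
near=> y; apply: fg; apply/andP; split; near: y.
  exact: lt_nbhsr.
exact: lt_nbhsl.
Unshelve. all: by end_near. Qed.

Lemma der_cont f x a : is_derive x 1 f a -> {for x, continuous f}.
Proof. by move=> [df _]; apply/differentiable_continuous/derivable1_diffP. Qed.

Lemma der_within f a b F : (forall x, a <= x <= b -> is_derive x 1 f (F x)) ->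
  {within `[a, b], continuous f}.
Proof.
move=> df; apply: derivable_within_continuous => x; rewrite in_itv /= => xab.
by case: (df x xab).
Qed.

Lemma mean_value f F a b : a < b ->
  (forall x, a <= x <= b -> is_derive x 1 f (F x)) ->
  exists2 c, a < c < b & f b - f a = F c * (b - a).
Proof.
move=> ab df.
have df' x : x \in `]a, b[ -> is_derive x 1 f (F x).
  by rewrite in_itv /= => xab; apply: df; lra.
have [c] := MVT ab df' (der_within df).
by rewrite in_itv /= => cab ->; exists c.
Qed.
End pointwise_derivatives.

(* The last three cases are eta-reduced opposites, sums and products. *)
Ltac der_step := first
  [ eassumption
  | notypeclasses refine (der_cst _ _) | notypeclasses refine (der_id _)
  | match goal with |- is_derive _ _ (fun y => _ + _) _ => notypeclasses refine (derD _ _) end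
  | match goal with |- is_derive _ _ (fun y => - _) _ => notypeclasses refine (derN _) end
  | match goal with |- is_derive _ _ (fun y => _ * _) _ => notypeclasses refine (derM _ _) end
  | match goal with |- is_derive _ _ (fun y => _ ^+ _) _ => notypeclasses refine (derX _ _) end
  | match goal with |- is_derive _ _ (fun y => _^-1) _ => notypeclasses refine (derV _ _) end
  | match goal with |- is_derive _ _ (fun y => Num.sqrt _) _ => notypeclasses refine (der_sqrt _ _) end
  | match goal with |- is_derive _ _ (fun y => expR _) _ => notypeclasses refine (der_expR _) end
  | match goal with |- is_derive _ _ -%R _ => notypeclasses refine (@derN _ (fun z => z) _ _ _) end
  | match goal with |- is_derive _ _ ( +%R ?a) _ => notypeclasses refine (@derD _ (fun _ => a) (fun z => z) _ _ _ _ _) end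
  | match goal with |- is_derive _ _ ( *%R ?a) _ => notypeclasses refine (@derM _ (fun _ => a) (fun z => z) _ _ _ _ _) end ].
(** Computes the derivative of an expression from those of its leaves, which
    have to be hypotheses, and leaves the equation with the expected value. *)
Ltac der := notypeclasses refine (der_eq _ _); [repeat der_step|cbv beta].

Section schwarz.
Context {R : realType}.
Local Notation joint A B u := {within A `*` B, continuous (uncurry2 u)}.

(** Symmetry of mixed second derivatives: both equal the limit of the second
    difference quotient over a small square, by two applications of the mean
    value theorem in either order. *)
Lemma schwarz (t0 t1 x0 x1 t x : R) (u ut ux uxt utx : R -> R -> R) :
  joint `]t0, t1[ `]x0, x1[ uxt -> joint `]t0, t1[ `]x0, x1[ utx ->
  (forall s y, t0 < s < t1 -> x0 < y < x1 ->
    [/\ is_derive s 1 (u^~ y) (ut s y), is_derive y 1 (u s) (ux s y),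
        is_derive s 1 (ux^~ y) (uxt s y) & is_derive y 1 (ut s) (utx s y)]) ->
  t0 < t < t1 -> x0 < x < x1 -> uxt t x = utx t x.
Proof.
move=> cxt ctx H tt xx; apply/eqP; rewrite -subr_eq0 -normr_le0.
apply/ler_addgt0Pr => e e0; rewrite add0r.
have e20 : 0 < e / 2 by rewrite divr_gt0.
have At : `]t0, t1[%classic t by rewrite /= in_itv.
have Bx : `]x0, x1[%classic x by rewrite /= in_itv.
have /joint_eps /(_ t x (e / 2) At Bx e20)[d1 d10 h1] := cxt.
have /joint_eps /(_ t x (e / 2) At Bx e20)[d2 d20 h2] := ctx.
pose q := Num.min (Num.min d1 d2) (Num.min (t1 - t) (x1 - x)) / 2.
have m0 : 0 < Num.min (Num.min d1 d2) (Num.min (t1 - t) (x1 - x)).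
  by rewrite !lt_min d10 d20 !subr_gt0 /=; lra.
have q0 : 0 < q by rewrite divr_gt0.
have [qd1 qd2 qt qx] : [/\ q < d1, q < d2, q < t1 - t & q < x1 - x].
  have : q < Num.min (Num.min d1 d2) (Num.min (t1 - t) (x1 - x)) by rewrite /q; lra.
  by rewrite !lt_min => /andP[/andP[-> ->] /andP[-> ->]].
have tq : t < t + q by lra.
have xq : x < x + q by lra.
have D1 y : x <= y <= x + q -> is_derive y 1 (fun y => u (t + q) y - u t y)
    (ux (t + q) y - ux t y).
  move=> yx; have [_ a1 _ _] := H (t + q) y (ltac:(lra)) (ltac:(lra)).
  have [_ a2 _ _] := H t y (ltac:(lra)) (ltac:(lra)).
  by apply: derD => //; apply: derN.
have [c1 c1x E1] := mean_value xq D1.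
have D2 s : t <= s <= t + q -> is_derive s 1 (ux^~ c1) (uxt s c1).
  by move=> st; have [] := H s c1 (ltac:(lra)) (ltac:(lra)).
have [c2 c2t E2] := mean_value tq D2.
have D3 s : t <= s <= t + q -> is_derive s 1 (fun s => u s (x + q) - u s x)
    (ut s (x + q) - ut s x).
  move=> st; have [a1 _ _ _] := H s (x + q) (ltac:(lra)) (ltac:(lra)).
  have [a2 _ _ _] := H s x (ltac:(lra)) (ltac:(lra)).
  by apply: derD => //; apply: derN.
have [c3 c3t E3] := mean_value tq D3.
have D4 y : x <= y <= x + q -> is_derive y 1 (ut c3) (utx c3 y).
  by move=> yx; have [] := H c3 y (ltac:(lra)) (ltac:(lra)).
have [c4 c4x E4] := mean_value xq D4.
have E : uxt c2 c1 = utx c3 c4.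
  have q2 : q * q != 0 by rewrite mulf_neq0 ?gt_eqF.
  apply: (mulIf q2); move: E1 E3; rewrite E2 E4.
  by rewrite !(addrC _ q) !addrK; lra.
have dist y z : z < y < z + q -> `|y - z| <= q.
  by move=> yz; rewrite ger0_norm; lra.
have k1 : `|uxt c2 c1 - uxt t x| < e / 2.
  apply: h1; rewrite /= ?in_itv /=; [lra|lra|..].
    exact: le_lt_trans (dist _ _ c2t) qd1.
  exact: le_lt_trans (dist _ _ c1x) qd1.
have k2 : `|utx c3 c4 - utx t x| < e / 2.
  apply: h2; rewrite /= ?in_itv /=; [lra|lra|..].
    exact: le_lt_trans (dist _ _ c3t) qd2.
  exact: le_lt_trans (dist _ _ c4x) qd2.
have -> : uxt t x - utx t x = (utx c3 c4 - utx t x) - (uxt c2 c1 - uxt t x).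
  by rewrite E; ring.
apply: le_trans (ler_normB _ _) _; rewrite (splitr e).
by rewrite lerD// ltW.
Qed.
End schwarz.

(** * Cauchy-Schwarz and Wirtinger inequalities *)

Section profile_inequalities.
Context {R : realType}.
Local Notation itg a b f := (\int[lebesgue_measure]_(x in `[a, b]) f x).
Local Notation cont a b f := {within `[a, b], continuous f}.
Implicit Types (f w v vx h P : R -> R) (a b L x : R).

(** Weighted Cauchy-Schwarz inequality: expand the integral of w (f - c)^2,
    where c is the weighted mean of f. *)
Lemma cauchy_schwarz a b w f : a <= b -> cont a b w -> cont a b f ->
  (forall x, a <= x <= b -> 0 <= w x) -> 0 < itg a b w ->
  itg a b (fun x => w x * f x) ^+ 2 <= itg a b w * itg a b (fun x => w x * f x ^+ 2).
Proof.
move=> ab cw cf w0 W0; set W := itg a b w; set A := itg a b _; set B := itg a b _.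
pose c := A / W.
have : 0 <= itg a b (fun x => w x * (f x - c) ^+ 2).
  by apply: itg_ge0 => x xab; rewrite mulr_ge0 ?sqr_ge0 ?w0.
have -> : itg a b (fun x => w x * (f x - c) ^+ 2) = B - 2 * c * A + c ^+ 2 * W.
  rewrite /A /B /W -itgZ; last by within_tac.
  rewrite -itgB; [|within_tac..].
  rewrite -itgZ; last by within_tac.
  rewrite -itgD; [|within_tac..].
  by apply: eq_itg => x _; ring.
have WW : W != 0 by rewrite gt_eqF.
move=> h; have := mulr_ge0 (ltW W0 : 0 <= W) h.
have -> : W * (B - 2 * c * A + c ^+ 2 * W) = W * B - A ^+ 2 by rewrite /c; field.
by rewrite subr_ge0.
Qed.

Lemma itg_sqr_le a b f : a < b -> cont a b f ->
  itg a b f ^+ 2 <= (b - a) * itg a b (fun x => f x ^+ 2).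
Proof.
move=> ab cf; have := @cauchy_schwarz a b (fun=> 1) f (ltW ab).
have -> : itg a b (fun=> 1) = b - a by rewrite itg_cst ?mul1r// ltW.
have -> : itg a b (fun x => 1 * f x) = itg a b f by apply: eq_itg => x _; rewrite mul1r.
have -> : itg a b (fun x => 1 * f x ^+ 2) = itg a b (fun x => f x ^+ 2).
  by apply: eq_itg => x _; rewrite mul1r.
by apply=> //; [exact: within_cst|rewrite subr_gt0].
Qed.

(** With T = tan (c (x - L / 2)), the function - c T v^2 vanishes at both
    ends, and its derivative is v_x^2 - c^2 v^2 minus the square (v_x + c T
    v)^2. *)
Lemma poincare_below L c v vx : 0 < L -> 0 < c -> c < pi / L ->
  cont 0 L v -> cont 0 L vx -> (forall x, 0 < x < L -> is_derive x 1 v (vx x)) ->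
  v 0 = 0 -> v L = 0 ->
  c ^+ 2 * itg 0 L (fun x => v x ^+ 2) <= itg 0 L (fun x => vx x ^+ 2).
Proof.
move=> L0 c0 cL cv cvx dv v0 vL.
pose T x := tan (c * (x - L / 2)).
have cos0 x : 0 <= x <= L -> cos (c * (x - L / 2)) != 0.
  move=> /andP[x0 xL]; rewrite gt_eqF// cos_gt0_pihalf//.
  have h : c * L < pi by rewrite -ltr_pdivlMr.
  have h1 : 0 <= c * x by rewrite mulr_ge0// ltW.
  have h2 : c * x <= c * L by rewrite ler_pM2l.
  by rewrite mulrBr mulrA; apply/andP; split; lra.
have dT x : 0 <= x <= L -> is_derive x 1 T (c * (1 + T x ^+ 2)).
  move=> xL; have d1 : is_derive x 1 (fun y => c * (y - L / 2)) c by der; ring.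
  have d2 := is_derive_tan (cos0 x xL).
  apply: der_eq (der_comp d1 d2) _.
  by rewrite cos2_tan2 ?cos0// mulrC.
have cT : cont 0 L T := der_within dT.
pose F x := - (c * T x * v x ^+ 2).
pose F' x := - (c * (c * (1 + T x ^+ 2)) * v x ^+ 2 + 2 * c * T x * v x * vx x).
have cF : cont 0 L F by rewrite /F; within_tac.
have dF x : 0 < x < L -> is_derive x 1 F (F' x).
  move=> xL; have dvx := dv x xL; have dTx := dT x (ltac:(lra)).
  by rewrite /F; der; rewrite /F' /=; ring.
have cf : cont 0 L (fun x => vx x ^+ 2 - c ^+ 2 * v x ^+ 2) by within_tac.
have := itg_ge_diff (ltW L0) cf cF dF.
rewrite itgB; [|within_tac..]; rewrite itgZ; last by within_tac.
rewrite /F v0 vL expr0n /= !mulr0 subrr subr_ge0; apply.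
move=> x _; rewrite /F' -subr_ge0.
rewrite (_ : _ - _ = (vx x + c * T x * v x) ^+ 2); last by ring.
exact: sqr_ge0.
Qed.

(** The sharp constant pi / L is the limit of the admissible c: the tangent
    is regular on the whole of [0, L] as long as c < pi / L. *)
Lemma poincare L v vx : 0 < L ->
  cont 0 L v -> cont 0 L vx -> (forall x, 0 < x < L -> is_derive x 1 v (vx x)) ->
  v 0 = 0 -> v L = 0 ->
  pi ^+ 2 * itg 0 L (fun x => v x ^+ 2) <= L ^+ 2 * itg 0 L (fun x => vx x ^+ 2).
Proof.
move=> L0 cv cvx dv v0 vL.
set A := itg 0 L _; set B := itg 0 L _.
have A0 : 0 <= A by apply: itg_ge0 => x _; exact: sqr_ge0.
have B0 : 0 <= B by apply: itg_ge0 => x _; exact: sqr_ge0.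
have pi0 : 0 < pi / L :> R by rewrite divr_gt0 ?pi_gt0.
have L2 : 0 < L ^+ 2 by rewrite exprn_gt0.
suff : (pi / L) ^+ 2 * A <= B.
  by rewrite expr_div_n mulrAC ler_pdivrMr// mulrC (mulrC B).
move: A0; rewrite le_eqVlt => /predU1P[<-|A0]; first by rewrite mulr0.
rewrite -ler_pdivlMr// leNgt; apply/negP => lt.
pose s := Num.sqrt (B / A).
have s0 : 0 <= s by exact: sqrtr_ge0.
have sE : s ^+ 2 = B / A by rewrite sqr_sqrtr// divr_ge0// ltW.
have spi : s < pi / L by rewrite -(ltr_pXn2r (n := 2)) ?nnegrE ?sE// ltW.
pose c := (s + pi / L) / 2.
have c0 : 0 < c by rewrite /c; lra.
have cpi : c < pi / L by move: spi; rewrite /c; set q := pi / L; lra.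
have sc : s < c by move: spi; rewrite /c; set q := pi / L; lra.
have := poincare_below L0 c0 cpi cv cvx dv v0 vL.
rewrite -/A -/B leNgt => /negP; apply.
by rewrite -ltr_pdivrMr// -sE ltr_pXn2r ?nnegrE// ?(ltW c0).
Qed.
End profile_inequalities.

(** * Energy densities *)

Section energy_densities.
Context {R : realType}.
Implicit Types (g mu sigma delta hs h v P : R).

(** P stands for the slope h_x, here and below. *)
Definition pot_density g sigma hs h P : R :=
  g / 2 * (h - hs) ^+ 2 + sigma * (Num.sqrt (1 + P ^+ 2) - 1).

Definition E_density g sigma hs h v P : R :=
  1 / 2 * (h * v ^+ 2) + pot_density g sigma hs h P.

Definition W_density g mu sigma hs h v P : R :=
  1 / 2 * (h^-1 * (h * v + mu * P) ^+ 2) + pot_density g sigma hs h P.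

Definition V_density g mu sigma delta hs h v P : R :=
  delta * E_density g sigma hs h v P + W_density g mu sigma hs h v P.

(** Minimizing the kinetic part over the velocity v leaves a multiple of
    P^2 / h. *)
Lemma V_density_ge g mu sigma delta hs h v P : 0 < delta -> 0 < h ->
  delta * mu ^+ 2 / (2 * (1 + delta)) * (P ^+ 2 / h) +
    (1 + delta) * pot_density g sigma hs h P
  <= V_density g mu sigma delta hs h v P.
Proof.
move=> d0 h0; rewrite /V_density /E_density /W_density.
set p := pot_density _ _ _ _ _; rewrite -subr_ge0.
have hN : h != 0 by rewrite gt_eqF.
have dN : 1 + delta != 0 by rewrite gt_eqF// addr_gt0.
rewrite (_ : _ - _ = ((1 + delta) * h * v + mu * P) ^+ 2 / (2 * h * (1 + delta))).
  by rewrite divr_ge0 ?sqr_ge0// !mulr_ge0// ltW// addr_gt0.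
by field; apply/andP.
Qed.

Lemma arc_ge1 P : 1 <= Num.sqrt (1 + P ^+ 2).
Proof. by rewrite -[leLHS]sqrtr1 ler_sqrt ?lerDl ?sqr_ge0// addr_ge0 ?sqr_ge0. Qed.

Lemma pot_density_ge0 g sigma hs h P : 0 < g -> 0 < sigma -> 0 <= pot_density g sigma hs h P.
Proof.
move=> g0 s0; rewrite /pot_density addr_ge0// mulr_ge0 ?sqr_ge0 ?divr_ge0 ?(ltW g0) ?(ltW s0)//.
by rewrite subr_ge0 arc_ge1.
Qed.

(** The absolute value of the function G on [0, oo[; 3/2 of it is the cubic
    (s - a)^2 (s + 2 a) in s = sqrt h, a = sqrt hs. *)
Definition absG hs h : R :=
  2 / 3 * h * Num.sqrt h - 2 * hs * Num.sqrt h + 4 / 3 * hs * Num.sqrt hs.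

Lemma sqrt_root h : 0 <= h -> exists s, [/\ 0 <= s, h = s ^+ 2 & Num.sqrt h = s].
Proof. by move=> h0; exists (Num.sqrt h); rewrite sqrtr_ge0 sqr_sqrtr. Qed.

Lemma absGE hs h : 0 <= hs -> 0 <= h ->
  absG hs h = 2 / 3 * (Num.sqrt h - Num.sqrt hs) ^+ 2 * (Num.sqrt h + 2 * Num.sqrt hs).
Proof.
move=> /sqrt_root[a [_ hsE aE]] /sqrt_root[s [_ hE sE]].
by rewrite /absG aE sE hsE hE; field.
Qed.

Lemma absG_ge0 hs h : 0 <= hs -> 0 <= h -> 0 <= absG hs h.
Proof.
move=> hs0 h0; rewrite absGE// -mulrA mulr_ge0//.
by rewrite mulr_ge0 ?sqr_ge0// addr_ge0 ?mulr_ge0 ?sqrtr_ge0.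
Qed.

Lemma der_absG hs h : 0 < h -> is_derive h 1 (absG hs) ((h - hs) / Num.sqrt h).
Proof.
move=> h0; have s0 : Num.sqrt h != 0 by rewrite gt_eqF ?sqrtr_gt0.
have ds : is_derive h 1 Num.sqrt (2 * Num.sqrt h)^-1 := is_derive1_sqrt h0.
rewrite /absG; der; have [s [_ hE sE]] := sqrt_root (ltW h0).
by move: s0; rewrite sE hE => s0; field.
Qed.

(** The gravitational and the capillary-viscous parts of the energy dominate
    their geometric mean, which is the derivative of a function of h alone. *)
Lemma V_density_ge_mean g mu sigma delta hs h v P : 0 < g -> 0 < mu -> 0 < sigma ->
  0 < delta -> 0 < h ->
  mu * Num.sqrt (delta * g) * (`|h - hs| * `|P| / Num.sqrt h)
  <= V_density g mu sigma delta hs h v P.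
Proof.
move=> g0 mu0 s0 d0 h0; apply: le_trans (V_density_ge g mu sigma hs v P d0 h0).
have d1 : 0 < 1 + delta by rewrite addr_gt0.
have arc : 0 <= (1 + delta) * (sigma * (Num.sqrt (1 + P ^+ 2) - 1)).
  by rewrite mulr_ge0 ?(ltW d1)// mulr_ge0 ?(ltW s0)// subr_ge0 arc_ge1.
apply: (@le_trans _ _ (delta * mu ^+ 2 / (2 * (1 + delta)) * (P ^+ 2 / h) +
    (1 + delta) * (g / 2 * (h - hs) ^+ 2))); last first.
  by rewrite lerD2l /pot_density [leRHS]mulrDr lerDl.
rewrite -subr_ge0.
rewrite sqrtrM ?(ltW d0)//.
have [d [dp dE ->]] := sqrt_root (ltW d0).
have [c [cp cE ->]] := sqrt_root (ltW g0).
have [s [sp sE ->]] := sqrt_root (ltW h0).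
have [e [ep eE _]] := sqrt_root (ltW d1).
have e0 : e != 0 by apply: contraTneq d1 => e0; rewrite eE e0 expr0n ltxx.
have s0' : s != 0 by apply: contraTneq h0 => s1; rewrite sE s1 expr0n ltxx.
have E5 : P ^+ 2 = `|P| ^+ 2 by rewrite -normrX ger0_norm ?sqr_ge0.
have E6 : (h - hs) ^+ 2 = `|h - hs| ^+ 2 by rewrite -normrX ger0_norm ?sqr_ge0.
rewrite E5 E6 eE {1}sE {1}dE {1}cE.
rewrite [X in 0 <= X](_ : _ = (d * mu * `|P| / (e * s) - e * c * `|h - hs|) ^+ 2 / 2).
  by rewrite divr_ge0 ?sqr_ge0.
by field; apply/andP.
Qed.
End energy_densities.

(** * Heights controlled by the energy *)

Section height_bounds.
Context {R : realType}.
Local Notation itg a b f := (\int[lebesgue_measure]_(x in `[a, b]) f x).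
Local Notation cont a b f := {within `[a, b], continuous f}.
Context (g mu sigma L m delta : R).
Context (g_gt0 : 0 < g) (mu_gt0 : 0 < mu) (sigma_gt0 : 0 < sigma)
  (L_gt0 : 0 < L) (m_gt0 : 0 < m) (delta_gt0 : 0 < delta).
Context (h P v : R -> R) (ch : cont 0 L h) (cP : cont 0 L P) (cv : cont 0 L v).
Context (dh : forall x, 0 < x < L -> is_derive x 1 h (P x)).
Context (h_gt0 : forall x, 0 <= x <= L -> 0 < h x) (mass : itg 0 L h = m).
Let hs := m / L.
Local Notation en x := (V_density g mu sigma delta hs (h x) (v x) (P x)).
Local Notation En := (itg 0 L (fun x => en x)).

Lemma height_neq0 x : `[0, L]%classic x -> h x != 0.
Proof. by rewrite /= in_itv /= => xL; rewrite gt_eqF ?h_gt0. Qed.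

Lemma cont_V_density : cont 0 L (fun x => en x).
Proof.
have chV : cont 0 L (fun x => (h x)^-1) := withinV height_neq0 ch.
by rewrite /V_density /E_density /W_density /pot_density; within_tac.
Qed.

Lemma mean_height : exists2 x, 0 <= x <= L & h x = hs.
Proof.
have c : cont 0 L (fun x => h x - hs) by within_tac.
have [|x xL /eqP] := itg0_root L_gt0 c.
  rewrite itgB//; last exact: within_cst.
  by rewrite mass itg_cst ?(ltW L_gt0)// /hs subr0 divfK ?subrr// gt_eqF.
by rewrite subr_eq0 => /eqP E; exists x => //; lra.
Qed.

(** By V_density_ge_mean the slope of mu sqrt (delta g) absG (h) is in
    absolute value at most the energy density, and absG vanishes at the mean
    height, which the profile attains. *)
Lemma height_bound_G x : 0 <= x <= L ->
  mu * Num.sqrt (delta * g) * absG hs (h x) <= En.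
Proof.
move=> xL; have [y yL hy] := mean_height.
pose k := mu * Num.sqrt (delta * g).
pose F x := k * absG hs (h x); pose F' x := k * ((h x - hs) / Num.sqrt (h x) * P x).
have k0 : 0 <= k by rewrite mulr_ge0 ?sqrtr_ge0 ?ltW.
have cF : cont 0 L F by rewrite /F /absG; within_tac.
have dF z : 0 < z < L -> is_derive z 1 F (F' z).
  move=> zL; have hz : 0 < h z by apply: h_gt0; lra.
  apply: der_eq (derM (der_cst k z) (der_comp (dh zL) (der_absG hs hz))) _.
  by rewrite /F' mul0r add0r.
have ge z : 0 <= z <= L -> k * (`|h z - hs| * `|P z| / Num.sqrt (h z)) <= en z.
  by move=> zL; apply: V_density_ge_mean => //; exact: h_gt0.
have en0 z : 0 <= z <= L -> 0 <= en z.
  move=> zL; apply: le_trans (ge z zL).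
  by rewrite mulr_ge0// divr_ge0 ?mulr_ge0 ?sqrtr_ge0.
have := @osc_le R 0 L F F' _ x y (ltW L_gt0) cF cont_V_density dF en0 _ xL yL.
rewrite {2}/F hy {1}/absG.
have -> : 2 / 3 * hs * Num.sqrt hs - 2 * hs * Num.sqrt hs + 4 / 3 * hs * Num.sqrt hs = 0 by field.
rewrite mulr0 subr0 => h1; apply: le_trans (ler_norm _) (h1 _) => z zL.
apply: le_trans (ge z (ltac:(lra))).
rewrite /F' normrM (ger0_norm k0) !normrM normfV (ger0_norm (sqrtr_ge0 _)).
by rewrite (mulrAC `|h z - hs|).
Qed.

Lemma cont_arc : cont 0 L (fun x => Num.sqrt (1 + P x ^+ 2)).
Proof. by within_tac. Qed.

Lemma height_osc x : 0 <= x <= L -> `|h x - hs| <= itg 0 L (fun x => `|P x|).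
Proof.
move=> xL; have [y yL <-] := mean_height.
by apply: (osc_le (F' := P)) => //; [exact: ltW|within_tac].
Qed.

Lemma itg_P_ge0 : 0 <= itg 0 L (fun x => `|P x|).
Proof. exact: itg_ge0. Qed.

Lemma itg_slope_sqr_le : delta * mu ^+ 2 * itg 0 L (fun x => P x ^+ 2 / h x)
  <= 2 * (1 + delta) * En.
Proof.
have chV : cont 0 L (fun x => (h x)^-1) := withinV height_neq0 ch.
rewrite -!itgZ; [|exact: cont_V_density|by within_tac].
apply: itg_le; [by within_tac| |].
  by apply: withinM; [exact: within_cst|exact: cont_V_density].
move=> x xL; have := V_density_ge g mu sigma hs (v x) (P x) delta_gt0 (h_gt0 xL).
have := pot_density_ge0 hs (h x) (P x) g_gt0 sigma_gt0.
set p := pot_density _ _ _ _ _; move=> p0.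
have d1 : 0 < 1 + delta by rewrite addr_gt0.
have q0 : 0 <= (1 + delta) * p by rewrite mulr_ge0// ltW.
move=> le1; rewrite -ler_pdivrMl ?mulr_gt0//.
apply: le_trans le1; rewrite -[leLHS]addr0 lerD// le_eqVlt; apply/orP; left; apply/eqP.
by field; rewrite !gt_eqF ?h_gt0.
Qed.

(** The Cauchy-Schwarz inequality with weight h bounds the square of the
    total variation of h by m times the integral of h_x^2 / h. *)
Lemma height_bound_viscous x : 0 <= x <= L ->
  delta * mu ^+ 2 * (h x - hs) ^+ 2 <= 2 * m * (1 + delta) * En.
Proof.
move=> xL; have chV : cont 0 L (fun x => (h x)^-1) := withinV height_neq0 ch.
have cs : itg 0 L (fun x => `|P x|) ^+ 2 <= m * itg 0 L (fun x => P x ^+ 2 / h x).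
  rewrite -mass; have -> : itg 0 L (fun x => `|P x|) = itg 0 L (fun x => h x * (`|P x| / h x)).
    by apply: eq_itg => z zL; rewrite mulrC divfK// gt_eqF ?h_gt0.
  have -> : itg 0 L (fun x => P x ^+ 2 / h x) = itg 0 L (fun x => h x * (`|P x| / h x) ^+ 2).
    apply: eq_itg => z zL; rewrite -[P z ^+ 2]ger0_norm ?sqr_ge0// normrX.
    by field; rewrite gt_eqF ?h_gt0.
  apply: cauchy_schwarz; [exact: ltW|exact: ch|by within_tac| |].
    by move=> z zL; rewrite ltW ?h_gt0.
  by rewrite mass.
have h1 : (h x - hs) ^+ 2 <= itg 0 L (fun x => `|P x|) ^+ 2.
  rewrite -[leLHS]ger0_norm ?sqr_ge0// normrX ler_pXn2r ?nnegrE ?itg_P_ge0//.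
  exact: height_osc.
apply: (@le_trans _ _ (delta * mu ^+ 2 * (m * itg 0 L (fun x => P x ^+ 2 / h x)))).
  rewrite ler_pM2l ?mulr_gt0 ?exprn_gt0//; exact: le_trans h1 cs.
rewrite mulrCA (_ : 2 * m * (1 + delta) * En = m * (2 * (1 + delta) * En)).
  by rewrite ler_pM2l// itg_slope_sqr_le.
by ring.
Qed.

Lemma itg_arc_le : sigma * (1 + delta) * itg 0 L (fun x => Num.sqrt (1 + P x ^+ 2) - 1) <= En.
Proof.
have ca := cont_arc; rewrite -itgZ; last by within_tac.
apply: itg_le; [by within_tac|exact: cont_V_density|].
move=> x xL; have := V_density_ge g mu sigma hs (v x) (P x) delta_gt0 (h_gt0 xL).
apply: le_trans; rewrite /pot_density.
have d1 : 0 < 1 + delta by rewrite addr_gt0.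
have a0 : 0 <= delta * mu ^+ 2 / (2 * (1 + delta)) * (P x ^+ 2 / h x).
  apply: mulr_ge0; last by rewrite divr_ge0 ?sqr_ge0// ltW ?h_gt0.
  apply: divr_ge0; first by rewrite mulr_ge0 ?sqr_ge0// ltW.
  by rewrite mulr_ge0// ltW.
have b0 : 0 <= (1 + delta) * (g / 2 * (h x - hs) ^+ 2).
  by rewrite mulr_ge0 ?(ltW d1)// mulr_ge0 ?sqr_ge0// divr_ge0 ?ltW.
by rewrite (mulrDr (1 + delta) (g / 2 * _)); lra.
Qed.

(** The surface is at least as long as the hypotenuse of the right triangle
    whose legs are L and the total variation of h; pointwise this is the
    Cauchy-Schwarz inequality in the plane. *)
Lemma height_bound_surface x : 0 <= x <= L ->
  L ^+ 2 + (h x - hs) ^+ 2 <= (En / (sigma * (delta + 1)) + L) ^+ 2.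
Proof.
move=> xL; set A := itg 0 L (fun x => `|P x|).
have A0 : 0 <= A := itg_P_ge0.
have h1 : (h x - hs) ^+ 2 <= A ^+ 2.
  rewrite -[leLHS]ger0_norm ?sqr_ge0// normrX ler_pXn2r ?nnegrE//.
  exact: height_osc.
pose q := Num.sqrt (L ^+ 2 + A ^+ 2).
have LA : 0 < L ^+ 2 + A ^+ 2 by rewrite ltr_pwDl ?sqr_ge0// exprn_gt0.
have q0 : 0 < q by rewrite sqrtr_gt0.
have qE : q ^+ 2 = L ^+ 2 + A ^+ 2 by rewrite sqr_sqrtr// ltW.
have cP1 : cont 0 L (fun x => `|P x|) by within_tac.
have ca := cont_arc.
have s1 : q <= itg 0 L (fun x => Num.sqrt (1 + P x ^+ 2)).
  have -> : q = itg 0 L (fun x => L / q + A / q * `|P x|).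
    rewrite itgD; [|exact: within_cst|by within_tac].
    rewrite itg_cst ?(ltW L_gt0)// itgZ// subr0 -/A.
    rewrite -[LHS](mulfK (lt0r_neq0 q0)) -expr2 qE; field.
    exact: lt0r_neq0.
  apply: itg_le; [by within_tac|exact: cont_arc|].
  move=> z zL; set s := Num.sqrt _; set p := `|P z|.
  have s0 : 0 <= s by exact: sqrtr_ge0.
  have p0 : 0 <= p by exact: normr_ge0.
  have sE : s ^+ 2 = 1 + p ^+ 2.
    by rewrite sqr_sqrtr ?addr_ge0 ?sqr_ge0// /p -normrX ger0_norm ?sqr_ge0.
  rewrite mulrAC -mulrDl ler_pdivrMr//.
  rewrite -(ler_pXn2r (n := 2)) ?nnegrE ?addr_ge0 ?mulr_ge0 ?(ltW L_gt0) ?(ltW q0)//.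
  rewrite exprMn sE qE -subr_ge0 (_ : _ - _ = (L * p - A) ^+ 2) ?sqr_ge0//.
  by ring.
have d1 : 0 < delta + 1 by rewrite addr_gt0.
have s2 : q <= En / (sigma * (delta + 1)) + L.
  rewrite -lerBlDr ler_pdivlMr ?mulr_gt0//; apply: le_trans itg_arc_le.
  rewrite mulrC (addrC 1) ler_pM2l ?mulr_gt0// itgB//; last exact: within_cst.
  by rewrite itg_cst ?(ltW L_gt0)// mul1r subr0 lerB.
apply: (@le_trans _ _ (q ^+ 2)); first by rewrite qE lerD2l.
by rewrite ler_pXn2r ?nnegrE ?(ltW q0)// (le_trans (ltW q0)).
Qed.
End height_bounds.

(** * The fundamental lemma of the calculus of variations *)

Section bump.
Context {R : realType}.
Implicit Types (x y a b : R).

Definition pospart y : R := (y + `|y|) / 2.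

Lemma pospart_ge y : 0 <= y -> pospart y = y.
Proof. by move=> y0; rewrite /pospart ger0_norm//; lra. Qed.

Lemma pospart_le y : y <= 0 -> pospart y = 0.
Proof. by move=> y0; rewrite /pospart ler0_norm//; lra. Qed.

Lemma der_pospart_sqr y : is_derive y 1 (fun z => pospart z ^+ 2) (2 * pospart y).
Proof.
have [y0|y0|->] := ltgtP y 0.
- rewrite (pospart_le (ltW y0)) mulr0.
  apply: (@der_near _ (fun=> 0) _ _ _ (y - 1) 0); [by lra|].
  by move=> z /andP[_ z0]; rewrite (pospart_le (ltW z0)) expr0n.
- rewrite (pospart_ge (ltW y0)).
  apply: (@der_near _ (fun z => z ^+ 2) _ _ _ 0 (y + 1)); first by lra.
    by move=> z /andP[z0 _]; rewrite (pospart_ge (ltW z0)).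
  by der; rewrite /= expr1 mulr1.
- rewrite pospart_ge// mulr0; apply/is_derive1_caratheodory.
  exists pospart; rewrite pospart_ge//; split => //.
    move=> z; rewrite expr0n /= !subr0 expr2.
    have [z0|z0] := leP z 0; first by rewrite pospart_le// !mul0r.
    by rewrite pospart_ge// ltW.
  apply: cvgM; last exact: cvg_cst.
  by apply: cvgD; [exact: cvg_id|exact: norm_continuous].
Qed.

Lemma cont_pospart : continuous pospart.
Proof.
move=> z; apply: cvgM; last exact: cvg_cst.
by apply: cvgD; [exact: cvg_id|exact: norm_continuous].
Qed.

(** A C^1 approximation of the indicator function of ]a, b[, which is 0
    outside of that interval and increases to 1 inside as c decreases to 0. *)
Definition bump a b c x : R :=
  pospart ((x - a) * (b - x)) ^+ 2 / (pospart ((x - a) * (b - x)) ^+ 2 + c).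

Lemma bump_out a b c x : a < b -> x <= a \/ b <= x -> bump a b c x = 0.
Proof.
move=> ab xab; rewrite /bump pospart_le ?expr0n ?mul0r//.
by case: xab => h; [rewrite mulr_le0_ge0|rewrite mulr_ge0_le0]; lra.
Qed.

Lemma bump_den a b c x : 0 < c -> 0 < pospart ((x - a) * (b - x)) ^+ 2 + c.
Proof. by move=> c0; rewrite ltr_wpDl// sqr_ge0. Qed.

Lemma bump_le1 a b c x : 0 < c -> 0 <= bump a b c x <= 1.
Proof.
move=> c0; have d0 := bump_den a b x c0.
by rewrite divr_ge0 ?sqr_ge0 ?(ltW d0)//= ler_pdivrMr// mul1r lerDl ltW.
Qed.

Definition dbump a b c x : R :=
  2 * pospart ((x - a) * (b - x)) * (a + b - 2 * x) * c /
  (pospart ((x - a) * (b - x)) ^+ 2 + c) ^+ 2.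

Lemma der_bump a b c x : 0 < c -> is_derive x 1 (bump a b c) (dbump a b c x).
Proof.
move=> c0; have d0 := lt0r_neq0 (bump_den a b x c0).
have d1 : is_derive x 1 (fun y => (y - a) * (b - y)) (a + b - 2 * x).
  der.
  ring.
have d2 := der_comp d1 (der_pospart_sqr _).
by rewrite /bump; der; rewrite /dbump; field.
Qed.

Lemma cont_dbump a b c : 0 < c -> continuous (dbump a b c).
Proof.
move=> c0; apply/continuous_subspace_setT.
have wp : {within setT, continuous (fun x => pospart ((x - a) * (b - x)))}.
  apply: within_comp; last by move=> x _; exact: cont_pospart.
  by within_tac.
apply: withinM; first by within_tac.
apply: withinV; last by within_tac.
by move=> x _; rewrite expf_neq0// lt0r_neq0// bump_den.
Qed.

Lemma bump_test L a b c : 0 < a -> a < b -> b < L -> 0 < c -> test_function L (bump a b c).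
Proof.
move=> a0 ab bL c0; split.
- by move=> x; have [] := der_bump a b x c0.
- rewrite (_ : derive1 _ = dbump a b c); first exact: cont_dbump.
  by apply/funext => x; rewrite derive1E; have [] := der_bump a b x c0.
- exists a, b; split => // x; rewrite in_itv /= => /negP xab.
  apply: bump_out => //; have [//|ax] := leP x a; first by left.
  right; rewrite leNgt; apply/negP => xb; apply: xab.
  by rewrite !ltW.
Qed.

Lemma bump_cvg a b x : a < x < b -> bump a b n.+1%:R^-1 x @[n --> \oo] --> (1 : R).
Proof.
move=> /andP[ax xb]; set p := pospart ((x - a) * (b - x)) ^+ 2.
have p0 : 0 < p.
  by rewrite exprn_gt0// pospart_ge ?mulr_ge0 ?mulr_gt0 ?subr_ge0 ?subr_gt0// ltW.
have E : p / (p + 0) = 1 by rewrite addr0 divff// gt_eqF.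
rewrite -[X in _ --> X]E.
apply: cvgM; first exact: cvg_cst.
apply: cvgV; first by rewrite addr0 gt_eqF.
apply: cvgD; first exact: cvg_cst.
exact: cvg_harmonic.
Qed.
End bump.
Section fundamental_lemma.
Context {R : realType}.
Local Notation mu := (@lebesgue_measure R).
Implicit Types (U f p phi : R -> R) (a b L x : R).

Lemma integrable_EFin_fine U (D : set R) : measurable D ->
  mu.-integrable D (EFin \o U) ->
  (\int[mu]_(x in D) (U x)%:E = (\int[mu]_(x in D) U x)%:E)%E.
Proof. by move=> mD iU; rewrite /Rintegral fineK//; exact: integrable_fin_num. Qed.

Lemma cont_measurable U : continuous U -> measurable_fun setT U.
Proof. exact: continuous_measurable_fun. Qed.

Lemma cont_bump a b c : 0 < c -> continuous (@bump R a b c).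
Proof. by move=> c0 x; exact: der_cont (der_bump a b x c0). Qed.

Lemma integrable_mul_bounded U phi : mu.-integrable setT (EFin \o U) ->
  measurable_fun setT phi -> (forall x, 0 <= phi x <= 1) ->
  mu.-integrable setT (EFin \o (fun x => U x * phi x)).
Proof.
move=> iU mphi phi1; have [mU _] := integrableP _ _ _ iU.
apply: (le_integrable measurableT _ _ iU).
  by apply/measurable_EFinP/measurable_funM => //; exact/measurable_EFinP.
move=> x _ /=; have /andP[p0 p1] := phi1 x.
by rewrite lee_fin normrM ler_piMr// ger0_norm.
Qed.

(** The bumps converge boundedly to the indicator function of ]a, b[. *)
Lemma itg_test_eq0 L U a b : mu.-integrable setT (EFin \o U) ->
  (forall phi, test_function L phi -> \int[mu]_x (U x * phi x) = 0) ->
  0 < a -> a < b -> b < L -> \int[mu]_(x in `]a, b]) U x = 0.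
Proof.
move=> iU U0 a0 ab bL; pose c n : R := n.+1%:R^-1.
have c0 n : 0 < c n by rewrite invr_gt0 ltr0n.
have mU : measurable_fun setT U by apply/measurable_EFinP; case/integrableP: iU.
have ib n : mu.-integrable setT (EFin \o (fun x => U x * bump a b (c n) x)).
  apply: (integrable_mul_bounded iU) => [|x]; last exact: bump_le1.
  by apply: cont_measurable; exact: cont_bump.
have Z n : (\int[mu]_x (U x * bump a b (c n) x)%:E = 0)%E.
  by rewrite integrable_EFin_fine// U0//; exact: bump_test.
have cv : ((\int[mu]_x (U x * bump a b (c n) x)%:E)%E @[n --> \oo] -->
    (\int[mu]_x (U x * \1_`]a, b[ x)%:E)%E).
  apply: (@dominated_cvg _ _ R mu setT measurableT
    (fun n x => (U x * bump a b (c n) x)%:E) (fun x => (U x * \1_`]a, b[ x)%:E)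
    (fun x => `|U x|%:E)).
  - by move=> n; have /integrableP[] := ib n.
  - move=> x _; apply: cvg_EFin; first exact: nearW.
    rewrite /comp /=; rewrite indicE; case: (boolP (x \in `]a, b[%classic)) => [|xab].
      rewrite inE /= in_itv /= => xab; apply: cvgM; first exact: cvg_cst.
      exact: bump_cvg.
    have {}xab : x <= a \/ b <= x.
      move: xab; rewrite notin_setE /= in_itv /= => /negP.
      by rewrite negb_and -!leNgt => /orP[]; [left|right].
    rewrite mulr0 (_ : (fun n => _) = fun=> 0); first exact: cvg_cst.
    by apply/funext => n; rewrite bump_out// mulr0.
  - by [].
  - exact: integrable_norm.
  - move=> n x _ /=; have /andP[p0 p1] := bump_le1 a b x (c0 n).
    by rewrite lee_fin normrM ler_piMr// ger0_norm.
have {}cv : (\int[mu]_x (U x * \1_`]a, b[ x)%:E = 0)%E.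
  have E : (fun n => \int[mu]_x (U x * bump a b (c n) x)%:E)%E = cst 0%E.
    by apply/funext.
  rewrite E in cv; have <- := cvg_lim (@ereal_hausdorff R) cv.
  by apply: cvg_lim; [exact: ereal_hausdorff|exact: cvg_cst].
rewrite -Rintegral_itv_bndo_bndc; last exact: integrableS iU.
rewrite /Rintegral integral_mkcond /= (_ : (\int[mu]_x _)%E = 0%E)// -[RHS]cv.
apply: eq_integral => x _; rewrite /patch indicE; case: ifPn => xab.
  by rewrite mulr1.
by rewrite mulr0.
Qed.

(** The primitive of U is constant on ]0, L[, and U is its derivative at
    almost every point. *)
Lemma fundamental_lemma L U : mu.-integrable setT (EFin \o U) ->
  (forall x, ~ (0 < x < L) -> U x = 0) ->
  (forall phi, test_function L phi -> \int[mu]_x (U x * phi x) = 0) ->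
  {ae mu, forall x, U x = 0}.
Proof.
move=> iU Uout U0.
have lU : locally_integrable setT U.
  by apply: open_integrable_locally => //; exact: openT.
have iNy y : mu.-integrable `]-oo, y] (EFin \o U) by exact: integrableS iU.
have := FTC1Ny iNy lU; apply: filterS; first exact: (ae_filter_ringOfSetsType mu).
move=> x [_]; have [xL|xL] := boolP (0 < x < L); last first.
  by move=> _; apply: Uout; exact/negP.
move=> <-; rewrite derive1E.
set F := fun x => \int[mu]_(t in `]-oo, x]) U t.
have FE y z : 0 < y -> y < z -> z < L -> F y = F z.
  move=> y0 yz zL; apply/eqP; rewrite eq_sym -subr_eq0; apply/eqP.
  rewrite /F Rintegral_itvB//; last by rewrite bnd_simp ltW.
  exact: itg_test_eq0 U0 _ _ _.
have dF : is_derive x 1 F 0.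
  apply: (@der_near _ (fun=> F x) _ _ _ 0 L) => //.
  move=> y /andP[y0 yL]; have [xy|yx|->//] := ltgtP x y.
    by apply: FE => //; case/andP: xL.
  by apply/esym/FE => //; case/andP: xL.
by have [] := dF.
Qed.
End fundamental_lemma.

(** * Weak derivatives of functions of class C^1 *)

Section weak_derivative_of_C1.
Context {R : realType}.
Local Notation mu := (@lebesgue_measure R).
Local Notation itg a b f := (\int[lebesgue_measure]_(x in `[a, b]) f x).
Local Notation cont a b f := {within `[a, b], continuous f}.
Implicit Types (f p phi h P : R -> R) (a b L x : R).

Lemma cont_measurable_oo a b f : cont a b f -> measurable_fun `]a, b[ f.
Proof.
move=> cf; apply: (measurable_funS (measurable_itv `[a, b])).
  by apply: subset_itv; rewrite bnd_simp.
by apply: subspace_continuous_measurable_fun.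
Qed.

Lemma itg_oo a b f : measurable_fun `]a, b[ f ->
  itg a b f = \int[mu]_(x in `]a, b[) f x.
Proof.
move=> mf; rewrite /Rintegral integral_itv_bndo_bndc; last exact/measurable_EFinP.
rewrite integral_itv_obnd_cbnd//; apply/measurable_EFinP.
exact: measurable_fun_itv_oc mf.
Qed.

Lemma L2_measurable L f : L2 L f -> measurable_fun `]0, L[ f.
Proof.
rewrite /L2 inE => /andP[+ _]; rewrite inE /= => mf.
by apply/(measurable_restrictT _ _).2 => //.
Qed.

Lemma cont_L2 L f : cont 0 L f -> L2 L f.
Proof.
move=> cf; rewrite /L2 inE; apply/andP; split; rewrite inE /=.
  by apply/(measurable_restrictT _ _).1 => //; exact: cont_measurable_oo.
rewrite /finite_norm unlock; apply: poweR_lty.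
have /integrableP[_] : mu.-integrable `]0, L[ (EFin \o (fun x => f x ^+ 2)).
  apply: (@integrableS _ _ _ mu `[0, L]) => //.
    by apply: subset_itv; rewrite bnd_simp.
  by apply: cont_integrable; within_tac.
apply: le_lt_trans; rewrite [leRHS]integral_mkcond le_eqVlt; apply/orP; left.
apply/eqP; apply: eq_integral => x _; rewrite /= /patch; case: ifPn => _ /=.
  by rewrite powR_mulrn// -normrX.
rewrite (_ : (point : R) = 0)// (_ : (point : \bar R) = 0%E)//.
by rewrite normr0 powR0.
Qed.

Lemma L2norm_sqr L f : L2 L f -> L2norm L f ^+ 2 = \int[mu]_(x in `]0, L[) f x ^+ 2.
Proof.
move=> /[dup] L2f /Lfun2_integrable_sqr isq.
have E : (\int[mu]_x (`|(f \_ `]0, L[) x| `^ 2)%:E =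
    (\int[mu]_(x in `]0, L[) f x ^+ 2)%:E)%E.
  transitivity (\int[mu]_x ((f \_ `]0, L[) x ^+ 2)%:E)%E.
    apply: eq_integral => x _.
    by rewrite powR_mulrn// -normrX ger0_norm ?sqr_ge0.
  rewrite integrable_EFin_fine//; congr (_%:E).
  rewrite [RHS]Rintegral_mkcond; apply: eq_Rintegral => x _; rewrite /patch.
  by case: ifPn => // _; rewrite expr0n.
rewrite /L2norm unlock; under eq_integral do rewrite /=.
have -> : (\int[mu]_x (`|(f \_ `]0, L[) x|%:E `^ 2) =
    (\int[mu]_(x in `]0, L[) f x ^+ 2)%:E)%E by exact: E.
rewrite poweR_EFin /= -powR_mulrn ?powR_ge0// -powRrM mulVf ?pnatr_eq0// powRr1//.
by apply: Rintegral_ge0 => x _; rewrite sqr_ge0.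
Qed.

Lemma cont_L2norm_sqr L f : cont 0 L f -> L2norm L f ^+ 2 = itg 0 L (fun x => f x ^+ 2).
Proof.
move=> cf; rewrite L2norm_sqr; last exact: cont_L2.
by rewrite itg_oo//; apply: cont_measurable_oo; within_tac.
Qed.

Lemma C1_weak_derivative L f p : 0 < L -> cont 0 L f -> cont 0 L p ->
  (forall x, 0 < x < L -> is_derive x 1 f (p x)) -> is_weak_derivative L f p.
Proof.
move=> L0 cf cp df phi [dphi cdphi [a [b [a0 bL phi0]]]].
have dphi' x : is_derive x 1 phi (derive1 phi x).
  by rewrite derive1E; exact/derivableP.
have cphi : cont 0 L phi by apply: (@der_within _ _ _ _ (derive1 phi)).
have cdphi' : cont 0 L (derive1 phi) by exact: continuous_subspaceT.
have z x : x < a \/ b < x -> phi x = 0.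
  by move=> h; apply: phi0; rewrite in_itv /=; apply/negP; lra.
have z0 : phi 0 = 0 by apply: z; left.
have zL : phi L = 0 by apply: z; right.
apply/eqP; rewrite -addr_eq0 /integral_0L -itgD; [|within_tac..].
have cF : cont 0 L (fun x => f x * phi x) by within_tac.
have cF' : cont 0 L (fun x => f x * derive1 phi x + p x * phi x) by within_tac.
have dF x : 0 < x < L ->
    is_derive x 1 (fun x => f x * phi x) (f x * derive1 phi x + p x * phi x).
  by move=> xL; have := df x xL => dfx; have := dphi' x => dpx; der; ring.
by rewrite (itg_ftc (ltW L0) cF' cF dF) z0 zL !mulr0 subrr.
Qed.

Lemma test_function_out L phi x : test_function L phi -> ~ (0 < x < L) -> phi x = 0.
Proof.
move=> [_ _ [a [b [a0 bL phi0]]]] xL; apply: phi0; rewrite in_itv /=.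
by apply/negP => xab; apply: xL; lra.
Qed.

Lemma weak_derivative_unique L f p q : 0 < L -> L2 L p -> L2 L q ->
  is_weak_derivative L f p -> is_weak_derivative L f q ->
  {ae mu, forall x, (0 < x < L) -> p x = q x}.
Proof.
move=> L0 L2p L2q wp wq.
pose Up := p \_ `]0, L[; pose Uq := q \_ `]0, L[.
have one : L2 L (fun _ : R => 1 : R) by apply: cont_L2; exact: within_cst.
have integ r : L2 L r -> mu.-integrable setT (EFin \o r \_ `]0, L[).
  move=> L2r; have /Lfun1_integrable := Lfun2_mul_Lfun1 L2r one.
  apply: eq_integrable => // x _ /=; congr (_%:E); rewrite /patch.
  by case: ifPn => _; rewrite ?mulr1 ?mulr0.
have weak r phi : L2 L r -> test_function L phi ->
    mu.-integrable setT (EFin \o (fun x => (r \_ `]0, L[) x * phi x)) /\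
    integral_0L L (fun x => r x * phi x) = \int[mu]_x ((r \_ `]0, L[) x * phi x).
  move=> L2r tphi; have [dphi _ _] := tphi.
  have cphi : cont 0 L phi.
    by apply: derivable_within_continuous => x _; exact: dphi.
  split.
    have /Lfun1_integrable := Lfun2_mul_Lfun1 L2r (cont_L2 cphi).
    apply: eq_integrable => // x _ /=; congr (_%:E); rewrite /patch.
    by case: ifPn => _; rewrite ?mul0r.
  rewrite /integral_0L [LHS]Rintegral_mkcond; apply: eq_Rintegral => x _.
  rewrite /patch; case: ifPn => xL; case: ifPn => xL' //.
  - rewrite (test_function_out tphi) ?mulr0//.
    by move: xL'; rewrite notin_setE /= in_itv.
  - move: xL xL'; rewrite notin_setE inE /= !in_itv /= => h1 h2.
    by exfalso; apply: h1; lra.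
  - by rewrite (_ : (point : R) = 0)// mul0r.
have iU : mu.-integrable setT (EFin \o (fun x => Up x - Uq x)).
  rewrite (_ : _ \o _ = (EFin \o Up) \- (EFin \o Uq))%E; last exact/funext.
  by apply: integrableB => //; exact: integ.
have := @fundamental_lemma R L _ iU.
have out x : ~ 0 < x < L -> Up x - Uq x = 0.
  move=> xL; rewrite /Up /Uq /patch !ifN ?subrr//; rewrite notin_setE /= in_itv //.
move=> /(_ out); set Z := (forall phi, _) => h.
have {}h : {ae mu, forall x, Up x - Uq x = 0}.
  apply: h => phi tphi; have [ip Ep] := weak p phi L2p tphi.
  have [iq Eq] := weak q phi L2q tphi.
  transitivity (\int[mu]_x (Up x * phi x - Uq x * phi x)).
    by apply: eq_Rintegral => x _; rewrite mulrBl.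
  rewrite RintegralB// -Ep -Eq; apply/eqP; rewrite subr_eq0; apply/eqP.
  by apply: oppr_inj; rewrite -wp// -wq.
move: h; apply: filterS; first exact: (ae_filter_ringOfSetsType mu).
move=> x /eqP; rewrite subr_eq0 => /eqP + xL.
by rewrite /Up /Uq /patch !ifT// inE /= in_itv.
Qed.

(** The chosen weak derivative of a function of class C^1 on [0, L] may be
    replaced by its classical derivative under any integral. *)
Lemma weak_derivativeE L f p : 0 < L -> cont 0 L f -> cont 0 L p ->
  (forall x, 0 < x < L -> is_derive x 1 f (p x)) ->
  [/\ H1 L f, L2 L (weak_derivative L f) &
      {ae mu, forall x, (0 < x < L) -> weak_derivative L f x = p x}].
Proof.
move=> L0 cf cp df; have wp := C1_weak_derivative L0 cf cp df.
have L2p := cont_L2 cp.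
have [L2w ww] := xgetI (fun=> 0) (conj L2p wp :
  [set p | L2 L p /\ is_weak_derivative L f p] p).
split => //; first by split; [exact: cont_L2|exists p].
exact: weak_derivative_unique ww wp.
Qed.

Lemma ae_itg L (F : R -> R -> R) p q : measurable_fun `]0, L[ (fun x => F x (p x)) ->
  measurable_fun `]0, L[ (fun x => F x (q x)) ->
  {ae mu, forall x, (0 < x < L) -> p x = q x} ->
  itg 0 L (fun x => F x (p x)) = itg 0 L (fun x => F x (q x)).
Proof.
move=> mp mq pq; rewrite !itg_oo// /Rintegral; congr fine.
apply: ae_eq_integral => //; try exact/measurable_EFinP.
move: pq; apply: filterS; first exact: (ae_filter_ringOfSetsType mu).
by move=> x h; rewrite /= in_itv /= => xL; rewrite h.
Qed.

Lemma weak_derivative_norm L f p : 0 < L -> cont 0 L f -> cont 0 L p ->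
  (forall x, 0 < x < L -> is_derive x 1 f (p x)) ->
  L2norm L (weak_derivative L f) ^+ 2 = itg 0 L (fun x => p x ^+ 2).
Proof.
move=> L0 cf cp df; have [_ L2w wE] := weak_derivativeE L0 cf cp df.
have mw := L2_measurable L2w.
rewrite L2norm_sqr// -itg_oo; last exact: measurable_funX.
apply: (@ae_itg _ (fun _ y => y ^+ 2)) => //; first exact: measurable_funX.
by apply: cont_measurable_oo; within_tac.
Qed.
End weak_derivative_of_C1.

(** * Energy and input controlled by the dissipation *)

Lemma density_sum_le (R : realType) (delta sigma p W hv c P2 u w : R) :
  W <= hv + c * P2 -> (1 + delta) * p <= (1 + delta) * (u + sigma * (P2 / 2)) ->
  (delta / 2 + 1) * hv <= (delta / 2 + 1) * w ->
  delta * (1 / 2 * hv + p) + (W + p) <=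
    (delta / 2 + 1) * w + (c + (1 + delta) * (sigma / 2)) * P2 + (1 + delta) * u.
Proof. by lra. Qed.

Section decay_rate.
Context {R : realType}.
Local Notation itg a b f := (\int[lebesgue_measure]_(x in `[a, b]) f x).
Local Notation cont a b f := {within `[a, b], continuous f}.
Context (g mu sigma L m Hmax delta Q : R).
Context (g_gt0 : 0 < g) (mu_gt0 : 0 < mu) (sigma_gt0 : 0 < sigma)
  (L_gt0 : 0 < L) (m_gt0 : 0 < m) (delta_gt0 : 0 < delta) (Q_gt0 : 0 < Q)
  (Hmax_gt0 : 0 < Hmax).
Context (h P v vx : R -> R) (ch : cont 0 L h) (cP : cont 0 L P) (cv : cont 0 L v)
  (cvx : cont 0 L vx).
Context (dh : forall x, 0 < x < L -> is_derive x 1 h (P x)).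
Context (dv : forall x, 0 < x < L -> is_derive x 1 v (vx x)).
Context (v0 : v 0 = 0) (vL : v L = 0).
Context (hQ : forall x, 0 <= x <= L -> Q <= h x <= Hmax) (mass : itg 0 L h = m).
Let hs := m / L.
Local Notation en x := (V_density g mu sigma delta hs (h x) (v x) (P x)).
Local Notation En := (itg 0 L (fun x => en x)).
Local Notation A := (itg 0 L (fun x => h x * vx x ^+ 2)).
Local Notation B := (itg 0 L (fun x => P x ^+ 2)).
Local Notation Iv := (itg 0 L (fun x => v x ^+ 2)).
Local Notation M := (itg 0 L (fun x => h x * v x)).

Let h_gt0 x : 0 <= x <= L -> 0 < h x.
Proof. by move=> /hQ /andP[+ _]; exact: lt_le_trans. Qed.

(** Wirtinger inequality, and h >= Q. *)
Lemma velocity_sqr_le : Iv <= L ^+ 2 / (pi ^+ 2 * Q) * A.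
Proof.
have p0 : 0 < pi ^+ 2 :> R by rewrite exprn_gt0 ?pi_gt0.
have h1 := poincare L_gt0 cv cvx dv v0 vL.
have h2 : Q * itg 0 L (fun x => vx x ^+ 2) <= A.
  rewrite -itgZ; last by within_tac.
  apply: itg_le; [by within_tac..|] => x xL.
  by rewrite ler_wpM2r ?sqr_ge0//; case/andP: (hQ xL).
have h3 : pi ^+ 2 * Q * Iv <= L ^+ 2 * A.
  apply: (@le_trans _ _ (Q * (L ^+ 2 * itg 0 L (fun x => vx x ^+ 2)))).
    by rewrite mulrAC mulrC ler_pM2l.
  by rewrite mulrCA ler_pM2l ?exprn_gt0.
rewrite mulrAC ler_pdivlMr; last exact: mulr_gt0.
by rewrite mulrC.
Qed.

Lemma friction_ge0 : 0 <= A.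
Proof. by apply: itg_ge0 => x xL; rewrite mulr_ge0 ?sqr_ge0 ?ltW ?h_gt0. Qed.

Lemma slope_sqr_ge0 : 0 <= B.
Proof. by apply: itg_ge0 => x xL; rewrite sqr_ge0. Qed.

Lemma momentum_sqr_le : M ^+ 2 <= m * Hmax * L ^+ 2 / (pi ^+ 2 * Q) * A.
Proof.
have cs : M ^+ 2 <= m * itg 0 L (fun x => h x * v x ^+ 2).
  rewrite -mass; apply: cauchy_schwarz => //; [exact: ltW| |by rewrite mass].
  by move=> x xL; rewrite ltW ?h_gt0.
have h2 : itg 0 L (fun x => h x * v x ^+ 2) <= Hmax * Iv.
  rewrite -itgZ; last by within_tac.
  apply: itg_le; [by within_tac..|] => x xL.
  by rewrite ler_wpM2r ?sqr_ge0//; case/andP: (hQ xL).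
apply: (le_trans cs); rewrite -!mulrA ler_pM2l//; apply: (le_trans h2).
rewrite ler_pM2l//; apply: le_trans velocity_sqr_le _.
by rewrite !mulrA.
Qed.

Lemma height_drop_sqr_le : (h L - h 0) ^+ 2 <= L * B.
Proof.
have <- : itg 0 L P = h L - h 0 by apply: itg_ftc => //; exact: ltW.
by have := itg_sqr_le L_gt0 cP; rewrite subr0.
Qed.

Lemma height_dev_sqr_le x : 0 <= x <= L -> (h x - hs) ^+ 2 <= L * B.
Proof.
move=> xL; have cP1 : cont 0 L (fun x => `|P x|) by within_tac.
have := itg_sqr_le L_gt0 cP1; rewrite subr0.
have -> : itg 0 L (fun x => `|P x| ^+ 2) = B.
  by apply: eq_itg => z _; rewrite -normrX ger0_norm ?sqr_ge0.
apply: le_trans; rewrite -[leLHS]ger0_norm ?sqr_ge0// normrX ler_pXn2r ?nnegrE//.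
  exact: (height_osc L_gt0 ch cP dh mass).
exact: itg_P_ge0.
Qed.

Lemma arc_le P0 : Num.sqrt (1 + P0 ^+ 2) - 1 <= P0 ^+ 2 / 2 :> R.
Proof.
rewrite lerBlDr -(ler_pXn2r (n := 2)) ?nnegrE ?sqrtr_ge0//; last first.
  by rewrite addr_ge0 ?divr_ge0 ?sqr_ge0.
rewrite sqr_sqrtr ?addr_ge0 ?sqr_ge0// -subr_ge0.
by rewrite (_ : _ - _ = (P0 ^+ 2 / 2) ^+ 2) ?sqr_ge0//; field.
Qed.

Definition energy_const : R :=
  (delta / 2 + 1) * Hmax * (L ^+ 2 / (pi ^+ 2 * Q)) / (delta * mu) +
  (mu ^+ 2 / Q + (1 + delta) * (sigma / 2 + g / 2 * L ^+ 2)) / (mu * g).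

Lemma energy_const_gt0 : 0 < energy_const.
Proof.
have p0 : 0 < pi ^+ 2 :> R by rewrite exprn_gt0 ?pi_gt0.
have L2 : 0 < L ^+ 2 by rewrite exprn_gt0.
have d2 : 0 < delta / 2 + 1 by rewrite addr_gt0// divr_gt0.
have c1 : 0 < (delta / 2 + 1) * Hmax * (L ^+ 2 / (pi ^+ 2 * Q)) / (delta * mu).
  apply: divr_gt0; last exact: mulr_gt0.
  by rewrite mulr_gt0 ?(mulr_gt0 d2)// divr_gt0// mulr_gt0.
rewrite addr_gt0// divr_gt0 ?mulr_gt0// addr_gt0 ?divr_gt0 ?exprn_gt0//.
by rewrite mulr_gt0 ?addr_gt0 ?mulr_gt0 ?divr_gt0.
Qed.

(** The kinetic energy is controlled by the viscous dissipation, through the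
    Wirtinger inequality. The rest is controlled by the integral of h_x^2,
    because the profile attains its mean height. *)
Lemma energy_le : En <= energy_const * (delta * mu * A + mu * g * B).
Proof.
have p0 : 0 < pi ^+ 2 :> R by rewrite exprn_gt0 ?pi_gt0.
have d1 : 0 < 1 + delta by rewrite addr_gt0.
have d2 : 0 < delta / 2 + 1 by rewrite addr_gt0// divr_gt0.
have A0 := friction_ge0; have B0 := slope_sqr_ge0.
pose c1 := (delta / 2 + 1) * Hmax; pose c2 := mu ^+ 2 / Q + (1 + delta) * (sigma / 2).
pose c3 := (1 + delta) * (g / 2 * (L * B)).
have cen : cont 0 L (fun x => en x).
  by apply: cont_V_density => //; exact: h_gt0.
have h1 : En <= c1 * Iv + c2 * B + c3 * L.
  have -> : c3 * L = itg 0 L (fun=> c3) by rewrite itg_cst ?subr0 ?ltW.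
  rewrite -itgZ; last by within_tac.
  rewrite -[X in _ + X + _]itgZ; last by within_tac.
  rewrite -itgD; [|by within_tac..].
  rewrite -itgD; [|by within_tac..].
  apply: itg_le => //; first by within_tac.
  move=> x xL; have [Qh hH] := andP (hQ xL); have h0 := h_gt0 xL.
  have e1 : h x * v x ^+ 2 <= Hmax * v x ^+ 2 by rewrite ler_wpM2r ?sqr_ge0.
  have e2 : 1 / 2 * ((h x)^-1 * (h x * v x + mu * P x) ^+ 2) <=
      h x * v x ^+ 2 + mu ^+ 2 / Q * P x ^+ 2.
    apply: (@le_trans _ _ (h x * v x ^+ 2 + mu ^+ 2 / h x * P x ^+ 2)).
      rewrite -subr_ge0.
      rewrite (_ : _ - _ = 1 / 2 * ((h x)^-1 * (h x * v x - mu * P x) ^+ 2)).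
        by rewrite mulr_ge0// mulr_ge0 ?sqr_ge0// invr_ge0 ltW.
      by field; rewrite gt_eqF.
    rewrite lerD2l ler_wpM2r ?sqr_ge0// ler_wpM2l ?sqr_ge0//.
    by rewrite lef_pV2 ?posrE.
  have e3 := arc_le (P x); have e4 := height_dev_sqr_le xL.
  have e5 : pot_density g sigma hs (h x) (P x) <=
      g / 2 * (L * B) + sigma * (P x ^+ 2 / 2).
    rewrite /pot_density lerD//; first by rewrite ler_pM2l ?divr_gt0.
    by rewrite ler_pM2l.
  rewrite /V_density /E_density /W_density.
  move: (pot_density g sigma hs (h x) (P x)) e5 => p e5.
  have e6 : (1 + delta) * p <= (1 + delta) * (g / 2 * (L * B) + sigma * (P x ^+ 2 / 2)).
    by rewrite ler_pM2l.
  have e7 : (delta / 2 + 1) * (h x * v x ^+ 2) <= (delta / 2 + 1) * (Hmax * v x ^+ 2).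
    by rewrite ler_pM2l.
  have := density_sum_le e2 e6 e7.
  by rewrite /c1 -(mulrA (delta / 2 + 1)).
have h2 : c1 * Iv <= c1 * (L ^+ 2 / (pi ^+ 2 * Q)) * A.
  by rewrite -mulrA ler_pM2l ?mulr_gt0// velocity_sqr_le.
apply: (le_trans h1).
set z1 := c1 * (L ^+ 2 / (pi ^+ 2 * Q)).
pose z2 := c2 + (1 + delta) * (g / 2) * L ^+ 2.
have L2 : 0 < L ^+ 2 by rewrite exprn_gt0.
have z10 : 0 <= z1.
  by apply/ltW; rewrite mulr_gt0 ?(mulr_gt0 d2)// divr_gt0// mulr_gt0.
have z20 : 0 <= z2.
  apply/ltW; rewrite addr_gt0//; last by rewrite mulr_gt0// mulr_gt0 ?divr_gt0.
  rewrite addr_gt0//; first by rewrite divr_gt0 ?exprn_gt0.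
  by rewrite mulr_gt0 ?divr_gt0.
have dm : 0 < delta * mu by rewrite mulr_gt0.
have mg : 0 < mu * g by rewrite mulr_gt0.
have EC : energy_const = z1 / (delta * mu) + z2 / (mu * g).
  rewrite /energy_const /z1 /z2 /c1 /c2; move: (pi ^+ 2 : R) p0 => p p0.
  by field; rewrite !gt_eqF.
rewrite EC.
have x1 : 0 <= z1 / (delta * mu) * (mu * g * B).
  by rewrite mulr_ge0 ?(mulr_ge0 (ltW mg))// divr_ge0 ?(ltW dm).
have x2 : 0 <= z2 / (mu * g) * (delta * mu * A).
  by rewrite mulr_ge0 ?(mulr_ge0 (ltW dm))// divr_ge0 ?(ltW mg).
have x3 : z1 / (delta * mu) * (delta * mu * A) = z1 * A.
  by field; rewrite !gt_eqF.
have x4 : z2 / (mu * g) * (mu * g * B) = z2 * B.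
  by field; rewrite !gt_eqF.
have x5 : z2 * B = c2 * B + c3 * L by rewrite /z2 /c3; ring.
rewrite (mulrDl (z1 / _)) (mulrDr (z1 / _)) (mulrDr (z2 / _)) x3 x4 x5.
move: h2; rewrite -/z1 => h2.
apply: (@le_trans _ _ (z1 * A + (c2 * B + c3 * L))); first by rewrite -addrA lerD2r.
by rewrite lerD ?lerDl ?lerDr.
Qed.

(** The momentum is estimated by the viscous dissipation A, the height
    difference between the walls by the integral B of h_x^2. *)
Lemma input_sqr_le C :
  2 * (delta + 1) ^+ 2 * m * Hmax * L ^+ 2 / (pi ^+ 2 * Q * delta * mu) <= C ->
  2 * mu * L / g <= C ->
  ((delta + 1) * M + mu * (h L - h 0)) ^+ 2 <= C * (delta * mu * A + mu * g * B).
Proof.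
move=> C1 C2; have A0 := friction_ge0; have B0 := slope_sqr_ge0.
have m1 := momentum_sqr_le; have m2 := height_drop_sqr_le.
have p0 : 0 < pi ^+ 2 :> R by rewrite exprn_gt0 ?pi_gt0.
have dm : 0 < delta * mu by rewrite mulr_gt0.
have mg : 0 < mu * g by rewrite mulr_gt0.
set X := (delta + 1) * M; set Y := mu * _.
apply: (@le_trans _ _ (2 * X ^+ 2 + 2 * Y ^+ 2)).
  by rewrite -subr_ge0 (_ : _ - _ = (X - Y) ^+ 2) ?sqr_ge0//; ring.
rewrite mulrDr lerD//.
  apply: (@le_trans _ _ (2 * (delta + 1) ^+ 2 * m * Hmax * L ^+ 2 /
      (pi ^+ 2 * Q * delta * mu) * (delta * mu * A))).
    have -> : 2 * X ^+ 2 = 2 * (delta + 1) ^+ 2 * M ^+ 2 by rewrite /X; ring.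
    have -> : 2 * (delta + 1) ^+ 2 * m * Hmax * L ^+ 2 / (pi ^+ 2 * Q * delta * mu) *
        (delta * mu * A) =
        2 * (delta + 1) ^+ 2 * (m * Hmax * L ^+ 2 / (pi ^+ 2 * Q) * A).
      by move: (pi ^+ 2 : R) p0 => p p0; field; rewrite !gt_eqF.
    by rewrite ler_wpM2l// mulr_ge0 ?sqr_ge0.
  by rewrite ler_wpM2r// mulr_ge0// ltW.
apply: (@le_trans _ _ (2 * mu * L / g * (mu * g * B))).
  have -> : 2 * Y ^+ 2 = 2 * mu ^+ 2 * (h L - h 0) ^+ 2 by rewrite /Y; ring.
  have -> : 2 * mu * L / g * (mu * g * B) = 2 * mu ^+ 2 * (L * B).
    by field; rewrite !gt_eqF.
  by rewrite ler_wpM2l// mulr_ge0 ?sqr_ge0.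
by rewrite ler_wpM2r// mulr_ge0// ltW.
Qed.
End decay_rate.

(** An upper bound for the fraction of the dissipation that is spent on the
    only power of the wrong sign, k q y^2 with y = w + k xi. *)
Definition decay_ratio (R : realType) (omega k q C : R) : R := k / q * (omega^-1 + C).

(** The first entry is the rate of the term in xi^2, the second one that of
    all the others. *)
Definition decay_lambda (R : realType) (omega k q C C4 : R) : R :=
  Num.min k ((1 - decay_ratio omega k q C) / (2 * (C4 + (omega^-1 + C) / (2 * q)))).

(** With y = w + k xi, the quantity that the feedback law measures is a = Phi
    - q y, and the dissipation is T = omega a^2 + D0. Both a and Phi are
    controlled by T, hence so is their difference: (q y)^2 <= (1 / omega + C)
    T. The only power of the wrong sign is k q y^2, and it is absorbed
    because k (1 / omega + C) < q. *)
Lemma feedback_power (R : realType) (omega k q C C4 D0 Phi xi w V0 f : R) :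
  0 < omega -> 0 < k -> 0 < q -> 0 < C -> 0 < C4 -> k * (omega^-1 + C) < q ->
  0 <= D0 -> Phi ^+ 2 <= C * D0 -> V0 <= C4 * D0 ->
  f = - (omega * (Phi - q * (w + k * xi))) ->
  2 * decay_lambda omega k q C C4 * (V0 + (q * k ^+ 2 / 2 * xi ^+ 2 + q / 2 * (w + k * xi) ^+ 2)) <=
    D0 - f * Phi - (q * k ^+ 2 * xi * w + q * (w + k * xi) * (- f + k * w)).
Proof.
move=> w0 k0 q0 C0 C40 kq D00 hPhi hV fE.
pose rho := decay_ratio omega k q C; pose lambda := decay_lambda omega k q C C4.
pose y := w + k * xi; pose a := Phi - q * y; pose T := omega * a ^+ 2 + D0.
pose K := omega^-1 + C.
have K0 : 0 < K by rewrite addr_gt0 ?invr_gt0.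
have T0 : 0 <= T by rewrite addr_ge0// mulr_ge0 ?sqr_ge0 ?ltW.
have hy : (q * y) ^+ 2 <= K * T.
  apply: (@le_trans _ _ (K * (omega * a ^+ 2 + Phi ^+ 2 / C))).
    rewrite -subr_ge0 /K.
    rewrite (_ : _ - _ = (C * omega * a + Phi) ^+ 2 / (C * omega)).
      by rewrite divr_ge0 ?sqr_ge0// mulr_ge0// ltW.
    by rewrite /a; field; rewrite !gt_eqF.
  by rewrite ler_pM2l// lerD2l ler_pdivrMr// mulrC.
have rho1 : rho < 1 by rewrite /rho /decay_ratio mulrAC ltr_pdivrMr// mul1r.
have E : D0 - f * Phi - (q * k ^+ 2 * xi * w + q * (w + k * xi) * (- f + k * w)) =
    T + q * k ^+ 3 * xi ^+ 2 - k / q * (q * y) ^+ 2.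
  by rewrite fE /T /a /y; field; rewrite gt_eqF.
have hk : k / q * (q * y) ^+ 2 <= rho * T.
  by rewrite /rho /decay_ratio -/K -(mulrA (k / q)) ler_pM2l ?divr_gt0.
have den : 0 < 2 * (C4 + K / (2 * q)).
  by rewrite mulr_gt0// addr_gt0// divr_gt0// mulr_gt0.
have l0 : 0 <= lambda.
  by rewrite /lambda /decay_lambda -/rho -/K le_min ltW//= divr_ge0 ?subr_ge0 ?ltW.
have lk : lambda <= k by rewrite /lambda /decay_lambda ge_min lexx.
have lr : lambda * (2 * (C4 + K / (2 * q))) <= 1 - rho.
  by rewrite -ler_pdivlMr// /lambda /decay_lambda ge_min lexx orbT.
rewrite E -/lambda; have yE : q / 2 * (w + k * xi) ^+ 2 = (q * y) ^+ 2 / (2 * q).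
  by rewrite /y; field; rewrite gt_eqF.
have b1 : V0 + (q * y) ^+ 2 / (2 * q) <= (C4 + K / (2 * q)) * T.
  rewrite (mulrDl C4) lerD//.
    by apply: (le_trans hV); rewrite ler_pM2l// /T lerDr mulr_ge0 ?sqr_ge0 ?ltW.
  by rewrite [leRHS]mulrAC ler_pM2r// invr_gt0 mulr_gt0.
have b2 : 2 * lambda * (V0 + (q * y) ^+ 2 / (2 * q)) <= (1 - rho) * T.
  apply: (@le_trans _ _ (2 * lambda * ((C4 + K / (2 * q)) * T))).
    by rewrite ler_wpM2l// mulr_ge0.
  rewrite mulrA; apply: ler_wpM2r => //.
  by apply: le_trans lr; rewrite le_eqVlt; apply/orP; left; apply/eqP; ring.
have b3 : 2 * lambda * (q * k ^+ 2 / 2 * xi ^+ 2) <= q * k ^+ 3 * xi ^+ 2.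
  have -> : 2 * lambda * (q * k ^+ 2 / 2 * xi ^+ 2) = lambda * (q * k ^+ 2 * xi ^+ 2) by field.
  have -> : q * k ^+ 3 * xi ^+ 2 = k * (q * k ^+ 2 * xi ^+ 2) by ring.
  by rewrite ler_wpM2r// mulr_ge0 ?sqr_ge0// mulr_ge0 ?sqr_ge0// ltW.
rewrite yE addrCA mulrDr; move: b2; rewrite mulrBl mul1r => b2.
by move: b2 b3 hk; set z1 := 2 * lambda * _; set z2 := 2 * lambda * _; lra.
Qed.

Lemma decay_lambda_gt0 (R : realType) (omega k q C C4 : R) :
  0 < omega -> 0 < k -> 0 < q -> 0 < C -> 0 < C4 -> k * (omega^-1 + C) < q ->
  0 < decay_lambda omega k q C C4.
Proof.
move=> w0 k0 q0 C0 C40 kq; rewrite lt_min k0 divr_gt0//.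
  by rewrite subr_gt0 /decay_ratio mulrAC ltr_pdivrMr// mul1r.
by rewrite mulr_gt0// addr_gt0// divr_gt0 ?mulr_gt0// addr_gt0 ?invr_gt0.
Qed.

(** * The energy level R and the height Q_1 *)

Section thresholds.
Context {R : realType}.
Context (g mu sigma L m Hmax delta : R).
Context (g_gt0 : 0 < g) (mu_gt0 : 0 < mu) (sigma_gt0 : 0 < sigma)
  (L_gt0 : 0 < L) (m_gt0 : 0 < m) (delta_gt0 : 0 < delta).
Let hs := m / L.
Context (hH : hs < Hmax).
Let k := mu * Num.sqrt (delta * g).
Let hs0 : 0 < hs. Proof. exact: divr_gt0. Qed.
Let k0 : 0 < k. Proof. by rewrite mulr_gt0// sqrtr_gt0 mulr_gt0. Qed.

Lemma absG_decr a b : 0 <= a -> a < b -> b <= hs -> absG hs b < absG hs a.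
Proof.
move=> a0 ab bh; have b0 : 0 <= b by rewrite (le_trans a0)// ltW.
have sab : Num.sqrt a < Num.sqrt b by rewrite ltr_sqrt// (le_lt_trans a0).
have sbh : Num.sqrt b <= Num.sqrt hs by rewrite ler_sqrt// ltW.
rewrite !absGE ?(ltW hs0)//.
have := sqrtr_ge0 a; move: sab sbh; set s := Num.sqrt a; set t := Num.sqrt b.
set c := Num.sqrt hs => st tc s0; rewrite -subr_gt0.
rewrite (_ : _ - _ = 2 / 3 * ((t - s) * (3 * c ^+ 2 - (t ^+ 2 + t * s + s ^+ 2)))); last by field.
rewrite !mulr_gt0 ?subr_gt0//.
have h1 : t ^+ 2 <= c ^+ 2 by rewrite ler_pXn2r ?nnegrE//; lra.
have h2 : s ^+ 2 < c ^+ 2 by rewrite ltr_pXn2r ?nnegrE//; lra.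
have h3 : t * s <= c ^+ 2 by rewrite expr2 ler_pM//; lra.
lra.
Qed.

Lemma absG_incr a b : hs <= a -> a <= b -> absG hs a <= absG hs b.
Proof.
move=> ha ab; have a0 : 0 <= a by rewrite (le_trans (ltW hs0)).
have b0 : 0 <= b by rewrite (le_trans a0).
have sab : Num.sqrt a <= Num.sqrt b by rewrite ler_sqrt.
have sha : Num.sqrt hs <= Num.sqrt a by rewrite ler_sqrt.
rewrite !absGE ?(ltW hs0)//.
have := sqrtr_ge0 hs; move: sab sha; set s := Num.sqrt a; set t := Num.sqrt b.
set c := Num.sqrt hs => st cs c0; rewrite -subr_ge0.
rewrite (_ : _ - _ = 2 / 3 * ((t - s) * (t ^+ 2 + t * s + s ^+ 2 - 3 * c ^+ 2))); last by field.
rewrite !mulr_ge0 ?subr_ge0//.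
have h1 : c ^+ 2 <= t ^+ 2 by rewrite ler_pXn2r ?nnegrE//; lra.
have h2 : c ^+ 2 <= s ^+ 2 by rewrite ler_pXn2r ?nnegrE//; lra.
have h3 : c ^+ 2 <= t * s by rewrite expr2 ler_pM//; lra.
lra.
Qed.

Lemma G_fun_ge y : hs <= y -> G_fun hs y = absG hs y.
Proof.
move=> hy; rewrite /G_fun (lt_le_trans hs0 hy).
move: hy; rewrite le_eqVlt => /predU1P[<-|hy].
  by rewrite subrr sgr0 mul0r /absG; field.
by rewrite gtr0_sg ?subr_gt0// mul1r.
Qed.

Lemma G_fun_le y : 0 < y -> y <= hs -> G_fun hs y = - absG hs y.
Proof.
move=> y0; rewrite le_eqVlt => /predU1P[->|hy].
  by rewrite G_fun_ge// /absG; field.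
by rewrite /G_fun y0 ltr0_sg ?subr_lt0// mulN1r.
Qed.

Lemma G_fun_npos y : y <= 0 -> G_fun hs y = - absG hs 0 + y.
Proof. by move=> y0; rewrite /G_fun ltNge y0 /= /absG sqrtr0; congr (_ + _); ring. Qed.

Lemma G_surj u : u <= 0 -> exists y, G_fun hs y = u.
Proof.
move=> u0; have [h1|h1] := leP u (- absG hs 0).
  by exists (u + absG hs 0); rewrite G_fun_npos ?addrK; [ring|lra].
have cg : {within `[0, hs], continuous (fun y => - absG hs y)}.
  by rewrite /absG; within_tac.
have e0 : absG hs hs = 0 by rewrite /absG; field.
have [|y yh yu] := @IVT _ (fun y => - absG hs y) 0 hs u (ltW hs0) cg.
  rewrite e0 oppr0 minElt maxElt; have := absG_ge0 (ltW hs0) (lexx (0 : R)).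
  by case: ltP; lra.
move: yh; rewrite in_itv /= => /andP[y0 yh].
exists y; rewrite G_fun_le// lt_neqAle y0 andbT; apply/eqP => yE.
by move: h1; rewrite -yu -yE ltxx.
Qed.

Lemma G_invK u : u <= 0 -> G_fun hs (G_inv hs u) = u.
Proof.
by move=> /G_surj[y yu]; apply: pinvK; rewrite inE; exists y.
Qed.

Lemma Q1_G_le s y : 0 < y -> 0 <= s -> k * absG hs y <= s ->
  G_inv hs (- (1 / k * s)) <= y.
Proof.
move=> y0 s0 ys; set z := G_inv _ _.
have zE : G_fun hs z = - (1 / k * s).
  by apply: G_invK; rewrite oppr_le0 mulr_ge0// divr_ge0// ltW.
have cs0 : 0 <= 1 / k * s by rewrite mulr_ge0// divr_ge0// ltW.
have ys' : absG hs y <= 1 / k * s by rewrite mul1r -ler_pdivrMl ?invr_gt0// invrK.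
have [z0|z0] := leP z 0; first by rewrite (le_trans z0)// ltW.
rewrite leNgt; apply/negP => yz.
have [zh|zh] := leP z hs.
  by have := absG_decr (ltW y0) yz zh; move: zE; rewrite G_fun_le//; lra.
have : 0 < absG hs z.
  have sz : Num.sqrt hs < Num.sqrt z by rewrite ltr_sqrt.
  have a0 := sqrtr_ge0 hs; rewrite absGE ?(ltW hs0) ?(ltW z0)//.
  by rewrite !mulr_gt0 ?exprn_gt0 ?subr_gt0//; lra.
by move: zE; rewrite G_fun_ge ?(ltW zh)//; lra.
Qed.

Lemma G_inv_gt0 s : 0 <= s -> s < k * absG hs 0 -> 0 < G_inv hs (- (1 / k * s)).
Proof.
move=> s0 sk; set z := G_inv _ _.
have zE : G_fun hs z = - (1 / k * s).
  by apply: G_invK; rewrite oppr_le0 mulr_ge0// divr_ge0// ltW.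
rewrite ltNge; apply/negP => z0; move: zE; rewrite G_fun_npos//.
have : 1 / k * s < absG hs 0 by rewrite mul1r mulrC ltr_pdivrMr// mulrC.
lra.
Qed.

(** The three consequences for a height y of the energy level s. *)
Definition height_estimates s y : Prop :=
  [/\ k * absG hs y <= s,
      delta * mu ^+ 2 * (y - hs) ^+ 2 <= 2 * m * (1 + delta) * s &
      L ^+ 2 + (y - hs) ^+ 2 <= (s / (sigma * (delta + 1)) + L) ^+ 2].

Let dm2 : 0 < delta * mu ^+ 2. Proof. by rewrite mulr_gt0// exprn_gt0. Qed.
Let d1 : 0 < delta + 1. Proof. by rewrite addr_gt0. Qed.
Let sd : 0 < sigma * (delta + 1). Proof. exact: mulr_gt0. Qed.

Lemma abs_le_sqrt (a b : R) : a ^+ 2 <= b -> - a <= Num.sqrt b.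
Proof.
move=> ab; apply: (@le_trans _ _ `|a|); first by rewrite -normrN ler_norm.
by rewrite -sqrtr_sqr ler_wsqrtr.
Qed.

(** Each of the three entries of Q_1 is the lower bound for the height that
    one of the three estimates gives. *)
Lemma Q1_le s y : 0 < y -> 0 <= s -> height_estimates s y ->
  Q1 g mu sigma L m delta s <= y.
Proof.
move=> y0 s0 [b1 b2 b3]; rewrite /Q1 -/hs -/k !ge_max; apply/and3P; split.
- exact: Q1_G_le.
- rewrite lerBlDr -lerBlDl -opprB; apply: abs_le_sqrt.
  rewrite ler_pdivlMr// mulrC; apply: (le_trans b2).
  by [].
- rewrite lerBlDr -lerBlDl -opprB; apply: abs_le_sqrt.
  by rewrite lerBrDl.
Qed.

Let C := 2 * mu * Num.sqrt (delta * g * hs) / 3 * (Hmax - hs).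
Let Hh : 0 < Hmax - hs. Proof. by rewrite subr_gt0. Qed.

Lemma sqrt_dgh : Num.sqrt (delta * g * hs) = Num.sqrt delta * Num.sqrt g * Num.sqrt hs.
Proof. by rewrite !sqrtrM ?mulr_ge0 ?ltW. Qed.

Let C0 : 0 < C.
Proof.
have q0 : 0 < Num.sqrt (delta * g * hs) by rewrite sqrtr_gt0 mulr_gt0// mulr_gt0.
by apply: mulr_gt0 => //; apply: divr_gt0 => //; apply: mulr_gt0 => //; apply: mulr_gt0.
Qed.

(** Up to a common factor R is the minimum of two maxima of three terms. Each
    term, times that factor, is the energy level at which one of the three
    estimates starts to allow the height Hmax (in the first maximum) or the
    height 0 (in the second one). *)
Lemma R_const_lt s : s < R_const g mu sigma L m Hmax delta ->
  [\/ s < k * absG hs Hmax,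
      2 * m * (1 + delta) * s < delta * mu ^+ 2 * (Hmax - hs) ^+ 2 |
      s / (sigma * (delta + 1)) + L < Num.sqrt (L ^+ 2 + (Hmax - hs) ^+ 2)] /\
  [\/ s < k * absG hs 0,
      2 * m * (1 + delta) * s < delta * mu ^+ 2 * hs ^+ 2 |
      s / (sigma * (delta + 1)) + L < Num.sqrt (L ^+ 2 + hs ^+ 2)].
Proof.
have [d [dp dE ds]] := sqrt_root (ltW delta_gt0).
have [c [cp cE csq]] := sqrt_root (ltW g_gt0).
have [a [ap aE asq]] := sqrt_root (ltW hs0).
have nz (x y : R) : 0 < x -> x = y ^+ 2 -> y != 0.
  by move=> x0 xE; apply: contraTneq x0 => y0; rewrite xE y0 expr0n ltxx.
have d0 := nz _ _ delta_gt0 dE; have c0 := nz _ _ g_gt0 cE; have a0 := nz _ _ hs0 aE.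
have mE : m = hs * L by rewrite /hs divfK// gt_eqF.
have Hmax0 : 0 < Hmax by exact: lt_trans hH.
have [b [bp bE bsq]] := sqrt_root (ltW Hmax0).
have ba : 0 < b + a by rewrite ltr_pwDl// lt_neqAle bp andbT eq_sym (nz _ _ Hmax0 bE).
have sgh : Num.sqrt (g * hs) = c * a by rewrite (sqrtrM _ (ltW g_gt0)) csq asq.
have sdg : Num.sqrt (delta * g) = d * c by rewrite (sqrtrM _ (ltW delta_gt0)) ds csq.
have kE : k = mu * (d * c) by rewrite /k sdg.
have muN : mu != 0 by rewrite gt_eqF.
have HN : Hmax - hs != 0 by rewrite gt_eqF.
have LN : L != 0 by rewrite gt_eqF.
have dN : 1 + delta != 0 by rewrite addrC gt_eqF.
have sN : sigma != 0 by rewrite gt_eqF.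
rewrite /R_const -/hs -/C; set z1 := Num.max _ _; set z2 := _ / _ * _.
rewrite -ltr_pdivrMl// lt_min => /andP[r1 r2]; split.
- move: r1; rewrite /z1 !lt_max => /orP[|/orP[]]; rewrite ltr_pdivrMl// => r1.
  + apply: Or31; apply: (lt_le_trans r1); rewrite le_eqVlt; apply/orP; left; apply/eqP.
    rewrite /C sqrt_dgh ds csq asq bsq kE /absG bsq asq.
    have -> : Num.sqrt (Hmax / hs) = b / a.
      by rewrite sqrtrM ?(ltW Hmax0)// sqrtrV ?(ltW hs0)// bsq asq.
    by rewrite bE aE; field; rewrite a0 gt_eqF.
  + apply: Or32; move: r1; rewrite /C sqrt_dgh sgh ds csq asq => r1.
    have m0 : 0 < 2 * m * (1 + delta) by rewrite !mulr_gt0// addr_gt0.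
    rewrite -ltr_pdivlMl//; apply: (lt_le_trans r1); rewrite le_eqVlt; apply/orP; left; apply/eqP.
    have -> : delta * mu ^+ 2 = d ^+ 2 * mu ^+ 2 by rewrite -dE.
    by field; rewrite a0 c0 dN gt_eqF.
  + apply: Or33; rewrite -ltrBrDr ltr_pdivrMr//.
    apply: (lt_le_trans r1); rewrite le_eqVlt; apply/orP; left; apply/eqP.
    rewrite /C; set q := Num.sqrt (delta * g * hs).
    have q0 : q != 0.
      by rewrite gt_eqF// sqrtr_gt0; exact: mulr_gt0 (mulr_gt0 delta_gt0 g_gt0) hs0.
    by field; rewrite HN q0.
- move: r2; rewrite /z2 ltr_pdivrMl// mulrA.
  have -> : C * (hs / (Hmax - hs)) = 2 * mu * (d * c * a) / 3 * hs.
    by rewrite /C sqrt_dgh ds csq asq; field.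
  have w0 : 0 < 2 * mu * (d * c * a) / 3 * hs.
    by rewrite mulr_gt0// divr_gt0// !mulr_gt0// lt_neqAle eq_sym ?d0 ?c0 ?a0.
  rewrite -ltr_pdivrMl// !lt_max => /orP[|/orP[]]; rewrite ltr_pdivrMl// => r2.
  + apply: Or31; apply: (lt_le_trans r2); rewrite le_eqVlt; apply/orP; left; apply/eqP.
    by rewrite kE /absG sqrtr0 asq; field.
  + apply: Or32; move: r2; rewrite sgh ds => r2.
    have m0 : 0 < 2 * m * (1 + delta) by rewrite !mulr_gt0// addr_gt0.
    rewrite -ltr_pdivlMl//; apply: (lt_le_trans r2); rewrite le_eqVlt; apply/orP; left; apply/eqP.
    have -> : delta * mu ^+ 2 = d ^+ 2 * mu ^+ 2 by rewrite -dE.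
    by rewrite mE; field; rewrite a0 c0 LN dN gt_eqF.
  + apply: Or33; rewrite -ltrBrDr ltr_pdivrMr//.
    apply: (lt_le_trans r2); rewrite le_eqVlt; apply/orP; left; apply/eqP.
    rewrite sdg asq (addrC (hs ^+ 2)).
    set q := Num.sqrt _.
    have q0 : 0 < q.
      by rewrite sqrtr_gt0; exact: addr_gt0 (exprn_gt0 _ L_gt0) (exprn_gt0 _ hs0).
    have qE : q ^+ 2 = L ^+ 2 + hs ^+ 2 by rewrite sqr_sqrtr// addr_ge0 ?sqr_ge0.
    have -> : 2 * mu * (d * c * a) / 3 * hs *
        (3 * sigma * (delta + 1) * a / (2 * mu * (d * c) * (q + L))) =
        a ^+ 2 * hs * sigma * (delta + 1) / (q + L).
      by field; rewrite muN d0 c0 gt_eqF// addr_gt0.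
    rewrite -aE -expr2 (_ : hs ^+ 2 = (q - L) * (q + L)); last by rewrite mulrDr !mulrBl -!expr2 qE; ring.
    by field; rewrite gt_eqF// addr_gt0.
Qed.

Lemma sqrt_lt (x b : R) : 0 < b -> x < b ^+ 2 -> Num.sqrt x < b.
Proof.
move=> b0 xb; rewrite -[ltRHS](ger0_norm (ltW b0)) -sqrtr_sqr.
by rewrite ltr_sqrt ?exprn_gt0.
Qed.

Lemma surface_lt s y : 0 <= s -> s / (sigma * (delta + 1)) + L < Num.sqrt (L ^+ 2 + y ^+ 2) ->
  (s / (sigma * (delta + 1)) + L) ^+ 2 < L ^+ 2 + y ^+ 2.
Proof.
move=> s0 b; rewrite -[ltRHS]sqr_sqrtr ?addr_ge0 ?sqr_ge0//.
by rewrite ltr_pXn2r ?nnegrE ?sqrtr_ge0// addr_ge0 ?(ltW L_gt0)// divr_ge0// ltW.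
Qed.

Lemma Q1_gt0 s : 0 <= s -> s < R_const g mu sigma L m Hmax delta ->
  0 < Q1 g mu sigma L m delta s.
Proof.
move=> s0 /R_const_lt[_]; rewrite /Q1 -/hs -/k !lt_max => -[b|b|b].
- by rewrite G_inv_gt0.
- rewrite (_ : 0 < hs - Num.sqrt (2 * m * (1 + delta) * s / _)) ?orbT// subr_gt0.
  by apply: sqrt_lt => //; rewrite ltr_pdivrMr// [ltRHS]mulrC.
- rewrite (_ : 0 < hs - Num.sqrt (_ - L ^+ 2)) ?orbT// subr_gt0.
  by apply: sqrt_lt => //; rewrite ltrBlDl; exact: surface_lt.
Qed.

Lemma lt_Hmax s y : 0 < y -> 0 <= s -> s < R_const g mu sigma L m Hmax delta ->
  height_estimates s y -> y < Hmax.
Proof.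
move=> y0 s0 /R_const_lt[b _] [b1 b2 b3]; rewrite ltNge; apply/negP => Hy.
have sq : (Hmax - hs) ^+ 2 <= (y - hs) ^+ 2.
  have yh : 0 <= y - hs by rewrite subr_ge0; exact: le_trans (ltW hH) Hy.
  by rewrite ler_pXn2r ?nnegrE ?(ltW Hh)// lerD2r.
case: b => [b|b|/(surface_lt s0) b].
- have h1 := absG_incr (ltW hH) Hy.
  have h2 : k * absG hs Hmax <= k * absG hs y by rewrite ler_pM2l.
  by move: (lt_le_trans b (le_trans h2 b1)); rewrite ltxx.
- have h2 : delta * mu ^+ 2 * (Hmax - hs) ^+ 2 <= delta * mu ^+ 2 * (y - hs) ^+ 2.
    by rewrite ler_pM2l.
  by move: (lt_le_trans b (le_trans h2 b2)); rewrite ltxx.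
- have h2 : L ^+ 2 + (Hmax - hs) ^+ 2 <= L ^+ 2 + (y - hs) ^+ 2 by rewrite lerD2l.
  by move: (lt_le_trans b (le_trans h2 b3)); rewrite ltxx.
Qed.
End thresholds.

(** * Classical solutions in terms of pointwise derivatives *)

Section extensions.
Context {R : realType}.
Local Notation joint A B u := {within A `*` B, continuous (uncurry2 u)}.
Implicit Types (A B : set R) (u : R -> R -> R) (t x : R).

(** At a limit point of the interior the continuation is unique. *)
Lemma extensionE (T : topologicalType) (A : set T) (f g : T -> R) (p : T) :
  {within A, continuous g} -> (forall q, A° q -> g q = f q) ->
  A p -> closure A° p -> extension A f p = g p.
Proof.
move=> /subspace_continuousP cg gf Ap clp.
have pf : ProperFilter (within A° (nbhs p)) by apply: within_nbhs_proper.
apply: cvg_lim; first exact: Rhausdorff.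
have h1 : g @ within A° (nbhs p) --> g p.
  apply: cvg_trans (cg p Ap); apply: cvg_app.
  by apply: within_subset; exact: interior_subset.
apply: cvg_trans h1; apply: near_eq_cvg; rewrite near_withinE.
by apply: nearW => q Aq; exact: gf.
Qed.

Lemma interiorX A B t x : A° t -> B° x -> (A `*` B)° (t, x).
Proof. by move=> At Bx; exists (A, B). Qed.

Lemma interior_sub A B t : open A -> A `<=` B -> A t -> B° t.
Proof. by move=> oA AB At; apply: (interiorS AB); rewrite (interior_id _).1. Qed.

Lemma interior_gt0 t : 0 < t -> (`]0, +oo[%classic : set R)° t.
Proof. by move=> t0; apply: (@interior_sub `]0, +oo[) => //=; rewrite in_itv /= t0. Qed.

Lemma interior_ge0 t : 0 < t -> (`[0, +oo[%classic : set R)° t.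
Proof.
move=> t0; apply: (@interior_sub `]0, +oo[) => //=; last by rewrite in_itv /= t0.
by move=> y /=; rewrite !in_itv /= !andbT; exact: ltW.
Qed.

Lemma interior_itvoo (L : R) x : 0 < x < L -> (`]0, L[%classic : set R)° x.
Proof. by move=> x0; apply: (@interior_sub `]0, L[) => //=; rewrite in_itv. Qed.

Lemma interior_itvcc (L : R) x : 0 < x < L -> (`[0, L]%classic : set R)° x.
Proof.
move=> x0; apply: (@interior_sub `]0, L[) => //.
by apply: subset_itv; rewrite bnd_simp.
Qed.

Lemma closure_strip (L : R) t x : 0 < L -> 0 <= t -> 0 <= x <= L ->
  closure (`[0, +oo[ `*` `[0, L] : set (R * R))° (t, x).
Proof.
move=> L0 t0 xL U [[P Q] /= [[d1 d10 h1] [d2 d20 h2]] PQ].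
have [e [e0 e1 _ ed1 eL]] := small_pos4 ltr01 ltr01 d10 (divr_gt0 d20 L0).
have eL' : e * L < d2 by rewrite -ltr_pdivlMr.
(* The point x is moved towards the middle of [0, L]. *)
pose y := x + e * (L / 2 - x).
have p1 : 0 <= (1 - e) * x by rewrite mulr_ge0// ?subr_ge0; lra.
have p2 : 0 <= (1 - e) * (L - x) by rewrite mulr_ge0// ?subr_ge0; lra.
have p3 : 0 < e * L by rewrite mulr_gt0.
have p4 : e * `|L / 2 - x| <= e * L.
  by rewrite ler_pM2l// ler_norml; clear - xL L0; lra.
have y0 : 0 < y by rewrite /y; clear - p1 p3; lra.
have yL : y < L by rewrite /y; clear - p2 p3; lra.
exists (t + e, y); split.
  by apply: interiorX; [apply: interior_ge0; lra|apply: interior_itvcc; rewrite y0].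
apply: PQ; split => /=.
  apply: h1; rewrite /ball /= opprD addNKr normrN gtr0_norm//.
apply: h2; rewrite /ball /= /y opprD addNKr normrN normrM gtr0_norm//.
exact: le_lt_trans p4 eL'.
Qed.

Lemma extends2 A B u : extends_to (A `*` B) (uncurry2 u) ->
  exists2 g : R -> R -> R, joint A B g &
    forall t x, A° t -> B° x -> g t x = u t x.
Proof.
move=> [g cg gu]; exists (fun t x => g (t, x)).
  by apply: within_ext cg => -[].
by move=> t x At Bx; rewrite (gu (t, x))//; exact: interiorX.
Qed.

Lemma extends2_joint A B u : open A -> open B -> extends_to (A `*` B) (uncurry2 u) ->
  joint A B u.
Proof.
move=> oA oB /extends2[g cg gu]; apply: within_ext cg => -[t x] [/= At Bx].
by rewrite /uncurry2 /= gu// (interior_id _).1.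
Qed.
End extensions.

Section limit_at_0.
Context {R : realType}.
Local Notation itg a b f := (\int[lebesgue_measure]_(x in `[a, b]) f x).
Local Notation joint A B u := {within A `*` B, continuous (uncurry2 u)}.

Lemma within_le_at0 (f : R -> R) (c b : R) : 0 < b -> {within `[0, +oo[, continuous f} ->
  (forall t, 0 < t < b -> f t <= c) -> f 0 <= c.
Proof.
move=> b0 /subspace_continuousP cf fc; apply/ler_addgt0Pr => e e0.
have A0 : (`[0, +oo[%classic : set R) 0 by rewrite /= in_itv /= lexx.
have /cvgrPdist_lt /(_ e e0) := cf 0 A0; rewrite near_withinE => -[d /= d0 hd].
have [s [s0 sd sb _ _]] := small_pos4 d0 b0 d0 d0.
have := hd s; rewrite /= sub0r normrN gtr0_norm// in_itv /= andbT (ltW s0).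
move=> /(_ sd isT); have := fc s; rewrite s0 sb => /(_ isT).
by rewrite /from_subspace ltr_norml => h1 /andP[h2 h3]; clear - h1 h2 h3; lra.
Qed.

Lemma within_eq_at0 (f : R -> R) : {within `[0, +oo[, continuous f} ->
  (forall t, 0 < t -> f t = 0) -> f 0 = 0.
Proof.
move=> cf f0; apply/eqP; rewrite eq_le; apply/andP; split.
  by apply: (within_le_at0 ltr01 cf) => t /andP[t0 _]; rewrite f0.
rewrite -oppr_le0; apply: (within_le_at0 ltr01 (withinN cf)) => t /andP[t0 _].
by rewrite f0// oppr0.
Qed.

(** The identity h (t, y) = h (t, c) + the integral of P over [c, y] passes
    to the limit t = 0. *)
Lemma der_initial (L : R) (h P : R -> R -> R) x :
  joint `[0, +oo[ `[0, L] h -> joint `[0, +oo[ `[0, L] P ->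
  (forall t x, 0 < t -> 0 < x < L -> is_derive x 1 (h t) (P t x)) ->
  0 < x < L -> is_derive x 1 (h 0) (P 0 x).
Proof.
move=> ch cP dh /andP[x0 xL].
have [c [c0 cx _ _ _]] := small_pos4 x0 x0 x0 x0.
have A0 : (`[0, +oo[%classic : set R) 0 by rewrite /= in_itv /= lexx.
have E y : c < y < L -> h 0 c + itg c y (P 0) = h 0 y.
  move=> /andP[cy yL]; apply/esym/eqP; rewrite -subr_eq0 opprD addrA; apply/eqP.
  have cP' : joint `[0, +oo[ `[c, y] P.
    by apply: jointW cP => // z /=; rewrite !in_itv /=; clear - c0 yL; lra.
  apply: (@within_eq_at0 (fun t => h t y - h t c - itg c y (P t))).
    apply: withinB; last exact: joint_itg.
    by apply: withinB; apply: (joint_slice2 (B := `[0, L])) ch => //=;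
      rewrite in_itv /=; clear - c0 cy yL; lra.
  move=> t t0.
  have cPt : {within `[c, y], continuous (P t)}.
    by apply: (joint_slice (A := `[0, +oo[)) => //=; rewrite in_itv /= ltW.
  have dht z : c <= z <= y -> is_derive z 1 (h t) (P t z).
    by move=> zcy; apply: dh => //; clear - zcy c0 yL; lra.
  have dht' z : c < z < y -> is_derive z 1 (h t) (P t z).
    by move=> /andP[cz zy]; apply: dht; rewrite !ltW.
  by rewrite (itg_ftc (ltW cy) cPt (der_within dht) dht') subrr.
have cP0 : {within `[c, L], continuous (P 0)}.
  apply: (contW (a := 0) (b := L)) => //; first exact: ltW.
  exact: joint_slice cP.
apply: (der_near (f := fun y => h 0 c + itg c y (P 0)) (a := c) (b := L)) => //.
  by rewrite cx.
have dI : is_derive x 1 (fun y => itg c y (P 0)) (P 0 x).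
  by apply: (itg_derive cP0); rewrite cx.
by der; rewrite add0r.
Qed.
End limit_at_0.

Section regular_flow.
Context {R : realType}.
Local Notation joint A B u := {within A `*` B, continuous (uncurry2 u)}.

(** The curvature of the free surface and its x-derivative, as functions of
    the values of h_x, h_xx and h_xxx. *)
Definition curv (P hxx : R) : R := hxx / ((1 + P ^+ 2) * Num.sqrt (1 + P ^+ 2)).

Definition dcurv (P hxx hxxx : R) : R :=
  (hxxx * (1 + P ^+ 2) - 3 * P * hxx ^+ 2) /
  ((1 + P ^+ 2) ^+ 2 * Num.sqrt (1 + P ^+ 2)).

Lemma der_curv (p q : R -> R) (x a b : R) : is_derive x 1 p a -> is_derive x 1 q b -> a = q x ->
  is_derive x 1 (fun y => curv (p y) (q y)) (dcurv (p x) (q x) b).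
Proof.
move=> dp dq aE; have p0 : 0 < 1 + p x ^+ 2 by rewrite ltr_pwDl ?sqr_ge0.
have [s [s0 sE sq]] := sqrt_root (ltW p0).
have sN : s != 0 by apply: contraTneq p0 => z; rewrite sE z expr0n ltxx.
have dN : (1 + p x ^+ 2) * Num.sqrt (1 + p x ^+ 2) != 0.
  by rewrite mulf_neq0 ?sq// gt_eqF.
rewrite /curv; der; rewrite /dcurv /= sq aE sE.
by field.
Qed.

(** A classical solution in terms of pointwise derivatives. P is the
    continuation of h_x up to the walls and to t = 0, while ht, vt and vx are
    continuations up to the walls for t > 0; the derivatives of higher order
    exist in the interior only. The equations are expanded by the product
    rule and the momentum equation is freed from the mass equation. *)
Record regular_flow (g mu sigma L m : R) (xi w : R -> R) (h v : R -> R -> R)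
    (f : R -> R) (P ht hxt hxx hxxx vx vt vxx : R -> R -> R) : Prop := RegularFlow {
  rf_h : joint `[0, +oo[ `[0, L] h;
  rf_P : joint `[0, +oo[ `[0, L] P;
  rf_v : joint `[0, +oo[ `[0, L] v;
  rf_ht : joint `]0, +oo[ `[0, L] ht;
  rf_vx : joint `]0, +oo[ `[0, L] vx;
  rf_vt : joint `]0, +oo[ `[0, L] vt;
  rf_hxx : joint `]0, +oo[ `]0, L[ hxx;
  rf_hxt : joint `]0, +oo[ `]0, L[ hxt;
  rf_f : {within `[0, +oo[, continuous f};
  rf_xi : {within `[0, +oo[, continuous xi};
  rf_w : {within `[0, +oo[, continuous w};
  rf_h_gt0 : forall t x : R, 0 <= t -> 0 <= x <= L -> 0 < h t x;
  rf_bc : forall t : R, 0 <= t -> [/\ v t 0 = 0, v t L = 0, P t 0 = 0 & P t L = 0];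
  rf_mass : forall t : R, 0 <= t -> integral_0L L (h t) = m;
  rf_tank : forall t : R, 0 < t -> is_derive t 1 xi (w t) /\ is_derive t 1 w (- f t);
  rf_hP : forall t x : R, 0 <= t -> 0 < x < L -> is_derive x 1 (h t) (P t x);
  rf_der_h : forall t x : R, 0 < t -> 0 < x < L ->
    [/\ is_derive t 1 (h^~ x) (ht t x), is_derive t 1 (P^~ x) (hxt t x),
        is_derive x 1 (P t) (hxx t x), is_derive x 1 (hxx t) (hxxx t x) &
        is_derive x 1 (ht t) (hxt t x)];
  rf_der_v : forall t x : R, 0 < t -> 0 < x < L ->
    [/\ is_derive t 1 (v^~ x) (vt t x), is_derive x 1 (v t) (vx t x) &
        is_derive x 1 (vx t) (vxx t x)];
  rf_mass_eq : forall t x : R, 0 < t -> 0 < x < L ->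
    ht t x = - (P t x * v t x + h t x * vx t x);
  rf_momentum : forall t x : R, 0 < t -> 0 < x < L ->
    h t x * vt t x + h t x * v t x * vx t x + g * h t x * P t x -
      sigma * h t x * dcurv (P t x) (hxx t x) (hxxx t x) =
    mu * (P t x * vx t x + h t x * vxx t x) + h t x * f t
}.

Lemma derive1_of (u : R -> R) (x a : R) : is_derive x 1 u a -> derive1 u x = a.
Proof. by move=> du; rewrite derive1E; case: du. Qed.

Lemma of_derivable (u : R -> R) (x a : R) : derivable u x 1 -> a = derive1 u x ->
  is_derive x 1 u a.
Proof. by move=> du ->; rewrite derive1E; exact: derivableP. Qed.

Lemma oo_pos (t : R) : 0 < t -> (`]0, +oo[%classic : set R) t.
Proof. by move=> t0; rewrite /= in_itv /= t0. Qed.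

Lemma co_pos (t : R) : 0 <= t -> (`[0, +oo[%classic : set R) t.
Proof. by move=> t0; rewrite /= in_itv /= t0. Qed.

Lemma sub_oo_co : (`]0, +oo[%classic : set R) `<=` `[0, +oo[.
Proof. by move=> t /=; rewrite !in_itv /= !andbT; exact: ltW. Qed.

(** The continuations of the derivatives are the functions provided by the
    C^k classes; the two mixed derivatives of h agree by the theorem of
    Schwarz; at t = 0 the slope is found by passing to the limit. *)
Lemma classical_regular (g mu sigma L m : R) (xi w : R -> R) (h v : R -> R -> R) (f : R -> R) :
  0 < L -> classical_solution g mu sigma L m xi w h v f ->
  exists P ht hxt hxx hxxx vx vt vxx : R -> R -> R,
    regular_flow g mu sigma L m xi w h v f P ht hxt hxx hxxx vx vt vxx.
Proof.
move=> L0 [[cf _] [cxi Hxi] [cw Hw] [ch Hh1] [_ Hh3] h0 [cv _] [cv1 Hv1] Hv2 Exi Ew Emass Emom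
  bcv bcP mass].
case: Hh1 => _ [Dh1 [[ght cght ghtE] _] [[gP cgP gPE] _]].
case: Hh3 => _ [_ [_ [Dht _ [Hhtx _]]] [_ [DP [Hhxt _] [Hhxx [Dhxx _ _]]]]].
case: Hv1 => _ [Dv [[gvt cgvt gvtE] _] [[gvx cgvx gvxE] _]].
have oo0 : open (`]0, +oo[%classic : set R) by exact: interval_open.
have ooL : open (`]0, L[%classic : set R) by exact: interval_open.
pose A1 := (`[0, +oo[ `*` `[0, L])%classic : set (R * R).
pose A2 := (`]0, +oo[ `*` `[0, L])%classic : set (R * R).
have A21 : A2° `<=` A1°.
  by apply: interiorS => -[t x] /= [t0 xL]; split => //; exact: sub_oo_co.
(* Introduced by equations, these functions are not unfolded by unification. *)
have opq (u : R -> R -> R) : exists z : R -> R -> R, z = u by exists u.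
have [P Pd] := opq (fun t x => gP (t, x)).
have [ht htd] := opq (fun t x => ght (t, x)).
have [vx vxd] := opq (fun t x => gvx (t, x)).
have [vt vtd] := opq (fun t x => gvt (t, x)).
have [hxt hxtd] := opq (dt (dx h)).
have [htx htxd] := opq (dx (dt h)).
have [hxx hxxd] := opq (dx (dx h)).
have [hxxx hxxxd] := opq (dx (dx (dx h))).
have [vxx vxxd] := opq (fun t => derive1 (derive1 (v t))).
have in1 (t x : R) : 0 < t -> 0 < x < L -> A1° (t, x).
  by move=> t0 xL; apply: interiorX; [exact: interior_ge0|exact: interior_itvcc].
have in2 (t x : R) : 0 < t -> 0 < x < L -> A2° (t, x).
  by move=> t0 xL; apply: interiorX; [exact: interior_gt0|exact: interior_itvcc].
  have in3 (t x : R) : 0 < t -> 0 < x < L -> (`]0, +oo[ `*` `]0, L[ : set (R * R))° (t, x).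
  by move=> t0 xL; apply: interiorX; [exact: interior_gt0|exact: interior_itvoo].
have PE (t x : R) : 0 < t -> 0 < x < L -> P t x = dx h t x.
  by move=> t0 xL; rewrite Pd; exact: (gPE (t, x) (in1 t x t0 xL)).
have htE (t x : R) : 0 < t -> 0 < x < L -> ht t x = dt h t x.
  by move=> t0 xL; rewrite htd; exact: (ghtE (t, x) (in1 t x t0 xL)).
have vxE (t x : R) : 0 < t -> 0 < x < L -> vx t x = dx v t x.
  by move=> t0 xL; rewrite vxd; exact: (gvxE (t, x) (in2 t x t0 xL)).
have vtE (t x : R) : 0 < t -> 0 < x < L -> vt t x = dt v t x.
  by move=> t0 xL; rewrite vtd; exact: (gvtE (t, x) (in2 t x t0 xL)).
have chtP (u : R * R -> R) A B : {within A `*` B, continuous u} ->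
    joint A B (fun t x => u (t, x)).
  by move=> cu; apply: within_ext cu => -[].
have cP : joint `[0, +oo[ `[0, L] P by rewrite Pd; exact: chtP.
have cht : joint `[0, +oo[ `[0, L] ht by rewrite htd; exact: chtP.
have cvx : joint `]0, +oo[ `[0, L] vx by rewrite vxd; exact: chtP.
have cvt : joint `]0, +oo[ `[0, L] vt by rewrite vtd; exact: chtP.
have chxx : joint `]0, +oo[ `]0, L[ hxx by rewrite hxxd; exact: (extends2_joint oo0 ooL Hhxx).
have chxt : joint `]0, +oo[ `]0, L[ hxt by rewrite hxtd; exact: (extends2_joint oo0 ooL Hhxt).
have chtx : joint `]0, +oo[ `]0, L[ htx by rewrite htxd; exact: (extends2_joint oo0 ooL Hhtx).
have d_ht (t x : R) : 0 < t -> 0 < x < L -> is_derive t 1 (h^~ x) (ht t x).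
  move=> t0 xL; have [d _] := Dh1 t x (in1 t x t0 xL).
  exact: (of_derivable d (htE t x t0 xL)).
have d_hx (t x : R) : 0 < t -> 0 < x < L -> is_derive x 1 (h t) (P t x).
  move=> t0 xL; have [_ d] := Dh1 t x (in1 t x t0 xL).
  exact: (of_derivable d (PE t x t0 xL)).
have d_hxt (t x : R) : 0 < t -> 0 < x < L -> is_derive t 1 (P^~ x) (hxt t x).
  move=> t0 xL; have [d _] := DP t x (in3 t x t0 xL).
  have tt : 0 < t < t + 1 by rewrite t0 ltrDl ltr01.
  apply: (der_near tt _ (of_derivable d _)); last by rewrite hxtd.
  by move=> s /andP[s0 _]; rewrite PE.
have d_hxx (t x : R) : 0 < t -> 0 < x < L -> is_derive x 1 (P t) (hxx t x).
  move=> t0 xL; have [_ d] := DP t x (in3 t x t0 xL).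
  apply: (der_near xL _ (of_derivable d _)); last by rewrite hxxd.
  by move=> y yL; rewrite PE.
have d_hxxx (t x : R) : 0 < t -> 0 < x < L -> is_derive x 1 (hxx t) (hxxx t x).
  move=> t0 xL; have [_ d] := Dhxx t x (in3 t x t0 xL).
  by rewrite hxxd; apply: (of_derivable d); rewrite hxxxd.
have d_htx0 (t x : R) : 0 < t -> 0 < x < L -> is_derive x 1 (ht t) (htx t x).
  move=> t0 xL; have [_ d] := Dht t x (in3 t x t0 xL).
  apply: (der_near xL _ (of_derivable d _)); last by rewrite htxd.
  by move=> z zL; rewrite htE.
have mixed (t x : R) : 0 < t -> 0 < x < L -> hxt t x = htx t x.
  move=> t0 xL; have sub : (`]0, t + 1[%classic : set R) `<=` `]0, +oo[.
    by move=> s /=; rewrite !in_itv /= => /andP[-> _].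
  have tt : 0 < t < t + 1 by rewrite t0 ltrDl ltr01.
  have id2 : (`]0, L[%classic : set R) `<=` `]0, L[ by [].
  apply: (@schwarz R 0 (t + 1) 0 L t x h ht P hxt htx (jointW sub id2 chxt)
    (jointW sub id2 chtx) _ tt xL).
  move=> s y /andP[s0 _] yL; split.
  - exact: d_ht.
  - exact: d_hx.
  - exact: d_hxt.
  - exact: d_htx0.
have d_htx (t x : R) : 0 < t -> 0 < x < L -> is_derive x 1 (ht t) (hxt t x).
  by move=> t0 xL; rewrite (mixed t x t0 xL); exact: d_htx0.
have d_vt (t x : R) : 0 < t -> 0 < x < L -> is_derive t 1 (v^~ x) (vt t x).
  move=> t0 xL; have [d _] := Dv t x (in2 t x t0 xL).
  exact: (of_derivable d (vtE t x t0 xL)).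
have d_vx (t x : R) : 0 < t -> 0 < x < L -> is_derive x 1 (v t) (vx t x).
  move=> t0 xL; have [_ d] := Dv t x (in2 t x t0 xL).
  exact: (of_derivable d (vxE t x t0 xL)).
have d_vxx (t x : R) : 0 < t -> 0 < x < L -> is_derive x 1 (vx t) (vxx t x).
  move=> t0 xL; have [_ [_ [_ [_ [d _]]]]] := Hv2 t t0.
  apply: (der_near xL _ (of_derivable (d x (interior_itvoo xL)) _)); last by rewrite vxxd.
  by move=> y yL; rewrite vxE.
have mass_eq (t x : R) : 0 < t -> 0 < x < L -> ht t x = - (P t x * v t x + h t x * vx t x).
  move=> t0 xL; have xL' : 0 <= x <= L by case/andP: xL => /ltW-> /ltW->.
  have := Emass t x t0 xL'; rewrite /extension2.
  have A2p : A2 (t, x) by split; [exact: oo_pos|rewrite /= in_itv].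
  have cl : closure A2° (t, x) by apply: subset_closure; exact: in2.
  have cA2 (u : R * R -> R) : {within A1, continuous u} -> {within A2, continuous u}.
    by apply: continuous_subspaceW => -[s y] [/= s0 yL]; split => //; exact: sub_oo_co.
  have e1 := extensionE (cA2 _ cght) (fun q Aq => ghtE q (A21 q Aq)) A2p cl.
  have e2 : extension A2 (uncurry2 (dx (fun t x => h t x * v t x))) (t, x) =
      gP (t, x) * v t x + h t x * gvx (t, x).
    apply: (@extensionE R _ A2 _ (fun q => gP q * v q.1 q.2 + h q.1 q.2 * gvx q)) => //.
    - have cv' := cv1 : {within A2, continuous (fun q : R * R => v q.1 q.2)}.
      have ch' : {within A2, continuous (fun q : R * R => h q.1 q.2)} by exact: cA2 ch.
      have cgP' := cA2 _ cgP.
      by apply: withinD; exact: withinM.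
    - move=> [s y] sy; rewrite /= /uncurry2 /= /dx.
      have [_ d1] := Dh1 s y (A21 _ sy); have [_ d2] := Dv s y sy.
      apply/esym/derive1_of.
      have d1' : is_derive y 1 (h s) (gP (s, y)).
        by apply: of_derivable => //; exact: (gPE (s, y) (A21 _ sy)).
      have d2' : is_derive y 1 (v s) (gvx (s, y)).
        by apply: of_derivable => //; exact: (gvxE (s, y) sy).
      exact: derM d1' d2'.
  by rewrite e1 e2 Pd htd vxd => E; apply/eqP; rewrite -addr_eq0; apply/eqP.
have momentum (t x : R) : 0 < t -> 0 < x < L ->
    h t x * vt t x + h t x * v t x * vx t x + g * h t x * P t x -
      sigma * h t x * dcurv (P t x) (hxx t x) (hxxx t x) =
    mu * (P t x * vx t x + h t x * vxx t x) + h t x * f t.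
  move=> t0 xL; have := Emom t x t0 xL.
  have := d_ht t x t0 xL => e1; have := d_hx t x t0 xL => e2.
  have := d_vt t x t0 xL => e3; have := d_vx t x t0 xL => e4.
  have := d_vxx t x t0 xL => e5; have := d_hxx t x t0 xL => e6.
  have := d_hxxx t x t0 xL => e7.
  have -> : dt (fun t x => h t x * v t x) t x = ht t x * v t x + h t x * vt t x.
    by apply: derive1_of; exact: derM.
  have -> : dx (fun t x => h t x * v t x ^+ 2 + 1 / 2 * g * h t x ^+ 2) t x =
      P t x * v t x ^+ 2 + 2 * h t x * v t x * vx t x + g * h t x * P t x.
    by apply: derive1_of; der; rewrite /=; field.
  have -> : dx (fun t x => h t x * dx v t x) t x = P t x * vx t x + h t x * vxx t x.
    apply: derive1_of; apply: (@der_near _ (fun y => h t y * vx t y) _ _ _ 0 L) => //.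
    - by move=> y yL; rewrite vxE.
    - exact: derM.
  have -> : dx (fun t x => dx (dx h) t x / (1 + dx h t x ^+ 2) `^ (3 / 2)) t x =
      dcurv (P t x) (hxx t x) (hxxx t x).
    have E y : 0 < y < L -> curv (P t y) (hxx t y) =
        dx (dx h) t y / (1 + dx h t y ^+ 2) `^ (3 / 2).
      move=> yL; rewrite -(PE t y t0 yL) /curv hxxd.
      have p0 : 0 < 1 + P t y ^+ 2 by rewrite ltr_pwDl ?sqr_ge0.
      have e32 : 3 / 2 = 1 + 2^-1 :> R by field.
      rewrite e32 powRD; last by rewrite gt_eqF ?implybT.
      by rewrite powRr1 ?powR12_sqrt// ltW.
    apply: derive1_of; apply: (der_near xL E).
    by apply: (der_curv e6 e7).
  by rewrite (mass_eq t x t0 xL) => E; rewrite -E; ring.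
have clS (t x : R) : 0 <= t -> 0 <= x <= L -> closure A1° (t, x) by exact: closure_strip.
exists P, ht, hxt, hxx, hxxx, vx, vt, vxx; split => //.
- by apply: jointW cht => //; exact: sub_oo_co.
- move=> t t0; have [v0 vL] := bcv t t0; have [p0 pL] := bcP t t0.
  have A1e x : 0 <= x <= L -> A1 (t, x).
    by move=> xL; split; [exact: co_pos|rewrite /= in_itv].
  have z0 : 0 <= (0 : R) <= L by rewrite lexx ltW.
  have zL : 0 <= L <= L by rewrite lexx ltW.
  split => //.
  + by rewrite Pd -(extensionE cgP gPE (A1e 0 z0) (clS t 0 t0 z0)); exact: p0.
  + by rewrite Pd -(extensionE cgP gPE (A1e L zL) (clS t L t0 zL)); exact: pL.
- move=> t t0; have it := interior_ge0 t0.
  have cl : closure (`[0, +oo[%classic : set R)° t by exact: subset_closure.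
  case: Hxi => _ [dxi [[gx cgx gxE] _]]; case: Hw => _ [dw [[gw cgw gwE] _]].
  have tt := ltW t0; split.
    apply: of_derivable; first exact: dxi.
    by rewrite -(Exi t tt) (@extensionE R _ _ _ gx)// ?gxE//; exact: co_pos.
  apply: of_derivable; first exact: dw.
  by rewrite -(Ew t tt) (@extensionE R _ _ _ gw)// ?gwE//; exact: co_pos.
- move=> t x; rewrite le_eqVlt => /predU1P[<-|t0] xL; last exact: d_hx.
  exact: (der_initial ch cP d_hx).
- by move=> t x t0 xL; split; [exact: d_ht|exact: d_hxt|exact: d_hxx|exact: d_hxxx|exact: d_htx].
- by move=> t x t0 xL; split; [exact: d_vt|exact: d_vx|exact: d_vxx].
Qed.
End regular_flow.

(** * Local balance laws of the two energies *)

Section local_laws.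
Context {R : realType}.
Variables (g mu sigma hs : R).

(** The sine of the inclination of the surface. Its x-derivative is the
    curvature, and its product with h_xt is the time derivative of the arc
    length density. *)
Definition surface_sine (P : R) : R := P / Num.sqrt (1 + P ^+ 2).

Lemma arc_gt0 (P : R) : 0 < 1 + P ^+ 2.
Proof. by rewrite ltr_pwDl ?sqr_ge0. Qed.

Lemma der_surface_sine (p : R -> R) (x a : R) : is_derive x 1 p a ->
  is_derive x 1 (fun y => surface_sine (p y)) (curv (p x) a).
Proof.
move=> dp; have p0 := arc_gt0 (p x); have [s [s0 sE sq]] := sqrt_root (ltW p0).
have sN : s != 0 by apply: contraTneq p0 => z; rewrite sE z expr0n ltxx.
have dN : Num.sqrt (1 + p x ^+ 2) != 0 by rewrite sq.
rewrite /surface_sine; der; rewrite // /curv sq sE.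
have e1 : s ^+ 2 - p x ^+ 2 = 1 by rewrite -sE; ring.
transitivity (a * (s ^+ 2 - p x ^+ 2) / s ^+ 3); first by field.
by rewrite e1; field.
Qed.

Lemma der_pot_density (h p : R -> R) (t ht pt : R) :
  is_derive t 1 h ht -> is_derive t 1 p pt ->
  is_derive t 1 (fun s => pot_density g sigma hs (h s) (p s))
    (g * (h t - hs) * ht + sigma * (surface_sine (p t) * pt)).
Proof.
move=> dh dp; have p0 := arc_gt0 (p t); have [s [s0 sE sq]] := sqrt_root (ltW p0).
have sN : s != 0 by apply: contraTneq p0 => z; rewrite sE z expr0n ltxx.
by rewrite /pot_density /surface_sine; der; rewrite // sq; field.
Qed.

Lemma der_E_density (h v p : R -> R) (t ht vt pt : R) :
  is_derive t 1 h ht -> is_derive t 1 v vt -> is_derive t 1 p pt ->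
  is_derive t 1 (fun s => E_density g sigma hs (h s) (v s) (p s))
    (1 / 2 * ht * v t ^+ 2 + h t * v t * vt +
     (g * (h t - hs) * ht + sigma * (surface_sine (p t) * pt))).
Proof.
move=> dh dv dp; have dpot := der_pot_density dh dp.
by rewrite /E_density; der; rewrite /=; field.
Qed.

Lemma der_W_density (h v p : R -> R) (t ht vt pt : R) : h t != 0 ->
  is_derive t 1 h ht -> is_derive t 1 v vt -> is_derive t 1 p pt ->
  is_derive t 1 (fun s => W_density g mu sigma hs (h s) (v s) (p s))
    (- (1 / 2 * (ht / h t ^+ 2) * (h t * v t + mu * p t) ^+ 2) +
     (h t)^-1 * (h t * v t + mu * p t) * (ht * v t + h t * vt + mu * pt) +
     (g * (h t - hs) * ht + sigma * (surface_sine (p t) * pt))).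
Proof.
move=> h0 dh dv dp; have dpot := der_pot_density dh dp.
by rewrite /W_density; der; rewrite //=; field.
Qed.

(** Energy fluxes; K stands for the curvature. In W the kinetic energy is
    that of the velocity u = v + mu h_x / h: the factor h^-1 (h v + mu h_x)^2
    is h u^2. *)
Definition E_flux (h v p ht vx K : R) : R :=
  1 / 2 * h * v ^+ 3 + g * (h - hs) * h * v - sigma * (surface_sine p * ht + K * h * v) -
  mu * h * v * vx.

Definition W_flux (h v p ht K : R) : R :=
  1 / 2 * v * (h^-1 * (h * v + mu * p) ^+ 2) + (g * (h - hs) - sigma * K) * h * v -
  sigma * surface_sine p * ht - mu * sigma * p * K.

Lemma der_E_flux (h v p vx ht q : R -> R) (x vxx hxt hxxx : R) :
  is_derive x 1 h (p x) -> is_derive x 1 v (vx x) -> is_derive x 1 p (q x) ->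
  is_derive x 1 vx vxx -> is_derive x 1 ht hxt -> is_derive x 1 q hxxx ->
  is_derive x 1 (fun y => E_flux (h y) (v y) (p y) (ht y) (vx y) (curv (p y) (q y)))
   (let K := curv (p x) (q x) in
    1 / 2 * p x * v x ^+ 3 + 3 / 2 * h x * v x ^+ 2 * vx x + g * p x * h x * v x +
    g * (h x - hs) * (p x * v x + h x * vx x) -
    sigma * (K * ht x + surface_sine (p x) * hxt + dcurv (p x) (q x) hxxx * h x * v x +
             K * (p x * v x + h x * vx x)) -
    mu * (p x * v x * vx x + h x * vx x ^+ 2 + h x * v x * vxx)).
Proof.
move=> dh dv dp dvx dht dq; have dK := der_curv dp dq erefl.
by have ds := der_surface_sine dp; rewrite /E_flux; der; rewrite /=; field.
Qed.

Lemma der_W_flux (h v p vx ht q : R -> R) (x hxt hxxx : R) : h x != 0 ->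
  is_derive x 1 h (p x) -> is_derive x 1 v (vx x) -> is_derive x 1 p (q x) ->
  is_derive x 1 ht hxt -> is_derive x 1 q hxxx ->
  is_derive x 1 (fun y => W_flux (h y) (v y) (p y) (ht y) (curv (p y) (q y)))
   (let K := curv (p x) (q x) in let K' := dcurv (p x) (q x) hxxx in
    let N := h x * v x + mu * p x in
    let N' := p x * v x + h x * vx x + mu * q x in
    1 / 2 * vx x * ((h x)^-1 * N ^+ 2) - 1 / 2 * v x * (p x / h x ^+ 2) * N ^+ 2 +
    v x * (h x)^-1 * N * N' +
    (g * p x - sigma * K') * h x * v x +
    (g * (h x - hs) - sigma * K) * (p x * v x + h x * vx x) -
    sigma * (K * ht x + surface_sine (p x) * hxt) - mu * sigma * (q x * K + p x * K')).
Proof.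
move=> h0 dh dv dp dht dq; have dK := der_curv dp dq erefl.
by have ds := der_surface_sine dp; rewrite /W_flux; der; rewrite //=; field.
Qed.

Lemma mul_curv_ge0 (p q : R) : 0 <= q * curv p q.
Proof.
rewrite /curv mulrA -expr2 divr_ge0 ?sqr_ge0// mulr_ge0 ?sqrtr_ge0//.
exact/ltW/arc_gt0.
Qed.
End local_laws.

Section balances.
Context {R : realType}.
Context (g mu sigma hs h v p hxx vx vt vxx ht hxt f K K' psi : R).
Context (h0 : h != 0) (massE : ht = - (p * v + h * vx)).
Context (mass_x : hxt = - (hxx * v + 2 * p * vx + h * vxx)).
Context (momE : h * vt + h * v * vx + g * h * p - sigma * h * K' =
  mu * (p * vx + h * vxx) + h * f).

(** The momentum equation multiplied by v. *)
Lemma E_balance :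
  (1 / 2 * ht * v ^+ 2 + h * v * vt +
    (g * (h - hs) * ht + sigma * (psi * hxt))) +
  (1 / 2 * p * v ^+ 3 + 3 / 2 * h * v ^+ 2 * vx + g * p * h * v +
    g * (h - hs) * (p * v + h * vx) -
    sigma * (K * ht + psi * hxt + K' * h * v + K * (p * v + h * vx)) -
    mu * (p * v * vx + h * vx ^+ 2 + h * v * vxx)) +
  (mu * (h * vx ^+ 2) - f * (h * v)) = 0.
Proof.
move/eqP: momE; rewrite -subr_eq0 => /eqP E; rewrite massE.
by rewrite -[RHS](mulr0 v) -[in RHS]E; field.
Qed.

(** By the mass equation, N = h v + mu h_x satisfies the momentum equation
    without viscosity: mu h_xt cancels the viscous force. This equation is
    multiplied by u = N / h. The capillary term mu sigma h_x K_x, integrated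
    by parts, leaves the dissipation mu sigma h_xx K. *)
Lemma W_balance :
  (- (1 / 2 * (ht / h ^+ 2) * (h * v + mu * p) ^+ 2) +
     h^-1 * (h * v + mu * p) * (ht * v + h * vt + mu * hxt) +
     (g * (h - hs) * ht + sigma * (psi * hxt))) +
  (1 / 2 * vx * (h^-1 * (h * v + mu * p) ^+ 2) -
    1 / 2 * v * (p / h ^+ 2) * (h * v + mu * p) ^+ 2 +
    v * h^-1 * (h * v + mu * p) * (p * v + h * vx + mu * hxx) +
    (g * p - sigma * K') * h * v +
    (g * (h - hs) - sigma * K) * (p * v + h * vx) -
    sigma * (K * ht + psi * hxt) - mu * sigma * (hxx * K + p * K')) +
  (mu * g * p ^+ 2 - f * (h * v + mu * p)) = - (mu * sigma * (hxx * K)).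
Proof.
move/eqP: momE; rewrite -subr_eq0 => /eqP E; rewrite massE mass_x.
apply/eqP; rewrite -subr_eq0 -(mulr0 (h^-1 * (h * v + mu * p))) -[in eqbRHS]E.
by apply/eqP; field.
Qed.
End balances.

(** * Boundedness of the curvature and of the fluxes *)

Section bounded.
Context {R : realType}.
Context (t1 t2 L : R).
Implicit Types u w : R -> R -> R.
Local Notation joint A B u := {within A `*` B, continuous (uncurry2 u)}.

Definition bdd u := exists2 C : R, 0 <= C &
  forall t x : R, t1 < t < t2 -> 0 < x < L -> `|u t x| <= C.

Lemma bdd_joint u : joint `[t1, t2] `[0, L] u -> bdd u.
Proof.
move=> /joint_bounded[C C0 hC]; exists C; first exact: ltW.
by move=> t x /andP[? ?] /andP[? ?]; apply: hC; rewrite !ltW.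
Qed.

Lemma bdd_cst (c : R) : bdd (fun _ _ => c).
Proof. by exists `|c|. Qed.

Lemma bddD u w : bdd u -> bdd w -> bdd (fun t x => u t x + w t x).
Proof.
move=> [C C0 hC] [D D0 hD]; exists (C + D); first exact: addr_ge0.
move=> t x tt xx; apply: le_trans (ler_normD _ _) _.
by rewrite lerD ?hC ?hD.
Qed.

Lemma bddN u : bdd u -> bdd (fun t x => - u t x).
Proof. by move=> [C C0 hC]; exists C => // t x tt xx; rewrite normrN hC. Qed.

Lemma bddM u w : bdd u -> bdd w -> bdd (fun t x => u t x * w t x).
Proof.
move=> [C C0 hC] [D D0 hD]; exists (C * D); first exact: mulr_ge0.
by move=> t x tt xx; rewrite normrM ler_pM ?hC ?hD.
Qed.

Lemma bddX u n : bdd u -> bdd (fun t x => u t x ^+ n).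
Proof.
move=> [C C0 hC]; exists (C ^+ n); first exact: exprn_ge0.
by move=> t x tt xx; rewrite normrX lerXn2r ?nnegrE ?hC.
Qed.
End bounded.

Ltac bdd_tac := repeat first
  [ eassumption
  | match goal with
    | |- bdd _ _ _ (fun y z => _ + _) => apply: bddD
    | |- bdd _ _ _ (fun y z => - _) => apply: bddN
    | |- bdd _ _ _ (fun y z => _ * _) => apply: bddM
    | |- bdd _ _ _ (fun y z => _ ^+ _) => apply: bddX
    | |- bdd _ _ _ (fun y z => ?c) => exact: bdd_cst
    end ].

Section real_lemmas.
Context {R : realType}.

Lemma momentum_solved (g mu sigma h vt v vx vxx p f K' : R) : h != 0 ->
  h * vt + h * v * vx + g * h * p - sigma * h * K' = mu * (p * vx + h * vxx) + h * f ->
  sigma * K' + mu * vxx = vt + v * vx + g * p - mu * p * h^-1 * vx - f.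
Proof.
move=> h0 E; apply: (mulfI h0).
rewrite [RHS](_ : _ = h * vt + h * v * vx + g * h * p - mu * p * vx - h * f).
  by clear - E; lra.
by field.
Qed.

Lemma norm_isolate (mu sigma a b c d A B C : R) : 0 < mu -> 0 < sigma ->
  `|(sigma * a + mu * b) - (sigma * c + mu * d)| <= A ->
  `|d| <= B -> `|b| <= B -> `|c| <= C -> sigma * `|a| <= sigma * C + 2 * mu * B + A.
Proof.
move=> mu0 s0; rewrite -{3}(gtr0_norm s0) -normrM !ler_norml => /andP[h1 h2] /andP[h3 h4] /andP[h5 h6] /andP[h7 h8].
have := ler_wpM2l (ltW mu0) h3; have := ler_wpM2l (ltW mu0) h4.
have := ler_wpM2l (ltW mu0) h5; have := ler_wpM2l (ltW mu0) h6.
have := ler_wpM2l (ltW s0) h7; have := ler_wpM2l (ltW s0) h8.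
by move=> a1 a2 a3 a4 a5 a6; apply/andP; split; clear - h1 h2 a1 a2 a3 a4 a5 a6; lra.
Qed.

Lemma combine_balances (ex l V Y y' delta Et Wt jE jW dE dW z1 z2 S : R) :
  Et + jE + dE = 0 -> Wt + jW + dW = S ->
  ex * l * (V + Y) + ex * (delta * Et + Wt + y') +
    (0 * z1 + ex * (0 * z2 + delta * jE + jW)) +
    ex * (delta * dE + dW - l * (V + Y) - y') = ex * S.
Proof. by move=> e1 <-; rewrite -[RHS]addr0 -(mulr0 (ex * delta)) -[in RHS]e1; ring. Qed.

(** Every term of the fluxes contains v or h_x as a factor; so the fluxes
    vanish at the walls as soon as the other factors are bounded. *)
Lemma flux_split (g mu sigma hs delta h v p ht vx K : R) :
  delta * E_flux g mu sigma hs h v p ht vx K + W_flux g mu sigma hs h v p ht K =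
  v * (delta * (1 / 2 * h * v ^+ 2 + g * (h - hs) * h - sigma * K * h - mu * h * vx) +
       1 / 2 * (h^-1 * (h * v + mu * p) ^+ 2) + (g * (h - hs) - sigma * K) * h) +
  p * (- (delta * sigma * (Num.sqrt (1 + p ^+ 2))^-1 * ht) -
       sigma * (Num.sqrt (1 + p ^+ 2))^-1 * ht - mu * sigma * K).
Proof. by rewrite /E_flux /W_flux /surface_sine; ring. Qed.

Lemma inv_arc_le1 (p : R) : `|(Num.sqrt (1 + p ^+ 2))^-1| <= 1.
Proof.
have [_ s1] := (sqrtr_ge0 (1 + p ^+ 2), arc_ge1 p).
by rewrite normfV invf_le1 ger0_norm ?sqrtr_ge0// (lt_le_trans ltr01).
Qed.
End real_lemmas.

Section power.
Context {R : realType}.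
Local Notation itg a b f := (\int[lebesgue_measure]_(x in `[a, b]) f x).
Local Notation cont a b f := {within `[a, b], continuous f}.

Lemma itg_power (g mu delta f l y z L : R) (h v P vx V : R -> R) :
  0 < L -> cont 0 L h -> cont 0 L v -> cont 0 L P -> cont 0 L vx -> cont 0 L V ->
  itg 0 L (fun x => delta * (mu * (h x * vx x ^+ 2) - f * (h x * v x)) +
    (mu * g * P x ^+ 2 - f * (h x * v x + mu * P x)) - l * (V x + L^-1 * y) - L^-1 * z) =
  delta * mu * itg 0 L (fun x => h x * vx x ^+ 2) + mu * g * itg 0 L (fun x => P x ^+ 2) -
  f * ((delta + 1) * itg 0 L (fun x => h x * v x) + mu * itg 0 L P) -
  z - l * (itg 0 L V + y).
Proof.
move=> L0 ch cv cP cx cV.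
transitivity (itg 0 L (fun x => delta * mu * (h x * vx x ^+ 2) + mu * g * P x ^+ 2 -
    f * (delta + 1) * (h x * v x) - f * mu * P x - l * V x - L^-1 * (z + l * y))).
  by apply: eq_itg => x _; ring.
rewrite !itgB; [|by within_tac..].
rewrite !itgD; [|by within_tac..].
rewrite !itgZ; [|by within_tac..].
rewrite (itg_cst _ (ltW L0)) subr0 [L^-1 * _]mulrC mulfK ?gt_eqF//.
by ring.
Qed.
End power.

Section flow.
Context {R : realType}.
Local Notation joint A B u := {within A `*` B, continuous (uncurry2 u)}.
Local Notation itg a b f := (\int[lebesgue_measure]_(x in `[a, b]) f x).
Context (g mu sigma L m : R) (xi w f : R -> R) (h v P ht hxt hxx hxxx vx vt vxx : R -> R -> R).
Context (mu_gt0 : 0 < mu) (sigma_gt0 : 0 < sigma) (L_gt0 : 0 < L).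
Context (F : regular_flow g mu sigma L m xi w h v f P ht hxt hxx hxxx vx vt vxx).
Let hs := m / L.

Lemma mass_eq_x (t x : R) : 0 < t -> 0 < x < L ->
  hxt t x = - (hxx t x * v t x + 2 * P t x * vx t x + h t x * vxx t x).
Proof.
move=> t0 xL; have [_ _ dP _ dht] := rf_der_h F t0 xL.
have [_ dv dvx] := rf_der_v F t0 xL; have dh := rf_hP F (ltW t0) xL.
rewrite -(derive1_of dht); apply: derive1_of.
have E (y : R) : 0 < y < L -> - (P t y * v t y + h t y * vx t y) = ht t y.
  by move=> yL; rewrite (rf_mass_eq F t0 yL).
apply: (der_near xL E); der; ring.
Qed.

Context (t1 t2 : R) (t1_gt0 : 0 < t1) (t12 : t1 < t2).
Local Notation bdd := (bdd t1 t2 L).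

Lemma joint_time (A B : set R) (y : R -> R) : {within A, continuous y} ->
  joint A B (fun t _ => y t).
Proof.
move=> /subspace_continuousP cy; apply/subspace_continuousP => -[t x] [/= At Bx].
apply/cvgrPdist_lt => e e0; have /cvgrPdist_lt /(_ e e0) := cy t At.
rewrite near_withinE => -[d d0 hd]; rewrite near_withinE.
exists (ball t d, setT) => /=; first by split; [exact: nbhsx_ballx|exact: filterT].
by move=> [s y'] /= [sb _] [As _]; exact: hd.
Qed.

Let sub12 : (`[t1, t2]%classic : set R) `<=` `]0, +oo[.
Proof. by move=> t /=; rewrite !in_itv /= andbT => /andP[tt _]; exact: lt_le_trans tt. Qed.

Let sub12' : (`[t1, t2]%classic : set R) `<=` `[0, +oo[.
Proof. by move=> t /sub12; exact: sub_oo_co. Qed.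

Let pos12 t : t1 < t < t2 -> 0 < t.
Proof. by move=> /andP[tt _]; exact: lt_trans tt. Qed.

Let idL : (`[0, L]%classic : set R) `<=` `[0, L]. Proof. by []. Qed.

Let ch : joint `[t1, t2] `[0, L] h. Proof. exact: (jointW sub12' idL (rf_h F)). Qed.
Let cv : joint `[t1, t2] `[0, L] v. Proof. exact: (jointW sub12' idL (rf_v F)). Qed.
Let cP : joint `[t1, t2] `[0, L] P. Proof. exact: (jointW sub12' idL (rf_P F)). Qed.
Let cht : joint `[t1, t2] `[0, L] ht. Proof. exact: (jointW sub12 idL (rf_ht F)). Qed.
Let cvx : joint `[t1, t2] `[0, L] vx. Proof. exact: (jointW sub12 idL (rf_vx F)). Qed.
Let cvt : joint `[t1, t2] `[0, L] vt. Proof. exact: (jointW sub12 idL (rf_vt F)). Qed.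

Let cf : joint `[t1, t2] `[0, L] (fun t _ => f t).
Proof. exact/joint_time/(continuous_subspaceW sub12' (rf_f F)). Qed.

Let cV : joint `[t1, t2] `[0, L] (fun t x => (h t x)^-1).
Proof.
apply: (withinV _ ch) => -[t x] [/= tt xx]; rewrite gt_eqF// (rf_h_gt0 F)//.
by have := sub12 tt; rewrite /= in_itv /= andbT => /ltW.
Qed.

(** The momentum equation divided by h reads (sigma K + mu v_x)_x = N, where
    K is the curvature and N is continuous up to the walls. So the
    oscillation of sigma K + mu v_x is bounded, although h_xx need not extend
    to the walls. *)
Lemma curv_bounded : bdd (fun t x => curv (P t x) (hxx t x)).
Proof.
pose N t x := vt t x + v t x * vx t x + g * P t x - mu * P t x * (h t x)^-1 * vx t x - f t.
have bN : bdd N.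
  have b1 := bdd_joint cvt; have b2 := bdd_joint cv; have b3 := bdd_joint cvx.
  have b4 := bdd_joint cP; have b5 := bdd_joint cV; have b6 := bdd_joint cf.
  by rewrite /N; bdd_tac.
have [l lL] : exists l : R, 0 < l < L.
  by exists (L / 2); rewrite divr_gt0//= ltr_pdivrMr// ltr_pMr// ltr1n.
have K0 : {within `[t1, t2], continuous (fun t => curv (P t l) (hxx t l))}.
  have c1 : {within `[t1, t2], continuous (P^~ l)}.
    by apply: (joint_slice2 (B := `[0, L])) cP; rewrite /= in_itv /=; case/andP: lL => *; rewrite !ltW.
  have c2 : {within `[t1, t2], continuous (hxx^~ l)}.
    apply: continuous_subspaceW sub12 _.
    by apply: (joint_slice2 (B := `]0, L[)) (rf_hxx F); rewrite /= in_itv /=.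
  rewrite /curv; apply: withinM => //; apply: withinV; last by within_tac.
  move=> t _; have p0 := arc_gt0 (P t l).
  by apply: mulf_neq0; rewrite gt_eqF ?sqrtr_gt0.
have [CK CK0 hCK] := bdd_joint (joint_time (B := `[0, L]) K0).
have [CN CN0 hCN] := bN; have [Cx Cx0 hCx] := bdd_joint cvx.
exists (sigma^-1 * (sigma * CK + 2 * mu * Cx + CN * L)) => [|t x tt xL].
  have [s0 m0 l0] := And3 (ltW sigma_gt0) (ltW mu_gt0) (ltW L_gt0).
  by apply: mulr_ge0; rewrite ?invr_ge0// !addr_ge0// !mulr_ge0.
have t0 := pos12 tt.
pose T y := sigma * curv (P t y) (hxx t y) + mu * vx t y.
have dT y : 0 < y < L -> is_derive y 1 T (N t y).
  move=> yL; have [_ _ dP dxx _] := rf_der_h F t0 yL.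
  have [_ _ dvx] := rf_der_v F t0 yL.
  have dK := der_curv dP dxx erefl.
  rewrite /T; der; rewrite mul0r add0r mul0r add0r /N.
  have h0 : 0 < h t y by apply: (rf_h_gt0 F); [exact: ltW|case/andP: yL => ? ?; rewrite !ltW].
  by apply: momentum_solved (rf_momentum F t0 yL); rewrite gt_eqF.
have hT y z : 0 < y -> y < z -> z < L -> `|T z - T y| <= CN * L.
  move=> y0 yz zL; have [y' /andP[yy yz'] ->] : exists2 c, y < c < z & T z - T y = N t c * (z - y).
    by apply: mean_value => // u /andP[yu uz]; apply: dT; rewrite (lt_le_trans y0)//=; exact: le_lt_trans zL.
  rewrite normrM ler_pM ?hCN//; first by rewrite (lt_trans y0)//= (lt_trans yz').
  have zy : 0 < z - y by rewrite subr_gt0.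
  rewrite gtr0_norm// (le_trans _ (ltW zL))// lerBlDr lerDl ltW//.
have hTl : `|T x - T l| <= CN * L.
  case/andP: (xL) (lL) => x0 xl /andP[l0 lL'].
  have [xl'|lx|->] := ltgtP x l.
  - by rewrite distrC hT.
  - exact: hT.
  - by rewrite subrr normr0 mulr_ge0// ltW.
rewrite -(ler_pM2l sigma_gt0) mulVKf ?gt_eqF//.
have := hCK t l tt lL; have := hCx t x tt xL; have := hCx t l tt lL.
exact: (norm_isolate mu_gt0 sigma_gt0 hTl).
Qed.

Context (k q delta lambda : R).
Context (delta_gt0 : 0 < delta).

Local Notation vden t x := (V_density g mu sigma delta hs (h t x) (v t x) (P t x)).
Local Notation En t := (itg 0 L (fun x => vden t x)).
Local Notation dissipated t := (delta * mu * itg 0 L (fun x => h t x * vx t x ^+ 2) +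
  mu * g * itg 0 L (fun x => P t x ^+ 2)).
Local Notation Phi t := ((delta + 1) * itg 0 L (fun x => h t x * v t x) +
  mu * (h t L - h t 0)).

Definition tank_energy (t : R) : R := q * k ^+ 2 / 2 * xi t ^+ 2 + q / 2 * (w t + k * xi t) ^+ 2.

Definition tank_power (t : R) : R :=
  q * k ^+ 2 * xi t * w t + q * (w t + k * xi t) * (- f t + k * w t).

Lemma der_tank_energy (t : R) : 0 < t -> is_derive t 1 tank_energy (tank_power t).
Proof.
move=> t0; have [dxi dw] := rf_tank F t0; rewrite /tank_energy; der.
by rewrite /tank_power /=; field.
Qed.

Let cy : joint `[t1, t2] `[0, L] (fun t _ => tank_energy t).
Proof.
have cxi := continuous_subspaceW sub12' (rf_xi F).
have cw := continuous_subspaceW sub12' (rf_w F).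
by apply: joint_time; rewrite /tank_energy; within_tac.
Qed.

Let cy' : joint `[t1, t2] `[0, L] (fun t _ => tank_power t).
Proof.
have cxi := continuous_subspaceW sub12' (rf_xi F).
have cw := continuous_subspaceW sub12' (rf_w F).
have cf' := continuous_subspaceW sub12' (rf_f F).
by apply: joint_time; rewrite /tank_power; within_tac.
Qed.

Lemma within_expR (T : topologicalType) (A : set T) (u : T -> R) : {within A, continuous u} ->
  {within A, continuous (fun x => expR (u x))}.
Proof. by move=> cu; apply: within_comp => // x _; exact: continuous_expR. Qed.

Let cexp : joint `[t1, t2] `[0, L] (fun t _ => expR (2 * lambda * t)).
Proof. by apply: joint_time; apply: within_expR; within_tac. Qed.

Lemma joint_V_density (A : set R) : joint A `[0, L] h -> joint A `[0, L] v -> joint A `[0, L] P ->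
  (forall t x, A t -> 0 <= x <= L -> 0 < h t x) ->
  joint A `[0, L] (fun t x => vden t x).
Proof.
move=> c1 c2 c3 h0; rewrite /V_density /E_density /W_density /pot_density.
have c4 : joint A `[0, L] (fun t x => (h t x)^-1).
  by apply: (withinV _ c1) => -[t x] [/= tt xx]; rewrite gt_eqF// h0.
move: c1 c2 c3 c4; rewrite /uncurry2 => c1 c2 c3 c4.
by within_tac.
Qed.

Let h_gt0 t x : t1 <= t <= t2 -> 0 <= x <= L -> 0 < h t x.
Proof.
by move=> /andP[tt _] xL; apply: (rf_h_gt0 F) => //; apply/ltW; exact: lt_le_trans tt.
Qed.

(** The energy of the tank is spread uniformly over [0, L], which turns the
    total energy, weighted by the exponential, into the integral of a density
    with a local balance law. *)
Lemma total_energy_decay :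
  (forall t, t1 < t < t2 ->
    2 * lambda * (En t + tank_energy t) <= dissipated t - f t * Phi t - tank_power t) ->
  expR (2 * lambda * t2) * (En t2 + tank_energy t2) <=
  expR (2 * lambda * t1) * (En t1 + tank_energy t1).
Proof.
move=> Hp.
pose ex t := expR (2 * lambda * t).
pose e t x := ex t * (vden t x + L^-1 * tank_energy t).
pose dd t x := delta * (mu * (h t x * vx t x ^+ 2) - f t * (h t x * v t x)) +
  (mu * g * P t x ^+ 2 - f t * (h t x * v t x + mu * P t x)).
pose d t x := ex t * (dd t x - 2 * lambda * (vden t x + L^-1 * tank_energy t)
  - L^-1 * tank_power t).
pose j t x := ex t * (delta * E_flux g mu sigma hs (h t x) (v t x) (P t x) (ht t x) (vx t x)
      (curv (P t x) (hxx t x)) +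
    W_flux g mu sigma hs (h t x) (v t x) (P t x) (ht t x) (curv (P t x) (hxx t x))).
have cVd : joint `[t1, t2] `[0, L] (fun t x => vden t x).
  by apply: joint_V_density => // t x; rewrite /= in_itv /=; exact: h_gt0.
have ce : joint `[t1, t2] `[0, L] e.
  move: cVd cy cexp; rewrite /e /ex /uncurry2 => c1 c2 c3; by within_tac.
have cd : joint `[t1, t2] `[0, L] d.
  move: cVd cy cy' cexp ch cv cP cvx cf.
  by rewrite /d /dd /ex /uncurry2 => c1 c2 c3 c4 c5 c6 c7 c8 c9; within_tac.
have en_t s : t1 <= s <= t2 -> itg 0 L (e s) = ex s * (En s + tank_energy s).
  move=> st; have As : `[t1, t2]%classic s by rewrite /= in_itv.
  have c1 := joint_slice As cVd.
  rewrite itgZ; last by within_tac.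
  rewrite itgD//; last exact: within_cst.
  rewrite (itg_cst _ (ltW L_gt0)) subr0 mulrAC mulVf ?mul1r//.
  exact: lt0r_neq0.
have [t11 t22] : t1 <= t1 <= t2 /\ t1 <= t2 <= t2 by rewrite !lexx !ltW.
rewrite -(en_t t1 t11) -(en_t t2 t22).
pose Et t x := 1 / 2 * ht t x * v t x ^+ 2 + h t x * v t x * vt t x +
  (g * (h t x - hs) * ht t x + sigma * (surface_sine (P t x) * hxt t x)).
pose Wt t x := - (1 / 2 * (ht t x / h t x ^+ 2) * (h t x * v t x + mu * P t x) ^+ 2) +
  (h t x)^-1 * (h t x * v t x + mu * P t x) * (ht t x * v t x + h t x * vt t x + mu * hxt t x) +
  (g * (h t x - hs) * ht t x + sigma * (surface_sine (P t x) * hxt t x)).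
pose et t x := ex t * (2 * lambda) * (vden t x + L^-1 * tank_energy t) +
  ex t * (delta * Et t x + Wt t x + L^-1 * tank_power t).
have cet : joint `]t1, t2[ `]0, L[ et.
  have s1 : (`]t1, t2[%classic : set R) `<=` `[t1, t2].
    by apply: subset_itv; rewrite bnd_simp.
  have s2 : (`]0, L[%classic : set R) `<=` `[0, L].
    by apply: subset_itv; rewrite bnd_simp.
  have s3 : (`]t1, t2[%classic : set R) `<=` `]0, +oo[ by move=> z /s1; exact: sub12.
  have id3 : (`]0, L[%classic : set R) `<=` `]0, L[ by [].
  have cS : joint `[t1, t2] `[0, L] (fun t x => surface_sine (P t x)).
    move: cP; rewrite /surface_sine /uncurry2 => c1; apply: withinM => //.
    apply: withinV; last by within_tac.
    by move=> p _; rewrite gt_eqF// sqrtr_gt0 arc_gt0.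
  move: (jointW s1 s2 cVd) (jointW s1 s2 cy) (jointW s1 s2 cy') (jointW s1 s2 cexp)
    (jointW s1 s2 ch) (jointW s1 s2 cv) (jointW s1 s2 cP) (jointW s1 s2 cV) (jointW s1 s2 cS)
    (jointW s1 s2 cht) (jointW s1 s2 cvt) (jointW s3 id3 (rf_hxt F)).
  rewrite /et /ex /uncurry2 => c1 c2 c3 c4 c5 c6 c7 c8 c9 c10 c11 c12.
  have cEt : {within `]t1, t2[ `*` `]0, L[, continuous (fun p : R * R => Et p.1 p.2)}.
    by rewrite /Et; within_tac.
  have cWt : {within `]t1, t2[ `*` `]0, L[, continuous (fun p : R * R => Wt p.1 p.2)}.
    have c13 : {within `]t1, t2[ `*` `]0, L[, continuous (fun p : R * R => (h p.1 p.2 ^+ 2)^-1)}.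
      have -> : (fun p : R * R => (h p.1 p.2 ^+ 2)^-1) = (fun p => (h p.1 p.2)^-1 ^+ 2).
        by apply/funext => p; rewrite exprVn.
      by within_tac.
    by rewrite /Wt; within_tac.
  by within_tac.
have [a ja bja] : exists2 a : R -> R -> R, bdd a & exists2 b : R -> R -> R, bdd b &
    forall t x, j t x = v t x * a t x + P t x * b t x.
  have b1 := bdd_joint ch; have b2 := bdd_joint cv; have b3 := bdd_joint cP.
  have b4 := bdd_joint cht; have b5 := bdd_joint cvx; have b6 := bdd_joint cV.
  have b7 := bdd_joint cexp; have bK := curv_bounded.
  have bS : bdd (fun t x => (Num.sqrt (1 + P t x ^+ 2))^-1).
    by exists 1 => // t x _ _; exact: inv_arc_le1.
  eexists; last eexists; last first.
    by move=> t x; rewrite /j flux_split mulrDr ![ex t * (_ * _)]mulrCA; reflexivity.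
  - by bdd_tac.
  - by bdd_tac.
have [b [Cb Cb0 hb] jE] := bja; have [Ca Ca0 ha] := ja.
pose bd t x := Ca * `|v t x| + Cb * `|P t x|.
have cbd : joint `[t1, t2] `[0, L] bd.
  by move: cv cP; rewrite /bd /uncurry2 => c1 c2; within_tac.
apply: (@dissipation R t1 t2 0 L e et j (fun t x => derive1 (j t) x) d bd t12 L_gt0 ce cd cbd cet _ _ _).
- move=> t /andP[tt _]; have t0 : 0 <= t by apply/ltW; exact: lt_le_trans tt.
  have [v0 vL p0 pL] := rf_bc F t0.
  by rewrite /bd v0 vL p0 pL normr0 !mulr0 addr0.
- move=> t x tt xL; have t0 := pos12 tt.
  have h0 : h t x != 0.
    by rewrite gt_eqF// h_gt0//; [case/andP: tt|case/andP: xL] => ? ?; rewrite !ltW.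
  have [dht dPt dP dxx dhtx] := rf_der_h F t0 xL.
  have [dvt dv dvx] := rf_der_v F t0 xL; have dh := rf_hP F (ltW t0) xL.
  have dE := der_E_density g sigma hs dht dvt dPt.
  have dW := der_W_density g mu sigma hs h0 dht dvt dPt.
  have dy := der_tank_energy t0.
  have djE := der_E_flux g mu sigma hs dh dv dP dvx dhtx dxx.
  have djW := der_W_flux g mu sigma hs h0 dh dv dP dhtx dxx.
  have bE := E_balance hs (hxt t x) (curv (P t x) (hxx t x)) (surface_sine (P t x))
    (rf_mass_eq F t0 xL) (rf_momentum F t0 xL).
  have bW := W_balance hs (curv (P t x) (hxx t x)) (surface_sine (P t x))
    h0 (rf_mass_eq F t0 xL) (mass_eq_x t0 xL) (rf_momentum F t0 xL).
  have dV : is_derive t 1 (fun s => vden s x) (delta * Et t x + Wt t x).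
    apply: der_eq (derD (derM (der_cst delta _) dE) dW) _.
    by rewrite mul0r add0r.
  have dj := derM (der_cst (ex t) x) (derD (derM (der_cst delta x) djE) djW).
  split.
  + have dex : is_derive t 1 ex (ex t * (2 * lambda)).
      by rewrite /ex; der; rewrite mulr1 mul0r add0r.
    by rewrite /e; der; rewrite /et; ring.
  + by rewrite (derive1_of dj).
  + rewrite jE /bd; apply: le_trans (ler_normD _ _) _.
    rewrite !normrM; apply: lerD; rewrite mulrC ler_wpM2r ?normr_ge0//.
      exact: ha.
    exact: hb.
  + have -> : et t x + derive1 (j t) x + d t x =
        ex t * - (mu * sigma * (hxx t x * curv (P t x) (hxx t x))).
      by rewrite (derive1_of dj); exact: (combine_balances _ _ _ _ _ _ _ _ bE bW).
    rewrite mulrN oppr_le0 mulr_ge0 ?expR_ge0// mulr_ge0 ?mul_curv_ge0//.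
    by rewrite mulr_ge0 ?ltW.
move=> t tt; have tt' : t1 <= t <= t2 by case/andP: tt => ? ?; rewrite !ltW.
have At : `[t1, t2]%classic t by rewrite /= in_itv.
have t0 := pos12 tt.
have s1 := joint_slice At ch; have s2 := joint_slice At cv; have s3 := joint_slice At cP.
have s4 := joint_slice At cvx; have s5 := joint_slice At cVd.
have IP : itg 0 L (P t) = h t L - h t 0.
  by apply: (itg_ftc (ltW L_gt0) s3 s1) => x xL; exact: (rf_hP F (ltW t0) xL).
rewrite /d itgZ; last by rewrite /dd; within_tac.
apply: mulr_ge0; first exact: expR_ge0.
have := Hp t tt; rewrite -subr_ge0 -IP.
by rewrite -(itg_power g mu delta (f t) (2 * lambda) (tank_energy t) (tank_power t)
  L_gt0 s1 s2 s3 s4 s5).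
Qed.
End flow.

(** * Comparison of the energy with the norm *)

Section norm_constants.
Context {R : realType}.
Local Notation itg a b f := (\int[lebesgue_measure]_(x in `[a, b]) f x).
Local Notation cont a b f := {within `[a, b], continuous f}.

Lemma itg_energy (L g sigma delta : R) (A B C D : R -> R) :
  cont 0 L A -> cont 0 L B -> cont 0 L C -> cont 0 L D ->
  itg 0 L (fun x => delta * (1 / 2 * A x + (g / 2 * C x + sigma * D x)) +
    (1 / 2 * B x + (g / 2 * C x + sigma * D x))) =
  delta * (1 / 2 * itg 0 L A + (g / 2 * itg 0 L C + sigma * itg 0 L D)) +
  (1 / 2 * itg 0 L B + (g / 2 * itg 0 L C + sigma * itg 0 L D)).
Proof.
move=> cA cB cC cD.
rewrite itgD; [|by within_tac..]; rewrite itgZ; last by within_tac.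
rewrite !itgD; [|by within_tac..]; rewrite !itgZ; [|by within_tac..].
by [].
Qed.

Definition norm_upper (g mu sigma delta k q Q Hmax : R) : R :=
  (delta / 2 + 1) * Hmax + (mu ^+ 2 / Q + (1 + delta) * sigma / 2) + (1 + delta) * g / 2 +
  (q + 3 / 2 * q * k ^+ 2).

Definition norm_lower (g mu delta k q Q Hmax : R) : R :=
  Num.min (Num.min (delta * Q / 4) (delta * mu ^+ 2 / (4 * (1 + delta) * Hmax)))
    (Num.min ((1 + delta) * g / 4) (Num.min (q / 8) (q * k ^+ 2 / 4))).

Context (g mu sigma delta k q Q Hmax hs : R).
Context (g_gt0 : 0 < g) (mu_gt0 : 0 < mu) (sigma_gt0 : 0 < sigma)
  (delta_gt0 : 0 < delta) (k_gt0 : 0 < k) (q_gt0 : 0 < q) (Q_gt0 : 0 < Q) (Hmax_gt0 : 0 < Hmax).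

Lemma norm_lower_gt0 : 0 < norm_lower g mu delta k q Q Hmax.
Proof.
have d1 : 0 < 1 + delta by rewrite addr_gt0.
by rewrite !lt_min; apply/and3P; split; rewrite ?andbT; do ?[apply/andP; split];
  rewrite divr_gt0 ?mulr_gt0 ?exprn_gt0.
Qed.

Let up4 : [/\ 0 <= (delta / 2 + 1) * Hmax, 0 <= mu ^+ 2 / Q + (1 + delta) * sigma / 2,
  0 <= (1 + delta) * g / 2 & 0 <= q + 3 / 2 * q * k ^+ 2].
Proof.
have d1 : 0 < 1 + delta by rewrite addr_gt0.
have [d0 q0 s0 g0] := And4 (ltW delta_gt0) (ltW q_gt0) (ltW sigma_gt0) (ltW g_gt0).
have [Q0 H0 dd] := And3 (ltW Q_gt0) (ltW Hmax_gt0) (ltW d1); split.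
- by rewrite mulr_ge0// addr_ge0// divr_ge0.
- by rewrite addr_ge0// divr_ge0 ?sqr_ge0// mulr_ge0.
- by rewrite divr_ge0// mulr_ge0.
- have k2 := sqr_ge0 k; have e0 : 0 <= q * k ^+ 2 by rewrite mulr_ge0.
  by rewrite -mulrA addr_ge0// (mulr_ge0 (divr_ge0 _ _)) ?ler0n.
Qed.

Lemma norm_upper_gt0 : 0 < norm_upper g mu sigma delta k q Q Hmax.
Proof.
have [u1 u2 u3 u4] := up4; rewrite /norm_upper; apply: ltr_wpDl.
  by apply: addr_ge0 => //; exact: addr_ge0.
have k2 := sqr_ge0 k; have e0 : 0 <= q * k ^+ 2 by rewrite mulr_ge0// ltW.
by rewrite -mulrA ltr_pwDl// mulr_ge0// divr_ge0 ?ler0n.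
Qed.

Let sum_le (c a b d : R) (x y z : R) : 0 <= x -> 0 <= y -> 0 <= z ->
  a <= c -> b <= c -> d <= c -> a * x + b * y + d * z <= c * (x + y + z).
Proof. by move=> x0 y0 z0 ac bc dc; rewrite !mulrDr !lerD// ler_wpM2r. Qed.

Let sum_ge (c a b d : R) (x y z : R) : 0 <= x -> 0 <= y -> 0 <= z ->
  c <= a -> c <= b -> c <= d -> c * (x + y + z) <= a * x + b * y + d * z.
Proof. by move=> x0 y0 z0 ac bc dc; rewrite !mulrDr !lerD// ler_wpM2r. Qed.

Lemma V_density_le (h v P : R) : Q <= h <= Hmax ->
  V_density g mu sigma delta hs h v P <=
  norm_upper g mu sigma delta k q Q Hmax * ((h - hs) ^+ 2 + P ^+ 2 + v ^+ 2).
Proof.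
move=> /andP[Qh hH]; have h0 := lt_le_trans Q_gt0 Qh.
have [u1 u2 u3 u4] := up4; have d1 : 0 < 1 + delta by rewrite addr_gt0.
apply: (@le_trans _ _ ((1 + delta) * g / 2 * (h - hs) ^+ 2 +
  (mu ^+ 2 / Q + (1 + delta) * sigma / 2) * P ^+ 2 + (delta / 2 + 1) * Hmax * v ^+ 2)).
  have e1 : h^-1 * (h * v + mu * P) ^+ 2 <= 2 * (h * v ^+ 2) + 2 * (mu ^+ 2 / h * P ^+ 2).
    rewrite -subr_ge0 (_ : _ - _ = h^-1 * (h * v - mu * P) ^+ 2).
      by rewrite mulr_ge0 ?sqr_ge0// invr_ge0 ltW.
    by field; rewrite gt_eqF.
  have e2 : mu ^+ 2 / h * P ^+ 2 <= mu ^+ 2 / Q * P ^+ 2.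
    by rewrite ler_wpM2r ?sqr_ge0// ler_pM2l ?exprn_gt0// lef_pV2.
  have e3 : (delta / 2 + 1) * (h * v ^+ 2) <= (delta / 2 + 1) * (Hmax * v ^+ 2).
    by rewrite ler_pM2l ?ler_wpM2r ?sqr_ge0// addr_gt0 ?divr_gt0.
  have e4 := ler_wpM2l (ltW (mulr_gt0 d1 sigma_gt0)) (arc_le P).
  rewrite /V_density /E_density /W_density /pot_density.
  move: e1 e2 e3 e4; move: (h^-1 * _) (mu ^+ 2 / h * _) (mu ^+ 2 / Q) (Num.sqrt _ - 1).
  move=> a b c d e1 e2 e3 e4; lra.
by rewrite /norm_upper; apply: sum_le; rewrite ?sqr_ge0//; lra.
Qed.

Lemma V_density_ge_norm (h v P : R) : Q <= h <= Hmax ->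
  norm_lower g mu delta k q Q Hmax * ((h - hs) ^+ 2 + P ^+ 2 + v ^+ 2) <=
  V_density g mu sigma delta hs h v P.
Proof.
move=> /andP[Qh hH]; have h0 := lt_le_trans Q_gt0 Qh.
have d1 : 0 < 1 + delta by rewrite addr_gt0.
apply: (@le_trans _ _ ((1 + delta) * g / 4 * (h - hs) ^+ 2 +
  delta * mu ^+ 2 / (4 * (1 + delta) * Hmax) * P ^+ 2 + delta * Q / 4 * v ^+ 2)).
  by apply: sum_ge; rewrite ?sqr_ge0// /norm_lower !ge_min lexx ?orbT.
have e1 := V_density_ge g mu sigma hs v P delta_gt0 h0.
have e2 : delta * (Q * v ^+ 2) <= delta * (h * v ^+ 2).
  by rewrite ler_pM2l// ler_wpM2r ?sqr_ge0.
have e3 : delta * mu ^+ 2 / (2 * (1 + delta) * Hmax) * P ^+ 2 <=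
    delta * mu ^+ 2 / (2 * (1 + delta)) * (P ^+ 2 / h).
  have -> : delta * mu ^+ 2 / (2 * (1 + delta) * Hmax) * P ^+ 2 =
      delta * mu ^+ 2 / (2 * (1 + delta)) * (P ^+ 2 / Hmax).
    by field; rewrite !gt_eqF.
  rewrite ler_wpM2l//.
    by rewrite divr_ge0 ?mulr_ge0 ?sqr_ge0 ?ltW// mulr_gt0.
  by rewrite ler_wpM2l ?sqr_ge0// lef_pV2.
have e4 : delta * mu ^+ 2 / (4 * (1 + delta) * Hmax) = delta * mu ^+ 2 / (2 * (1 + delta) * Hmax) / 2.
  by field; rewrite !gt_eqF.
have p0 := pot_density_ge0 hs h P g_gt0 sigma_gt0.
have p1 : g / 2 * (h - hs) ^+ 2 <= pot_density g sigma hs h P.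
  rewrite /pot_density lerDl mulr_ge0 ?(ltW sigma_gt0)// subr_ge0; exact: arc_ge1.
have p2 : (1 + delta) * (g / 2 * (h - hs) ^+ 2) <= (1 + delta) * pot_density g sigma hs h P.
  by rewrite ler_pM2l.
have e5 : delta * (1 / 2 * (h * v ^+ 2)) + (1 + delta) * pot_density g sigma hs h P <=
    V_density g mu sigma delta hs h v P.
  rewrite /V_density /E_density /W_density -subr_ge0.
  rewrite (_ : _ - _ = 1 / 2 * (h^-1 * (h * v + mu * P) ^+ 2)); last by ring.
  have hI : 0 <= h^-1 by rewrite invr_ge0 ltW.
  by rewrite mulr_ge0 ?divr_ge0// mulr_ge0// sqr_ge0.
have p3 := mulr_ge0 (ltW d1) p0.
rewrite e4; move: e1 e2 e3 p2 p3 e5.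
move: (V_density _ _ _ _ _ _ _ _) (pot_density _ _ _ _ _) (h * v ^+ 2)
  (delta * mu ^+ 2 / (2 * (1 + delta)) * _) (delta * mu ^+ 2 / (2 * (1 + delta) * Hmax)).
by move=> V p a b c e1 e2 e3 p2 p3 e5; lra.
Qed.

Lemma tank_le (xi w : R) : q * k ^+ 2 / 2 * xi ^+ 2 + q / 2 * (w + k * xi) ^+ 2 <=
  norm_upper g mu sigma delta k q Q Hmax * (xi ^+ 2 + w ^+ 2).
Proof.
have [u1 u2 u3 u4] := up4; have q2 := mulr_ge0 (ltW q_gt0) (sqr_ge0 (w - k * xi)).
have qk : 0 <= q * k ^+ 2 by rewrite mulr_ge0 ?sqr_ge0 ?ltW.
apply: (@le_trans _ _ ((q + 3 / 2 * q * k ^+ 2) * (xi ^+ 2 + w ^+ 2))); last first.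
  by rewrite ler_wpM2r ?addr_ge0 ?sqr_ge0// /norm_upper; lra.
have h1 := mulr_ge0 qk (sqr_ge0 w); have h2 := mulr_ge0 (ltW q_gt0) (sqr_ge0 xi).
by lra.
Qed.

Lemma tank_ge (xi w : R) : norm_lower g mu delta k q Q Hmax * (xi ^+ 2 + w ^+ 2) <=
  q * k ^+ 2 / 2 * xi ^+ 2 + q / 2 * (w + k * xi) ^+ 2.
Proof.
apply: (@le_trans _ _ (q * k ^+ 2 / 4 * xi ^+ 2 + q / 8 * w ^+ 2)).
  by rewrite mulrDr lerD// ler_wpM2r ?sqr_ge0// /norm_lower !ge_min lexx ?orbT.
have e1 := mulr_ge0 (ltW q_gt0) (sqr_ge0 (w + 4 / 3 * k * xi)).
have e2 := mulr_ge0 (ltW q_gt0) (sqr_ge0 (k * xi)).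
by lra.
Qed.
End norm_constants.

Section profile.
Context {R : realType}.
Local Notation itg a b f := (\int[lebesgue_measure]_(x in `[a, b]) f x).
Local Notation cont a b f := {within `[a, b], continuous f}.
Context (g mu sigma L m : R) (h P v : R -> R).
Context (L_gt0 : 0 < L) (ch : cont 0 L h) (cP : cont 0 L P) (cv : cont 0 L v).
Context (dh : forall x, 0 < x < L -> is_derive x 1 h (P x)).
Context (h_gt0 : forall x, 0 <= x <= L -> 0 < h x).
Let hs := m / L.

Let cV : cont 0 L (fun x => (h x)^-1).
Proof. by apply: withinV ch => x /=; rewrite in_itv /= => xL; rewrite gt_eqF ?h_gt0. Qed.

Lemma V_fun_smooth (k q delta xi w : R) :
  V_fun g mu sigma L m k q delta xi w h v =
  itg 0 L (fun x => V_density g mu sigma delta hs (h x) (v x) (P x)) +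
  (q * k ^+ 2 / 2 * xi ^+ 2 + q / 2 * (w + k * xi) ^+ 2).
Proof.
have [_ L2w wE] := weak_derivativeE L_gt0 ch cP dh.
have mw := L2_measurable L2w; have mP := cont_measurable_oo cP.
have mV := cont_measurable_oo cV; have mhv : measurable_fun `]0, L[ (fun x => h x * v x).
  by apply: cont_measurable_oo; within_tac.
have msqrt (u : R -> R) : measurable_fun `]0, L[ u ->
    measurable_fun `]0, L[ (fun x => Num.sqrt (1 + u x ^+ 2) - 1).
  move=> mu0; apply: measurable_funB => //.
  apply: (@measurableT_comp _ _ _ _ _ _ (@Num.sqrt R) _ (fun x => 1 + u x ^+ 2)).
    by apply: continuous_measurable_fun; exact: sqrt_continuous.
  by apply: measurable_funD => //; exact: measurable_funX.
have mker (u : R -> R) : measurable_fun `]0, L[ u ->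
    measurable_fun `]0, L[ (fun x => (h x)^-1 * (h x * v x + mu * u x) ^+ 2).
  move=> mu0; apply: measurable_funM => //; apply: measurable_funX.
  by apply: measurable_funD => //; exact: measurable_funM.
have e1 : itg 0 L (fun x => Num.sqrt (1 + weak_derivative L h x ^+ 2) - 1) =
    itg 0 L (fun x => Num.sqrt (1 + P x ^+ 2) - 1).
  by apply: (@ae_itg _ _ (fun _ y => Num.sqrt (1 + y ^+ 2) - 1)) => //; exact: msqrt.
have e2 : itg 0 L (fun x => (h x)^-1 * (h x * v x + mu * weak_derivative L h x) ^+ 2) =
    itg 0 L (fun x => (h x)^-1 * (h x * v x + mu * P x) ^+ 2).
  by apply: (@ae_itg _ _ (fun x y => (h x)^-1 * (h x * v x + mu * y) ^+ 2)) => //; exact: mker.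
rewrite /V_fun /E_fun /W_fun /potential /integral_0L e1 e2 cont_L2norm_sqr; last by within_tac.
rewrite /V_density /E_density /W_density /pot_density.
rewrite -[in LHS]addrA; congr (_ + _).
have cA : cont 0 L (fun x => h x * v x ^+ 2) by within_tac.
have cB : cont 0 L (fun x => (h x)^-1 * (h x * v x + mu * P x) ^+ 2) by within_tac.
have cC : cont 0 L (fun x => (h x - hs) ^+ 2) by within_tac.
have cD : cont 0 L (fun x => Num.sqrt (1 + P x ^+ 2) - 1) by within_tac.
by rewrite -(itg_energy _ _ _ cA cB cC cD).
Qed.

Local Notation norm2 xi w := (xi ^+ 2 + w ^+ 2 + itg 0 L (fun x => (h x - hs) ^+ 2) +
  itg 0 L (fun x => P x ^+ 2) + itg 0 L (fun x => v x ^+ 2)).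

Lemma Xnorm_smooth (xi w : R) :
  Xnorm L xi w (fun x => h x - hs) v = Num.sqrt (norm2 xi w).
Proof.
have ch' : cont 0 L (fun x => h x - hs) by within_tac.
have dh' x : 0 < x < L -> is_derive x 1 (fun y => h y - hs) (P x).
  by move=> xL; have dhx := dh xL; der; rewrite addr0.
by rewrite /Xnorm (weak_derivative_norm L_gt0 ch' cP dh') !cont_L2norm_sqr.
Qed.

Lemma in_S_smooth (xi w : R) : itg 0 L h = m -> v 0 = 0 -> v L = 0 -> in_S L m xi w h v.
Proof.
move=> mass v0 vL; have [H1h _ _] := weak_derivativeE L_gt0 ch cP dh.
by split=> //; split=> // x; rewrite in_itv; exact: h_gt0.
Qed.

Context (k q delta Q Hmax : R) (g_gt0 : 0 < g) (mu_gt0 : 0 < mu) (sigma_gt0 : 0 < sigma)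
  (delta_gt0 : 0 < delta) (k_gt0 : 0 < k) (q_gt0 : 0 < q) (Q_gt0 : 0 < Q) (Hmax_gt0 : 0 < Hmax).
Context (hQ : forall x, 0 <= x <= L -> Q <= h x <= Hmax).
Local Notation total xi w := (itg 0 L (fun x => V_density g mu sigma delta hs (h x) (v x) (P x)) +
  (q * k ^+ 2 / 2 * xi ^+ 2 + q / 2 * (w + k * xi) ^+ 2)).

Lemma norm2_sum (c xi w : R) : c * norm2 xi w =
  itg 0 L (fun x => c * ((h x - hs) ^+ 2 + P x ^+ 2 + v x ^+ 2)) + c * (xi ^+ 2 + w ^+ 2).
Proof.
rewrite itgZ; last by within_tac.
by rewrite !itgD; [|by within_tac..]; ring.
Qed.

Let cVd : cont 0 L (fun x => V_density g mu sigma delta hs (h x) (v x) (P x)).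
Proof. by rewrite /V_density /E_density /W_density /pot_density; within_tac. Qed.

Lemma total_le (xi w : R) :
  total xi w <= norm_upper g mu sigma delta k q Q Hmax * norm2 xi w.
Proof.
rewrite norm2_sum; apply: lerD; last exact: tank_le.
by apply: itg_le => //; [within_tac|move=> x /hQ hx; exact: V_density_le].
Qed.

Lemma total_ge (xi w : R) :
  norm_lower g mu delta k q Q Hmax * norm2 xi w <= total xi w.
Proof.
rewrite norm2_sum; apply: lerD; last exact: tank_ge.
by apply: itg_le => //; [within_tac|move=> x /hQ hx; exact: V_density_ge_norm].
Qed.
End profile.

(** * Exponential stability *)

(** At the supremum of the times up to which the bound holds, it still holds
    by continuity, and then beyond by assumption. *)
Lemma continuous_induction (R : realType) (f : R -> R) (c : R) :
  {within `[0, +oo[, continuous f} -> f 0 <= c ->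
  (forall T : R, 0 <= T -> (forall t : R, 0 <= t <= T -> f t <= c) ->
    exists2 e : R, 0 < e & forall t : R, T <= t <= T + e -> f t <= c) ->
  forall t : R, 0 <= t -> f t <= c.
Proof.
move=> /subspace_continuousP cf f0 step t0 t00; rewrite leNgt; apply/negP => ct0.
pose A : set R := [set T | 0 <= T /\ forall s, 0 <= s <= T -> f s <= c].
have A0 : A 0.
  by split=> // s; rewrite -eq_le => /eqP <-.
have Aub : ubound A t0.
  move=> T [T0 hT]; rewrite leNgt; apply/negP => tT.
  by have := hT t0; rewrite t00 (ltW tT) leNgt ct0 => /(_ isT).
have supA : has_sup A by split; [exists 0|exists t0].
have T0 : 0 <= sup A by apply: ub_le_sup => //; exists t0.
have before s : 0 <= s < sup A -> f s <= c.
  move=> /andP[s0 sA]; have [T [_ hT] sT] := sup_gt supA.1 sA.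
  by apply: hT; rewrite s0 ltW.
have at_sup : f (sup A) <= c.
  have [e|T0'] := eqVneq (sup A) 0; first by rewrite e.
  have sup0 : 0 < sup A by rewrite lt_def T0' T0.
  rewrite leNgt; apply/negP => cf0.
  have AT : (`[0, +oo[%classic : set R) (sup A) by rewrite /= in_itv /= T0.
  have e0 : 0 < f (sup A) - c by rewrite subr_gt0.
  have /cvgrPdist_lt /(_ _ e0) := cf _ AT; rewrite near_withinE => -[d /= d0 hd].
  have [s [s0 sd sA _ _]] := small_pos4 d0 sup0 d0 d0.
  have := hd (sup A - s); rewrite /= opprB addrC subrK gtr0_norm// in_itv /= andbT.
  have sA' : 0 <= sup A - s by rewrite subr_ge0 ltW.
  move=> /(_ sd sA'); rewrite /from_subspace ltr_norml => /andP[_].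
  have := before (sup A - s); rewrite sA' ltrBlDr ltrDl s0 => /(_ isT).
  by clear; lra.
have [e e0 he] : exists2 e : R, 0 < e & forall t : R, sup A <= t <= sup A + e -> f t <= c.
  apply: step => // s /andP[s0]; rewrite le_eqVlt => /predU1P[->//|sA].
  by apply: before; rewrite s0.
have : A (sup A + e).
  split=> [|s /andP[s0 sA]]; first by rewrite addr_ge0// ltW.
  have [ss|ss] := ltP s (sup A); first by apply: before; rewrite s0.
  by apply: he; rewrite ss.
move=> /(ub_le_sup (ex_intro _ t0 Aub)).
by rewrite gerDl leNgt e0.
Qed.

Lemma height_estimatesW (R : realType) (g mu sigma L m delta s s' y : R) :
  0 < m -> 0 < L -> 0 < sigma -> 0 < delta -> 0 <= s -> s <= s' ->
  height_estimates g mu sigma L m delta s y -> height_estimates g mu sigma L m delta s' y.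
Proof.
move=> m0 L0 s0 d0 s1 ss [h1 h2 h3]; have d1 : 0 < delta + 1 by rewrite addr_gt0.
have d2 : 0 < 1 + delta by rewrite addr_gt0.
split; first exact: le_trans ss.
  by apply: (le_trans h2); rewrite ler_pM2l// mulr_gt0// mulr_gt0.
have sd : 0 < sigma * (delta + 1) by rewrite mulr_gt0.
apply: (le_trans h3); rewrite ler_pXn2r ?nnegrE ?addr_ge0 ?divr_ge0 ?(ltW L0) ?(ltW sd)//.
  by rewrite lerD2r ler_pM2r ?invr_gt0.
exact: le_trans ss.
Qed.

Section gains.
Context {R : realType}.
Context (g mu sigma L m Hmax omega delta r : R).
Context (g_gt0 : 0 < g) (mu_gt0 : 0 < mu) (L_gt0 : 0 < L) (m_gt0 : 0 < m)
  (Hmax_gt0 : 0 < Hmax) (omega_gt0 : 0 < omega) (delta_gt0 : 0 < delta).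
Let Q := Q1 g mu sigma L m delta r.
Context (Q_gt0 : 0 < Q).

Definition momentum_gain (Q : R) : R :=
  2 * (delta + 1) ^+ 2 * m * Hmax * L ^+ 2 / (pi ^+ 2 * Q * delta * mu).

Definition drop_gain : R := 2 * mu * L / g.

(** The factor 2 leaves room for heights slightly below Q_1. *)
Definition input_gain : R := momentum_gain Q + 2 * drop_gain.

(** This turns the assumption on k into the smallness condition k (1 / omega
    + C) < q, where C is the gain of the input functional. *)
Lemma theta_inv : theta g mu sigma L m Hmax omega delta r = (omega^-1 + input_gain)^-1.
Proof.
rewrite /theta /input_gain /momentum_gain /drop_gain -/Q.
have p0 : 0 < pi ^+ 2 :> R by rewrite exprn_gt0 ?pi_gt0.
move: (pi ^+ 2 : R) Q p0 Q_gt0 => p q p0 q0.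
have d0 : 0 < delta + 1 by rewrite addr_gt0.
have K : 0 < omega^-1 + (2 * (delta + 1) ^+ 2 * m * Hmax * L ^+ 2 / (p * q * delta * mu) +
    2 * (2 * mu * L / g)).
  rewrite addr_gt0 ?invr_gt0// addr_gt0//; first by rewrite divr_gt0 ?mulr_gt0 ?exprn_gt0.
  by rewrite mulr_gt0// divr_gt0 ?mulr_gt0.
have N0 : 0 < omega * g * mu * delta * p * q by rewrite !mulr_gt0.
rewrite [X in _ / X](_ : _ = omega * g * mu * delta * p * q * (omega^-1 +
    (2 * (delta + 1) ^+ 2 * m * Hmax * L ^+ 2 / (p * q * delta * mu) + 2 * (2 * mu * L / g)))).
  have divMl (a b : R) : a != 0 -> a / (a * b) = b^-1.
    by move=> a0; rewrite invfM mulrA mulfV// mul1r.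
  exact: divMl (lt0r_neq0 N0).
by field; rewrite !gt_eqF.
Qed.

Let p0 : 0 < pi ^+ 2 :> R. Proof. by rewrite exprn_gt0 ?pi_gt0. Qed.

Lemma momentum_gain_gt0 : 0 < momentum_gain Q.
Proof.
have d0 : 0 < delta + 1 by rewrite addr_gt0.
by rewrite divr_gt0 ?mulr_gt0 ?exprn_gt0 ?pi_gt0.
Qed.

Lemma drop_gain_gt0 : 0 < drop_gain.
Proof. by apply: divr_gt0 => //; rewrite !mulr_gt0. Qed.

Lemma input_gain_gt0 : 0 < input_gain.
Proof. by rewrite addr_gt0 ?momentum_gain_gt0// mulr_gt0// drop_gain_gt0. Qed.

(** The height at which the momentum gain reaches the input gain. It lies
    strictly below Q_1, which allows to continue the estimates in time. *)
Definition floor_height : R := Q * (momentum_gain Q / input_gain).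

Lemma floor_height_gt0 : 0 < floor_height.
Proof. by rewrite mulr_gt0// divr_gt0 ?momentum_gain_gt0 ?input_gain_gt0. Qed.

Lemma floor_height_lt : floor_height < Q.
Proof.
rewrite /floor_height gtr_pMr// ltr_pdivrMr ?input_gain_gt0// mul1r /input_gain ltrDl.
by rewrite mulr_gt0// drop_gain_gt0.
Qed.

Let momentum_gainM c : 0 < c -> momentum_gain (Q * c) = momentum_gain Q / c.
Proof.
rewrite /momentum_gain; move: (pi ^+ 2 : R) Q p0 Q_gt0 => p q pp q0 c0.
by field; rewrite !gt_eqF.
Qed.

Lemma momentum_gain_floor : momentum_gain floor_height = input_gain.
Proof.
have [a0 b0] := (momentum_gain_gt0, input_gain_gt0).
have c0 := divr_gt0 a0 b0.
by rewrite /floor_height (momentum_gainM c0) invf_div mulrC divfK// gt_eqF.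
Qed.
End gains.

Definition decay_exponent (R : realType) (g mu sigma L m Hmax omega k q delta r : R) : R :=
  decay_lambda omega k q (input_gain g mu sigma L m Hmax delta r)
    (energy_const g mu sigma L Hmax delta (floor_height g mu sigma L m Hmax delta r)).

Section stability.
Context {R : realType}.
Local Notation itg a b f := (\int[lebesgue_measure]_(x in `[a, b]) f x).
Local Notation joint A B u := {within A `*` B, continuous (uncurry2 u)}.
Context (g mu sigma L m Hmax omega k q delta r : R).
Context (g_gt0 : 0 < g) (mu_gt0 : 0 < mu) (sigma_gt0 : 0 < sigma) (L_gt0 : 0 < L)
  (m_gt0 : 0 < m) (Hmax_gt0 : 0 < Hmax) (hstar_lt : m / L < Hmax)
  (omega_gt0 : 0 < omega) (k_gt0 : 0 < k) (q_gt0 : 0 < q) (delta_gt0 : 0 < delta)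
  (r_ge0 : 0 <= r) (r_lt : r < R_const g mu sigma L m Hmax delta)
  (k_lt : k < q * theta g mu sigma L m Hmax omega delta r).
Let Q := Q1 g mu sigma L m delta r.
Let C := input_gain g mu sigma L m Hmax delta r.
Let Qp := floor_height g mu sigma L m Hmax delta r.
Let C4 := energy_const g mu sigma L Hmax delta Qp.
Let lambda := decay_exponent g mu sigma L m Hmax omega k q delta r.

Let Q_gt0 : 0 < Q.
Proof. exact: (Q1_gt0 g_gt0 mu_gt0 sigma_gt0 L_gt0 m_gt0 delta_gt0 hstar_lt r_ge0 r_lt). Qed.
Let C_gt0 : 0 < C. Proof. exact: input_gain_gt0. Qed.
Let Qp_gt0 : 0 < Qp. Proof. exact: floor_height_gt0. Qed.
Let Qp_lt : Qp < Q. Proof. exact: floor_height_lt. Qed.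
Let C4_gt0 : 0 < C4. Proof. exact: energy_const_gt0. Qed.

Let k_small : k * (omega^-1 + C) < q.
Proof.
have K0 : 0 < omega^-1 + C by rewrite addr_gt0 ?invr_gt0.
by move: k_lt; rewrite theta_inv// ltr_pdivlMr.
Qed.

Lemma decay_exponent_gt0 : 0 < decay_exponent g mu sigma L m Hmax omega k q delta r.
Proof. exact: decay_lambda_gt0. Qed.
Let lambda_gt0 : 0 < lambda. Proof. exact: decay_exponent_gt0. Qed.

Lemma norm_ratio_gt0 : 0 < norm_upper g mu sigma delta k q Q Hmax /
  norm_lower g mu delta k q Q Hmax.
Proof. by rewrite divr_gt0 ?norm_upper_gt0 ?norm_lower_gt0. Qed.

Context (xi w f : R -> R) (h v P ht hxt hxx hxxx vx vt vxx : R -> R -> R).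
Context (F : regular_flow g mu sigma L m xi w h v f P ht hxt hxx hxxx vx vt vxx).
Context (fb : feedback_law mu L omega k q delta xi w h v f).

Local Notation En t := (itg 0 L (fun x => V_density g mu sigma delta (m / L) (h t x) (v t x) (P t x))).
Let Et t := En t + tank_energy xi w k q t.

Let At t : 0 <= t -> (`[0, +oo[%classic : set R) t.
Proof. exact: co_pos. Qed.
Let cht t : 0 <= t -> {within `[0, L], continuous (h t)}.
Proof. by move=> /At t0; exact: joint_slice t0 (rf_h F). Qed.
Let cPt t : 0 <= t -> {within `[0, L], continuous (P t)}.
Proof. by move=> /At t0; exact: joint_slice t0 (rf_P F). Qed.
Let cvt t : 0 <= t -> {within `[0, L], continuous (v t)}.
Proof. by move=> /At t0; exact: joint_slice t0 (rf_v F). Qed.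

Let Et_cont : {within `[0, +oo[, continuous Et}.
Proof.
rewrite /Et; apply: withinD; last first.
  have cxi := rf_xi F; have cw := rf_w F.
  by rewrite /tank_energy; within_tac.
apply: joint_itg L_gt0 _.
apply: joint_V_density (rf_h F) (rf_v F) (rf_P F) _ => t x.
by rewrite /= in_itv /= andbT; exact: (rf_h_gt0 F).
Qed.

Let En_ge0 t : 0 <= t -> 0 <= En t.
Proof.
move=> t0; apply: itg_ge0 => x xL; have h0 := rf_h_gt0 F t0 xL.
apply: le_trans (V_density_ge g mu sigma (m / L) (v t x) (P t x) delta_gt0 h0).
have d0 := ltW delta_gt0; have d1 : 0 <= 1 + delta by rewrite addr_ge0.
apply: addr_ge0; last by rewrite mulr_ge0 ?pot_density_ge0.
by apply: mulr_ge0; apply: divr_ge0; rewrite ?sqr_ge0 ?(ltW h0)// mulr_ge0 ?sqr_ge0.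
Qed.

Let tank_ge0 t : 0 <= tank_energy xi w k q t.
Proof.
have q0 := ltW q_gt0; have k2 : 0 <= q * k ^+ 2 by rewrite mulr_ge0 ?sqr_ge0.
by apply: addr_ge0; rewrite mulr_ge0 ?sqr_ge0// divr_ge0.
Qed.

Let height_range t x : 0 <= t -> Et t <= r -> 0 <= x <= L -> Q <= h t x < Hmax.
Proof.
move=> t0 Er xL; have h0 := rf_h_gt0 F t0 xL.
have Enr : En t <= r by apply: le_trans Er; rewrite lerDl.
have hp y : 0 <= y <= L -> 0 < h t y by exact: (rf_h_gt0 F).
have mass := rf_mass F t0; have dh y : 0 < y < L -> is_derive y 1 (h t) (P t y).
  exact: (rf_hP F t0).
have est : height_estimates g mu sigma L m delta r (h t x).
  apply: (height_estimatesW m_gt0 L_gt0 sigma_gt0 delta_gt0 (En_ge0 t0) Enr).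
  split.
  - exact: (height_bound_G g_gt0 mu_gt0 sigma_gt0 L_gt0 delta_gt0 (cht t0) (cPt t0) (cvt t0)).
  - exact: (height_bound_viscous g_gt0 mu_gt0 sigma_gt0 L_gt0 m_gt0 delta_gt0 (cht t0) (cPt t0) (cvt t0)).
  - exact: (height_bound_surface mu g_gt0 sigma_gt0 L_gt0 delta_gt0 (cht t0) (cPt t0) (cvt t0)).
apply/andP; split.
  exact: (Q1_le g_gt0 mu_gt0 L_gt0 m_gt0 delta_gt0 h0 r_ge0 est).
exact: (lt_Hmax g_gt0 mu_gt0 sigma_gt0 L_gt0 m_gt0 delta_gt0 hstar_lt h0 r_ge0 r_lt est).
Qed.

Let sub_oo12 (t1 t2 t : R) : 0 < t1 -> t1 <= t <= t2 -> 0 < t.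
Proof. by move=> t10 /andP[tt _]; exact: lt_le_trans tt. Qed.

Let decay_positive t1 t2 : 0 < t1 -> t1 < t2 ->
  (forall t x, t1 <= t <= t2 -> 0 <= x <= L -> Qp <= h t x <= Hmax) ->
  expR (2 * lambda * t2) * Et t2 <= expR (2 * lambda * t1) * Et t1.
Proof.
move=> t10 t12 hQ.
apply: (total_energy_decay mu_gt0 sigma_gt0 L_gt0 F t10 t12) => t tt.
have tt' : t1 <= t <= t2 by case/andP: tt => ? ?; rewrite !ltW.
have t0 := sub_oo12 t10 tt'; have t0' := ltW t0.
have hQt x : 0 <= x <= L -> Qp <= h t x <= Hmax by exact: hQ.
have cvx : {within `[0, L], continuous (vx t)}.
  by apply: joint_slice (oo_pos t0) (rf_vx F).
have dh y : 0 < y < L -> is_derive y 1 (h t) (P t y) by exact: (rf_hP F t0').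
have dv y : 0 < y < L -> is_derive y 1 (v t) (vx t y).
  by move=> yL; case: (rf_der_v F t0 yL).
have [v0 vL _ _] := rf_bc F t0'; have mass := rf_mass F t0'.
apply: (feedback_power omega_gt0 k_gt0 q_gt0 C_gt0 C4_gt0 k_small).
- have A0 := friction_ge0 Qp_gt0 (vx t) hQt; have B0 := slope_sqr_ge0 L (P t).
  by rewrite addr_ge0// mulr_ge0 ?mulr_ge0// ltW.
- apply: (input_sqr_le g_gt0 mu_gt0 L_gt0 m_gt0 delta_gt0 Qp_gt0 Hmax_gt0 (cht t0') (cPt t0')
    (cvt t0') cvx dh dv v0 vL hQt mass).
  + rewrite -/(momentum_gain mu L m Hmax delta Qp) /Qp /C momentum_gain_floor//.
  + rewrite -/(drop_gain g mu L) /C /input_gain.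
    have := drop_gain_gt0 g_gt0 mu_gt0 L_gt0.
    have := momentum_gain_gt0 mu_gt0 L_gt0 m_gt0 Hmax_gt0 delta_gt0 Q_gt0.
    by rewrite -/Q; move: (momentum_gain _ _ _ _ _ _) (drop_gain _ _ _) => a b a0 b0; lra.
- exact: (energy_le g_gt0 mu_gt0 sigma_gt0 L_gt0 delta_gt0 Qp_gt0 Hmax_gt0 (cht t0') (cPt t0')
    (cvt t0') cvx dh dv v0 vL hQt mass).
- exact: fb.
Qed.

(** The local balance laws hold for positive times; the initial time is
    reached by continuity. *)
Let decay_from0 t : 0 <= t ->
  (forall s x, 0 <= s <= t -> 0 <= x <= L -> Qp <= h s x <= Hmax) ->
  expR (2 * lambda * t) * Et t <= Et 0.
Proof.
move=> /[dup] tge0; rewrite le_eqVlt => /predU1P[<-|t0] hQ.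
  by rewrite mulr0 expR0 mul1r.
rewrite -lerN2.
have c1 : {within `[0, +oo[, continuous (fun s : R => expR (2 * lambda * s))}.
  by apply: within_expR; within_tac.
have := @within_le_at0 R (fun s => - (expR (2 * lambda * s) * Et s))
  (- (expR (2 * lambda * t) * Et t)) t t0.
rewrite mulr0 expR0 mul1r; apply; first by within_tac.
move=> s /andP[s0 st]; rewrite lerN2; apply: decay_positive => // u x /andP[su ut].
by apply: hQ; rewrite ut andbT (le_trans (ltW s0)).
Qed.

(** As long as V <= r, the heights lie in [Q_1, Hmax[. For a short while
    afterwards they still lie in [Qp, Hmax], and there the weighted energy
    decreases, so that V <= r continues to hold. *)
Let energy_bounded : Et 0 <= r -> forall t, 0 <= t -> Et t <= r.
Proof.
move=> E0; apply: (continuous_induction Et_cont E0) => T T0 hT.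
have ETr : Et T <= r by apply: hT; rewrite T0 lexx.
have hr s x : 0 <= s <= T -> 0 <= x <= L -> Qp <= h s x <= Hmax.
  move=> sT xL; have s0 : 0 <= s by case/andP: sT.
  case/andP: (height_range s0 (hT s sT) xL) => h1 h2.
  by rewrite (ltW h2) andbT (le_trans _ h1)// ltW.
have [c cL hc] := EVT_max (ltW L_gt0) (cht T0).
have cL' : 0 <= c <= L by move: cL; rewrite in_itv.
have /andP[_ hcH] := height_range T0 ETr cL'.
have [d1 d10 hd1] := joint_unif (rf_h F) (At T0) (etrans (subr_gt0 _ _) Qp_lt : 0 < Q - Qp).
have [d2 d20 hd2] := joint_unif (rf_h F) (At T0) (etrans (subr_gt0 _ _) hcH : 0 < Hmax - h T c).
have [e [e0 ed1 ed2 _ _]] := small_pos4 d10 d20 d10 d10.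
exists e => // t /andP[Tt tTe]; have t0 : 0 <= t := le_trans T0 Tt.
have hQ s x : 0 <= s <= t -> 0 <= x <= L -> Qp <= h s x <= Hmax.
  move=> /andP[s0 st] xL; have [sT|Ts] := leP s T; first by apply: hr => //; rewrite s0.
  have sT : `|s - T| <= e.
    by rewrite ger0_norm ?subr_ge0 ?(ltW Ts)// lerBlDl (le_trans st).
  have := hd1 s x (At s0) (le_lt_trans sT ed1) xL.
  have := hd2 s x (At s0) (le_lt_trans sT ed2) xL.
  have /andP[h1 _] := height_range T0 ETr xL.
  have h2 : h T x <= h T c by apply: hc; rewrite in_itv.
  rewrite !ltr_norml => /andP[_ a1] /andP[a2 _].
  by apply/andP; split; lra.
apply: le_trans E0; apply: le_trans (decay_from0 t0 hQ).
have E_ge0 : 0 <= Et t by rewrite addr_ge0 ?En_ge0.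
rewrite -[leLHS]mul1r ler_wpM2r// -expR0 ler_expR.
by rewrite !mulr_ge0// ltW.
Qed.

Local Notation norm2 t := (xi t ^+ 2 + w t ^+ 2 + itg 0 L (fun x => (h t x - m / L) ^+ 2) +
  itg 0 L (fun x => P t x ^+ 2) + itg 0 L (fun x => v t x ^+ 2)).

Lemma flow_decay :
  in_X_V g mu sigma L m k q delta r (xi 0) (w 0) (h 0) (v 0) ->
  forall t, 0 <= t ->
    in_X_V g mu sigma L m k q delta r (xi t) (w t) (h t) (v t) /\
    Xnorm L (xi t) (w t) (fun x => h t x - m / L) (v t) <=
      Num.sqrt (norm_upper g mu sigma delta k q Q Hmax / norm_lower g mu delta k q Q Hmax) *
      expR (- (lambda * t)) *
      Xnorm L (xi 0) (w 0) (fun x => h 0 x - m / L) (v 0).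
Proof.
have [c1 c1E] : exists c, c = norm_lower g mu delta k q Q Hmax by eexists.
have [c2 c2E] : exists c, c = norm_upper g mu sigma delta k q Q Hmax by eexists.
rewrite -c1E -c2E => -[_ V0r] t t0.
have dh (s : R) : 0 <= s -> forall x : R, 0 < x < L -> is_derive x 1 (h s) (P s x).
  by move=> s0 x xL; exact: (rf_hP F s0 xL).
have hp (s : R) : 0 <= s -> forall x : R, 0 <= x <= L -> 0 < h s x.
  by move=> s0 x; exact: (rf_h_gt0 F s0).
have VE (s : R) : 0 <= s -> V_fun g mu sigma L m k q delta (xi s) (w s) (h s) (v s) = Et s.
  by move=> s0; exact: (V_fun_smooth _ _ _ _ L_gt0 (cht s0) (cPt s0) (cvt s0) (dh s s0) (hp s s0)).
have z0 : 0 <= (0 : R) by [].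
have E0 : Et 0 <= r by rewrite -VE.
have Er := energy_bounded E0.
have hQH (s x : R) : 0 <= s -> 0 <= x <= L -> Q <= h s x <= Hmax.
  by move=> s0 xL; case/andP: (height_range s0 (Er s s0) xL) => -> /ltW ->.
have hQpH (s x : R) : 0 <= s <= t -> 0 <= x <= L -> Qp <= h s x <= Hmax.
  move=> /andP[s0 _] xL; case/andP: (hQH s x s0 xL) => h1 ->.
  by rewrite andbT (le_trans _ h1)// ltW.
have [v0 vL _ _] := rf_bc F t0.
split.
  split; last by rewrite VE// Er.
  exact: (in_S_smooth L_gt0 (cht t0) (cPt t0) (cvt t0) (dh t t0) (hp t t0) _ _ (rf_mass F t0)).
rewrite (Xnorm_smooth _ L_gt0 (cht t0) (cPt t0) (cvt t0) (dh t t0)).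
rewrite (Xnorm_smooth _ L_gt0 (cht z0) (cPt z0) (cvt z0) (dh 0 z0)).
have c10 : 0 < c1 by rewrite c1E norm_lower_gt0.
have c20 : 0 < c2 by rewrite c2E norm_upper_gt0.
have lo := total_ge m (cht t0) (cPt t0) (cvt t0) (hp t t0) k g_gt0 mu_gt0 sigma_gt0 delta_gt0
  q_gt0 Q_gt0 Hmax_gt0 (fun x => hQH t x t0) (xi t) (w t).
have up := total_le m (cht z0) (cPt z0) (cvt z0) (hp 0 z0) k g_gt0 mu_gt0 sigma_gt0 delta_gt0
  q_gt0 Q_gt0 Hmax_gt0 (fun x => hQH 0 x z0) (xi 0) (w 0).
have dec := decay_from0 t0 hQpH.
move: lo up; rewrite -c1E -c2E => lo up.
have n0 : 0 <= norm2 0.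
  by rewrite !addr_ge0 ?sqr_ge0//; apply: itg_ge0 => x _; exact: sqr_ge0.
have main : norm2 t <= c2 / c1 * expR (- (lambda * t)) ^+ 2 * norm2 0.
  rewrite -(ler_pM2l c10); apply: (le_trans lo).
  rewrite -(ler_pM2l (expR_gt0 (2 * lambda * t))); apply: (le_trans dec).
  apply: (le_trans up); rewrite -expRM_natl.
  rewrite [leRHS](_ : _ = expR (2 * lambda * t) * expR (2 * - (lambda * t)) * (c2 * norm2 0)).
    have e0 : 2 * lambda * t + 2 * - (lambda * t) = 0 by ring.
    by rewrite -expRD e0 expR0 mul1r.
  move: (expR _) (expR _) (norm2 0) => a b n.
  by field; rewrite gt_eqF.
rewrite (le_trans (ler_wsqrtr main))// sqrtrM; last first.
  by rewrite mulr_ge0 ?sqr_ge0// divr_ge0 ?ltW.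
rewrite sqrtrM ?divr_ge0 ?(ltW c10) ?(ltW c20)// sqrtr_sqr ger0_norm// expR_ge0.
Qed.
End stability.

Theorem theorem1 (R : realType) (g mu sigma L m Hmax : R)
    (g_gt0 : 0 < g) (mu_gt0 : 0 < mu) (sigma_gt0 : 0 < sigma)
    (L_gt0 : 0 < L) (m_gt0 : 0 < m) (Hmax_gt0 : 0 < Hmax)
    (hstar_lt_Hmax : m / L < Hmax)
    (omega k q delta : R)
    (omega_gt0 : 0 < omega) (k_gt0 : 0 < k) (q_gt0 : 0 < q)
    (delta_gt0 : 0 < delta)
    (r : R) (r_ge0 : 0 <= r) (r_lt : r < R_const g mu sigma L m Hmax delta)
    (k_lt : k < q * theta g mu sigma L m Hmax omega delta r) :
  exists M lambda : R, 0 < M /\ 0 < lambda /\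
    forall (xi w : R -> R) (h v : R -> R -> R) (f : R -> R),
      classical_solution g mu sigma L m xi w h v f ->
      feedback_law mu L omega k q delta xi w h v f ->
      in_X_V g mu sigma L m k q delta r (xi 0) (w 0) (h 0) (v 0) ->
      forall t : R, 0 <= t ->
        in_X_V g mu sigma L m k q delta r (xi t) (w t) (h t) (v t) /\
        Xnorm L (xi t) (w t) (fun x => h t x - m / L) (v t) <=
          M * expR (- (lambda * t)) *
          Xnorm L (xi 0) (w 0) (fun x => h 0 x - m / L) (v 0).
Proof.
exists (Num.sqrt (norm_upper g mu sigma delta k q (Q1 g mu sigma L m delta r) Hmax /
    norm_lower g mu delta k q (Q1 g mu sigma L m delta r) Hmax)).
exists (decay_exponent g mu sigma L m Hmax omega k q delta r); split.
  by rewrite sqrtr_gt0; apply: norm_ratio_gt0.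
split; first exact: decay_exponent_gt0.
move=> xi w h v f sol fb init t t0.
have [P [ht [hxt [hxx [hxxx [vx [vt [vxx F]]]]]]]] := classical_regular L_gt0 sol.
exact: (flow_decay g_gt0 mu_gt0 sigma_gt0 L_gt0 m_gt0 Hmax_gt0 hstar_lt_Hmax omega_gt0
  k_gt0 q_gt0 delta_gt0 r_ge0 r_lt k_lt F fb init t0).
Qed.
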